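(* Let $1<\alpha<2$. For all sufficiently large $T_1$, i.e. there exists $T_*>0$ (depending only on $\alpha$ and $\Omega$) such that for every $T_1\ge T_*$ and every $T_2>T_1$, there exists a constant $d<1$, depending on $\alpha$, $T_1$ and $T_2$, such that $$0<\frac{Q_n(T_1)\,S_n(T_2)}{S_n(T_1)\,Q_n(T_2)}\le d,\qquad n=1,2,\dots .$$
   Context: $\Omega\subset\mathbb R^N$ ($N\in\{1,2,3\}$) is a bounded domain with sufficiently smooth boundary; $\{\lambda_n\}_{n\ge1}$ are the eigenvalues (counted with multiplicity, in nondecreasing order) of $-\Delta$ on $\Omega$ with homogeneous Dirichlet boundary condition. $E_{\alpha,\beta}(z)=\sum_{k=0}^\infty \frac{z^k}{\Gamma(\alpha k+\beta)}$ is the Mittag-Leffler function. For $t>0$, $S_n(t):=E_{\alpha,1}(-\lambda_n t^\alpha)$ and $Q_n(t):=t^\alpha E_{\alpha,\alpha+1}(-\lambda_n t^\alpha)$. *)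

(* Defs.v *)
From HB Require Import structures.
From mathcomp Require Import all_boot all_order all_algebra.
From mathcomp Require Import all_classical all_reals all_analysis.

Set Implicit Arguments.
Unset Strict Implicit.
Unset Printing Implicit Defensive.

Import Order.TTheory GRing.Theory Num.Theory.
Import numFieldNormedType.Exports.

Local Open Scope classical_set_scope.
Local Open Scope ring_scope.

(* Euler's integral; only meaningful for 0 < x, the integral diverges for
   x <= 0. *)
Definition Gamma (R : realType) (x : R) : R :=
  Rintegral lebesgue_measure `]0, +oo[ (fun t : R => t `^ (x - 1) * expR (- t)).

(* Intended for 0 < a and 0 < b, so that Gamma is only used at positive
   arguments and the series converges for every z. *)
Definition mittag_leffler (R : realType) (a b z : R) : R :=
  limn (series (fun k : nat => z ^+ k / Gamma (a * k%:R + b))).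

Definition S_ml (R : realType) (alpha lambda t : R) : R :=
  mittag_leffler alpha 1 (- lambda * t `^ alpha).

Definition Q_ml (R : realType) (alpha lambda t : R) : R :=
  t `^ alpha * mittag_leffler alpha (alpha + 1) (- lambda * t `^ alpha).

Section Domains.
Context {R : realType} {N : nat}.
Local Notation E := 'rV[R]_N.

Definition partial (i : 'I_N) (f : E -> R) : E -> R :=
  fun x => 'D_(delta_mx 0 i) f x.

Fixpoint class_C (k : nat) (U : set E) (f : E -> R) : Prop :=
  (forall x, U x -> {for x, continuous f}) /\
  if k is k'.+1 then
    forall i : 'I_N,
      (forall x, U x -> derivable f x (delta_mx 0 i)) /\
      class_C k' U (partial i f)
  else True.

Definition laplacian (f : E -> R) : E -> R :=
  fun x => \sum_(i < N) partial i (partial i f) x.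

Definition boundary (Omega : set E) : set E :=
  closure Omega `\` interior Omega.

(* Omega is locally a strict sublevel set of a C^k function without critical
   points; for 1 <= k this is the usual notion of a domain lying locally on one
   side of its boundary, the latter being a C^k hypersurface. *)
Definition C_boundary (k : nat) (Omega : set E) : Prop :=
  forall x, boundary Omega x ->
  exists (U : set E) (phi : E -> R),
    [/\ open U, U x, class_C k U phi,
        forall y, U y -> exists i : 'I_N, partial i phi y != 0
      & forall y, U y -> (Omega y <-> phi y < 0)].

Definition bounded_domain (Omega : set E) : Prop :=
  [/\ open Omega, connected Omega, Omega !=set0 & bounded_set Omega].

(* Classical solutions of - laplacian u = mu u in Omega, u = 0 on the boundary.
   The values of u outside the closure of Omega are irrelevant, which is why
   linear independence and span are tested on Omega only below. *)
Definition dirichlet_eigenspace (Omega : set E) (mu : R) : set (E -> R) :=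
  [set u | [/\ class_C 2 Omega u,
               {within closure Omega, continuous u},
               forall x, boundary Omega x -> u x = 0
             & forall x, Omega x -> - laplacian u x = mu * u x]].

(* m is the dimension of dirichlet_eigenspace Omega mu (m = 0 when mu is not an
   eigenvalue). *)
Definition dirichlet_multiplicity (Omega : set E) (mu : R) (m : nat) : Prop :=
  exists f : 'I_m -> E -> R,
    [/\ forall i, dirichlet_eigenspace Omega mu (f i),
        forall c : 'I_m -> R,
          (forall x, Omega x -> \sum_(i < m) c i * f i x = 0) ->
          forall i, c i = 0
      & forall u, dirichlet_eigenspace Omega mu u ->
          exists c : 'I_m -> R,
            forall x, Omega x -> u x = \sum_(i < m) c i * f i x].

(* lambda n stands for the (n+1)-st eigenvalue. Every real number occurs in the
   sequence as many times as its multiplicity, so the sequence is determined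
   by Omega. *)
Definition dirichlet_eigenvalues (Omega : set E) (lambda : nat -> R) : Prop :=
  {homo lambda : m n / (m <= n)%N >-> m <= n} /\
  forall mu : R, exists m : nat,
    ([set n | lambda n = mu] #= `I_m)%card /\ dirichlet_multiplicity Omega mu m.

End Domains.

(* Main.v *)
Require Import Defs.
From HB Require Import structures.
From mathcomp Require Import all_boot all_order all_algebra.
From mathcomp Require Import all_classical all_reals all_analysis.
From mathcomp Require Import measurable_realfun ring lra.
From mathcomp Require Import complex.

Import Order.TTheory GRing.Theory Num.Theory.
Import numFieldNormedType.Exports.
Import ComplexField.Normc.

Set Implicit Arguments.
Unset Strict Implicit.
Unset Printing Implicit Defensive.

Local Open Scope classical_set_scope.
Local Open Scope ring_scope.

Local Notation mu := lebesgue_measure.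
Local Notation pos R := [set` `](0 : R), +oo[].

(* Write u_i = - S_n(T_i). Since lambda Q_n = 1 - S_n, the quotient equals
   (1 + u_1) u_2 / (u_1 (1 + u_2)), so it suffices that 0 < u_1 <= 1 and that
   u_2 <= q u_1 with 0 < q < 1 independent of n. As S_n(t) = f(lambda^(1/a) t) with
   f(t) = E_{a,1}(- t^a), this follows from f(t) = - A t^(-a) + O(t^(-2a)), A > 0,
   together with the matching bound on increments of the remainder.

   The expansion is read off the representation
   pi f(t) = int_0^oo Im (e^{ts} s^a / (s^a + 1)) dr / r over a ray s = r e^{i th},
   pi/2 < th < pi/a, by splitting s^a / (s^a + 1) = s^a - s^{2a} / (s^a + 1).
   Both sides of the representation have the same Laplace transform: that of f is
   computed termwise, and that of the ray integral by rotating the ray to th -> 0+,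
   where the pole at the Laplace variable contributes a Poisson kernel. Lerch's
   theorem concludes.

   The scale at which the expansion becomes effective is uniform in n because the
   first Dirichlet eigenvalue is positive, by the maximum principle. *)

(** [Tstar] is fixed before T1 and T2, so k = T2 / T1 may be arbitrarily close to 1. The main terms
    of u_1 and u_2 then differ only by A t^(-a) (1 - k^(-a)), which a pointwise error O(t^(-2a))
    would swamp. The bound on increments of the remainder carries the same factor 1 - k^(-a), and
    this gives a contraction q < 1 for every k > 1 beyond one common scale.

    The condition th > pi/2 makes e^{ts} decay along the ray; th < pi/a keeps the ray, and the whole
    sector between it and the positive half-line, away from the zeros of s^a + 1. The two are
    compatible exactly because a < 2. As a > 0, the integrand is integrable at the origin, so the
    rays can start there and no arc around 0 is needed.

    Lerch's theorem asks for the Laplace transforms only at the real points 3 + n, so the Laplace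
    variable never has to be complex and no inversion formula enters. *)

Lemma is_derive_mulfun (R : realType) (f g : R -> R) (x df dg : R) :
  is_derive x 1 f df -> is_derive x 1 g dg ->
  is_derive x 1 (fun y => f y * g y) (df * g x + f x * dg).
Proof.
move=> hf hg; have := is_deriveM hf hg.
move=> h; apply: is_derive_eq h _.
by rewrite /GRing.scale/= addrC (mulrC (g x)).
Qed.

Lemma is_derive_addfun (R : realType) (f g : R -> R) (x df dg : R) :
  is_derive x 1 f df -> is_derive x 1 g dg ->
  is_derive x 1 (fun y => f y + g y) (df + dg).
Proof. exact: is_deriveD. Qed.

Lemma is_derive_oppfun (R : realType) (f : R -> R) (x df : R) :
  is_derive x 1 f df -> is_derive x 1 (fun y => - f y) (- df).
Proof. exact: is_deriveN. Qed.

Lemma is_derive_mull (R : realType) (a x : R) : is_derive x 1 (fun y : R => a * y) a.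
Proof.
have := is_derive_mulfun (is_derive_cst a x 1) (is_derive_id x 1).
by move=> h; apply: is_derive_eq h _; rewrite mul0r add0r mulr1.
Qed.

Lemma is_derive_mulr (R : realType) (a x : R) : is_derive x 1 (fun y : R => y * a) a.
Proof.
have := is_derive_mulfun (is_derive_id x 1) (is_derive_cst a x 1).
by move=> h; apply: is_derive_eq h _; rewrite mulr0 addr0 mul1r.
Qed.

Lemma is_derive_invfun (R : realType) (f : R -> R) (x df : R) : f x != 0 ->
  is_derive x 1 f df -> is_derive x 1 (fun y => (f y)^-1) (- df / f x ^+ 2).
Proof.
move=> fx0 hf.
apply: is_derive_eq (is_deriveV fx0 hf) _.
by rewrite /GRing.scale/= mulNr mulNr mulrC.
Qed.

Lemma is_derive_expfun (R : realType) (f : R -> R) (x df : R) :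
  is_derive x 1 f df -> is_derive x 1 (fun y => expR (f y)) (df * expR (f x)).
Proof.
move=> hf; have := is_derive1_comp (is_derive_expR (f x)) hf.
by move=> h; apply: is_derive_eq h _; rewrite mulrC.
Qed.

Lemma is_derive_continuous (R : realType) (f : R -> R) (x df : R) :
  is_derive x 1 f df -> {for x, continuous f}.
Proof. by case=> fd _; exact/differentiable_continuous/derivable1_diffP. Qed.

(** * The Gamma function and the Mittag-Leffler series *)

Lemma continuous_measurable_pos (R : realType) (f : R -> R) :
  (forall r : R, 0 < r -> {for r, continuous f}) -> measurable_fun (pos R) f.
Proof.
move=> cf; apply: open_continuous_measurable_fun; first exact: interval_open.
by move=> r; rewrite inE/= in_itv/= andbT => /cf.
Qed.

Lemma integrable_pos_itvP (R : realType) (f : R -> R) :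
  mu.-integrable (pos R) (EFin \o f) <-> mu.-integrable `[(0:R), +oo[ (EFin \o f).
Proof.
split => [fi|]; last first.
  by apply: integrableS => //; apply: subset_itvr; rewrite bnd_simp.
apply/integrableP; split.
  apply/measurable_EFinP; rewrite -(@setU1itv _ R +oo%O 0 false)//.
  apply/measurable_funU => //; split; first exact: measurable_fun_set1.
  by have /integrableP[/measurable_EFinP] := fi.
move/integrableP : fi => [mf].
by rewrite integral_itv_obnd_cbnd//; exact: measurableT_comp.
Qed.

Lemma integrable_oneDsqrV (R : realType) :
  mu.-integrable (pos R) (fun r : R => (1 + r ^+ 2)^-1%:E).
Proof.
apply/(@integrable_pos_itvP R); apply/integrableP; split.
  apply/measurable_EFinP; apply: measurable_funTS.
  exact: (continuous_measurable_fun (@continuous_oneDsqrV R)).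
under eq_integral do rewrite /= ger0_norm ?invr_ge0 ?addr_ge0 ?sqr_ge0//.
by rewrite integral0y_oneDsqr ltry.
Qed.

(** C / (1 + r^2) is the majorant used for most ray integrals: it is bounded at 0, decays
    quadratically and can be chosen uniformly in the angle. *)
Lemma integrable_dominated (R : realType) (f : R -> R) (C : R) :
  measurable_fun (pos R) f ->
  (forall r : R, 0 < r -> `|f r| <= C / (1 + r ^+ 2)) ->
  mu.-integrable (pos R) (EFin \o f).
Proof.
move=> mf fC.
apply: (@le_integrable _ _ _ mu (pos R) _ _ (fun r : R => (C%:E * (1 + r ^+ 2)^-1%:E)%E)) => //.
- exact/measurable_EFinP.
- move=> r /=; rewrite in_itv/= andbT => r0; rewrite lee_fin.
  exact: le_trans (fC _ r0) (ler_norm _).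
- by apply: integrableZl => //; exact: integrable_oneDsqrV.
Qed.

Lemma powR_expR_bounded (R : realType) (y t : R) : 0 <= y -> 0 < t ->
  exists2 C : R, 0 < C & forall r : R, 0 < r -> r `^ y * expR (- (r * t)) <= C.
Proof.
rewrite le_eqVlt => /predU1P[<-|y0] t0.
  exists 1 => // r r0; rewrite powRr0 mul1r expR_le1 oppr_le0.
  by rewrite mulr_ge0// ltW.
(* The constant is (y / t)^y, from ln x <= x - 1 at x = r t / y; the resulting factor e^{-y} is
   dropped. *)
exists (expR (- (y * ln (t / y)))) => [|r r0]; first exact: expR_gt0.
rewrite /powR gt_eqF// -expRD ler_expR.
have : ln (r * (t / y)) <= r * (t / y) - 1.
  have := @le_ln1Dx R (r * (t / y) - 1); rewrite addrCA subrr addr0; apply.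
  by rewrite ltrBDl subrr mulr_gt0// divr_gt0.
rewrite lnM ?posrE ?divr_gt0// -(ler_pM2l y0) mulrDr mulrBr mulr1.
by rewrite mulrCA (mulrCA y t) mulfV ?gt_eqF// mulr1; lra.
Qed.

(** The bound at exponent y absorbs the 1 in 1 + r^2, the bound at y + 2 absorbs the r^2. *)
Lemma powR_expR_dominated (R : realType) (y t : R) : 0 <= y -> 0 < t ->
  exists2 C : R, 0 < C &
    forall r : R, 0 < r -> r `^ y * expR (- (r * t)) <= C / (1 + r ^+ 2).
Proof.
move=> y0 t0; have [C1 C10 h1] := powR_expR_bounded y0 t0.
have y20 : 0 <= y + 2 by rewrite addr_ge0.
have [C2 C20 h2] := powR_expR_bounded y20 t0.
exists (C1 + C2) => [|r r0]; first exact: addr_gt0.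
rewrite ler_pdivlMr; last by rewrite ltr_pwDl ?sqr_ge0.
rewrite mulrDr mulr1 lerD ?h1//; have := h2 _ r0.
rewrite powRD; last by rewrite (gt_eqF r0) implybT.
by rewrite (powR_mulrn 2 (ltW r0)) mulrAC; exact.
Qed.

Lemma integrable_powR_expR (R : realType) (y t : R) : 0 <= y -> 0 < t ->
  mu.-integrable (pos R) (fun r => (r `^ y * expR (- (r * t)))%:E).
Proof.
move=> y0 t0; have [C C0 h] := powR_expR_dominated y0 t0.
apply: (@integrable_dominated _ _ C).
  apply: measurable_funTS; apply: measurable_funM; first exact: measurable_powR.
  apply: continuous_measurable_fun => r.
  apply: continuous_comp; last exact: continuous_expR.
  by apply: continuousN; apply: cvgM; [exact: cvg_id|exact: cvg_cst].
by move=> r r0; rewrite ger0_norm ?h// mulr_ge0 ?powR_ge0 ?expR_ge0.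
Qed.

Lemma continuous_powR (R : realType) (y x : R) : 0 < x ->
  {for x, continuous (fun r : R => r `^ y)}.
Proof.
move=> x0; apply/differentiable_continuous/derivable1_diffP.
by apply: derivable_powR; rewrite in_itv/= x0.
Qed.

(** Substitution u = t r in Euler's integral. For 1 <= x the integrand is continuous up to 0 from
    the right, as the substitution rule on the closed half-line requires. *)
Lemma Gamma_scale (R : realType) (x t : R) : 1 <= x -> 0 < t ->
  \int[mu]_(r in pos R) (r `^ (x - 1) * expR (- (r * t))) =
  Gamma x * t `^ (- x).
Proof.
move=> x1 t0; have y0 : 0 <= x - 1 by rewrite subr_ge0.
pose G (u : R) := u `^ (x - 1) * expR (- u).
have Gi : mu.-integrable (pos R) (EFin \o G).
  apply: eq_integrable (integrable_powR_expR y0 ltr01) => //.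
  by move=> u _; rewrite mulr1.
have D1 : derive1 (fun r : R => t * r) = cst t.
  apply/funext => r; rewrite derive1E.
  by have h := is_derive_mull t r; rewrite derive_val.
have cG : {within `[(0 : R), +oo[, continuous G}.
  apply/continuous_within_itvcyP; split.
    move=> u; rewrite in_itv/= andbT => u0.
    have h1 := is_derive1_powR (x - 1) u0.
    have h2 := is_derive_expfun (is_derive_oppfun (is_derive_id u 1)).
    exact: is_derive_continuous (is_derive_mulfun h1 h2).
  rewrite /G; apply: cvgM; last first.
    apply: cvg_at_right_filter; apply: continuous_comp.
      exact: continuousN.
    exact: continuous_expR.
  move: y0; rewrite le_eqVlt => /predU1P[<-|y0].
    by rewrite powRr0; under eq_fun do rewrite powRr0; exact: cvg_cst.
  by rewrite powR0 ?gt_eqF//; exact: powR_cvg0.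
have Hsub : (\int[mu]_(u in `[0%R, +oo[) (G u)%:E =
    \int[mu]_(r in `[0%R, +oo[)
      (((G \o (fun r => t * r)%R) * derive1 (fun r : R => t * r)%R)%R r)%:E)%E.
  rewrite -[in X in X = _](mulr0 t).
  apply: (@increasing_ge0_integration_by_substitutiony R (fun r => t * r) G 0).
  - by move=> a b _ _ ab; rewrite ltr_pM2l.
  - by rewrite D1 => a _; exact: cvg_cst.
  - by rewrite D1; apply/cvg_ex; exists t; exact: cvg_cst.
  - by rewrite D1; apply/cvg_ex; exists t; exact: cvg_cst.
  - split.
      move=> a _; apply: derivableM; [exact: derivable_cst|exact: derivable_id].
    apply: cvg_at_right_filter; apply: cvgM; [exact: cvg_cst|exact: cvg_id].
  - exact: gt0_cvgMry.
  - by rewrite mulr0.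
  - by move=> a _; rewrite mulr_ge0 ?powR_ge0 ?expR_ge0.
rewrite D1 in Hsub.
have hi := integrable_powR_expR y0 t0.
suff -> : Gamma x = t `^ x * \int[mu]_(r in pos R) (r `^ (x - 1) * expR (- (r * t))).
  by rewrite powRN mulrAC mulfV ?mul1r// gt_eqF// powR_gt0.
rewrite -RintegralZl// /Gamma /Rintegral; congr fine.
have mG : measurable_fun (pos R) (EFin \o G) by have /integrableP[] := Gi.
rewrite (integral_itv_obnd_cbnd mG) Hsub.
rewrite -integral_itv_obnd_cbnd; last first.
  apply/measurable_EFinP; apply: (@continuous_measurable_pos R) => r r0.
  have h1 := is_derive_continuous (is_derive_mull t r).
  apply: continuousM; last exact: cvg_cst.
  apply: continuous_comp => //; move/continuous_within_itvcyP : cG => [cG _].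
  by apply: cG; rewrite in_itv/= mulr_gt0.
apply: eq_integral => r; rewrite inE/= in_itv/= andbT => r0; congr EFin.
transitivity (G (t * (r : R)) * t); first by [].
rewrite /G powRM ?ltW//.
have -> : t `^ x = t `^ (x - 1) * t by rewrite mulrC mulr_powRB1 ?ltW// (lt_le_trans ltr01).
by rewrite [in RHS](mulrC r t); ring.
Qed.

Lemma integral_expRN (R : realType) (t : R) : 0 < t ->
  (\int[mu]_(r in pos R) (expR (- (r * t)))%:E = t^-1%:E)%E.
Proof.
move=> t0; pose F (r : R) := - t^-1 * expR (- (t * r)).
have dF (r : R) : is_derive r 1 F (expR (- (r * t))).
  have h := is_derive_mulfun (is_derive_cst (- t^-1) r 1)
    (is_derive_expfun (is_derive_oppfun (is_derive_mull t r))).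
  apply: is_derive_eq h _; rewrite mul0r add0r mulrA mulrNN mulVf ?gt_eqF//.
  by rewrite mul1r mulrC.
have cf (r : R) : {for r, continuous (fun r : R => expR (- (r * t)))}.
  exact: is_derive_continuous (is_derive_expfun (is_derive_oppfun (is_derive_mulr t r))).
rewrite integral_itv_obnd_cbnd; last first.
  by apply/measurable_EFinP; apply: (@continuous_measurable_pos R) => r _; exact: cf.
rewrite (@ge0_continuous_FTC2y R _ F 0 0).
- by rewrite sub0e /F mulr0 oppr0 expR0 mulr1 EFinN oppeK.
- by move=> r _; exact: expR_ge0.
- apply/continuous_within_itvcyP; split; first by move=> r _; exact: cf.
  by apply: cvg_at_right_filter; exact: cf.
- rewrite /F -(mulr0 (- t^-1)); apply: cvgM; first exact: cvg_cst.
  apply: (cvg_comp (fun r => t * r) (fun y => expR (- y))); last exact: cvgr_expR.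
  exact: gt0_cvgMry.
- by move=> r _; exact: ex_derive.
- by apply: cvg_at_right_filter; exact: is_derive_continuous (dF 0).
- by move=> r _; rewrite derive1E derive_val.
Qed.

Lemma Gamma1 (R : realType) : Gamma (1 : R) = 1.
Proof.
rewrite /Gamma /Rintegral.
under eq_integral do rewrite subrr powRr0 mul1r -[X in - X]mulr1.
by rewrite integral_expRN// invr1.
Qed.

Lemma integrable_Gamma (R : realType) (x : R) : 1 <= x ->
  mu.-integrable (pos R) (fun u => (u `^ (x - 1) * expR (- u))%:E).
Proof.
move=> x1; have y0 : 0 <= x - 1 by rewrite subr_ge0.
apply: eq_integrable (integrable_powR_expR y0 ltr01) => //.
by move=> u _; rewrite mulr1.
Qed.

(** Keeps only the part of Euler's integral over [M, M + 1]. As M is free, Gamma (a k + b) outgrows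
    every geometric sequence in k, which is all that is used of its growth. *)
Lemma Gamma_ge (R : realType) (x M : R) : 1 <= x -> 0 < M ->
  M `^ (x - 1) * expR (- (M + 1)) <= Gamma x.
Proof.
move=> x1 M0; have gi := integrable_Gamma x1.
have y0 : 0 <= x - 1 by rewrite subr_ge0.
rewrite -lee_fin /Gamma /Rintegral fineK; last exact: integrable_fin_num.
have mg : measurable_fun (pos R) (fun u : R => (u `^ (x - 1) * expR (- u))%:E).
  by have /integrableP[] := gi.
apply: (@le_trans _ _ (\int[mu]_(u in `[M, (M + 1)%R]) (u `^ (x - 1) * expR (- u))%:E)%E); last first.
  apply: ge0_subset_integral => //.
  - by move=> u _; rewrite lee_fin mulr_ge0 ?powR_ge0 ?expR_ge0.
  - by move=> u /=; rewrite !in_itv/= andbT => /andP[/(lt_le_trans M0)].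
apply: (@le_trans _ _ (\int[mu]_(u in `[M, (M + 1)%R]) (cst (M `^ (x - 1) * expR (- (M + 1)))%:E u))%E).
  rewrite integral_cst//= lebesgue_measure_itv/= lte_fin ltrDl ltr01.
  by rewrite -EFinB addrAC subrr add0r mule1.
apply: ge0_le_integral => //.
- by move=> u _; rewrite lee_fin mulr_ge0 ?powR_ge0 ?expR_ge0.
- apply: measurable_funS mg => //.
  by move=> u /=; rewrite !in_itv/= andbT => /andP[/(lt_le_trans M0)].
- move=> u /=; rewrite in_itv/= => /andP[Mu uM1]; rewrite lee_fin.
  apply: ler_pM; rewrite ?powR_ge0 ?expR_ge0//; last by rewrite ler_expR lerN2.
  by apply: ge0_ler_powR; rewrite ?nnegrE// ?ltW// (lt_le_trans M0).
Qed.

Lemma Gamma_gt0 (R : realType) (x : R) : 1 <= x -> 0 < Gamma x.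
Proof.
move=> x1; apply: lt_le_trans (Gamma_ge x1 ltr01).
by rewrite mulr_gt0 ?expR_gt0// powR_gt0.
Qed.

Lemma ml_term_bound (R : realType) (a b z : R) : 0 < a -> 1 <= b ->
  exists2 C : R, 0 < C & forall k : nat,
    `|z ^+ k / Gamma (a * k%:R + b)| <= C * 2^-1 ^+ k.
Proof.
(* With M^a = A the lower bound for Gamma contains A^k, and |z| / A <= 1/2. *)
move=> a0 b1; pose A := 2 * `|z| + 1; pose M := A `^ a^-1.
have A1 : 1 <= A by rewrite lerDr mulr_ge0.
have A0 : 0 < A by exact: lt_le_trans A1.
have M0 : 0 < M by exact: powR_gt0.
have M1 : 1 <= M by rewrite -(powRr0 A) ler_powR// invr_ge0 ltW.
exists (expR (M + 1)) => [|k]; first exact: expR_gt0.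
have ak0 : 0 <= a * k%:R by rewrite mulr_ge0// ltW.
have x1 : 1 <= a * k%:R + b by rewrite (le_trans b1)// lerDr.
have G0 := Gamma_gt0 x1.
have Gk : A ^+ k * expR (- (M + 1)) <= Gamma (a * k%:R + b).
  apply: le_trans (Gamma_ge x1 M0); rewrite ler_wpM2r ?expR_ge0//.
  have -> : A ^+ k = M `^ (a * k%:R).
    by rewrite /M -powRrM mulrA mulVf ?gt_eqF// mul1r powR_mulrn// ltW.
  by rewrite ler_powR// -addrA lerDl subr_ge0.
rewrite normrM normfV normrX (gtr0_norm G0) ler_pdivrMr//.
apply: le_trans (ler_wpM2l _ Gk); last by rewrite mulr_ge0 ?expR_ge0// exprn_ge0.
have -> : expR (M + 1) * 2^-1 ^+ k * (A ^+ k * expR (- (M + 1))) = (2^-1 * A) ^+ k.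
  by rewrite exprMn expRN; field; rewrite gt_eqF ?expR_gt0.
apply: lerXn2r; rewrite ?nnegrE//.
- by rewrite mulr_ge0// ltW.
- by rewrite /A; have := normr_ge0 z; lra.
Qed.

Lemma is_cvg_ml_norm (R : realType) (a b z : R) : 0 < a -> 1 <= b ->
  cvgn [normed series (fun k : nat => z ^+ k / Gamma (a * k%:R + b))].
Proof.
move=> a0 b1; have [C C0 h] := ml_term_bound z a0 b1.
apply: (@series_le_cvg _ _ (geometric C 2^-1)) => [k|k|k|].
- exact: normr_ge0.
- by rewrite /= mulr_ge0 ?exprn_ge0// ltW.
- exact: h.
- apply: is_cvg_geometric_series; rewrite ger0_norm ?invr_ge0//.
  by rewrite invf_lt1 ?ltr1n.
Qed.

Lemma cvg_ml (R : realType) (a b z : R) : 0 < a -> 1 <= b ->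
  series (fun k : nat => z ^+ k / Gamma (a * k%:R + b)) @ \oo -->
    mittag_leffler a b z.
Proof. by move=> a0 b1; apply: normed_cvg; exact: is_cvg_ml_norm. Qed.

(** With z = - lambda t^a this is lambda Q = 1 - S: the series is shifted by one index, its constant
    term being 1 / Gamma 1. *)
Lemma ml_shift (R : realType) (a z : R) : 0 < a ->
  mittag_leffler a 1 z = 1 + z * mittag_leffler a (a + 1) z.
Proof.
move=> a0; have a1 : 1 <= a + 1 by rewrite lerDr ltW.
have h1 := @cvg_ml R a 1 z a0 (lexx 1); have h2 := @cvg_ml R a _ z a0 a1.
have h3 : (fun n => 1 + z * series (fun k : nat => z ^+ k / Gamma (a * k%:R + (a + 1))) n)
   @ \oo --> (1 + z * mittag_leffler a (a + 1) z).
  by apply: cvgD; [exact: cvg_cst|apply: cvgM; [exact: cvg_cst|exact: h2]].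
move: h1; rewrite -cvg_shiftS => h1.
apply: (cvg_unique _ h1) => //.
rewrite (_ : (fun n => _) = (fun n => 1 + z * series (fun k : nat => z ^+ k / Gamma (a * k%:R + (a + 1))) n))//.
apply/funext => n; rewrite /series/= big_nat_recl//= expr0 mulr0 add0r Gamma1 divr1.
congr (_ + _); rewrite mulr_sumr; apply: eq_bigr => k _.
rewrite exprS -mulrA; congr (_ * (_ / Gamma _)).
by rewrite -natr1 mulrDr mulr1 addrA.
Qed.

(** * Holomorphic functions in polar coordinates *)

(** Integrability of [k] makes the truncated integrals converge by domination, whatever the sign of
    [k], so limits of [K] along the cut-offs 1 / (n + 2) and n + 2 are enough. *)
Lemma FTC_pos (R : realType) (k K : R -> R) (l0 l1 : R) :
  mu.-integrable (pos R) (EFin \o k) ->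
  (forall r : R, 0 < r -> {for r, continuous k}) ->
  (forall r : R, 0 < r -> is_derive r 1 K (k r)) ->
  K (n.+2%:R^-1) @[n --> \oo] --> l0 ->
  K n.+2%:R @[n --> \oo] --> l1 ->
  \int[mu]_(r in pos R) k r = l1 - l0.
Proof.
move=> ki ck dK K0 K1.
(* The shift by 2 keeps every interval nondegenerate: 1 / (n + 2) < 1 < n + 2, already at n = 0. *)
pose A n : set R := [set` `[(n.+2%:R^-1 : R), n.+2%:R]].
have Apos n : A n `<=` pos R.
  move=> r; rewrite /A/= !in_itv/= andbT => /andP[+ _].
  by apply: lt_le_trans; rewrite invr_gt0 ltr0n.
have mk : measurable_fun (pos R) k by have /integrableP[/measurable_EFinP] := ki.
have kA (n : nat) :
    (\int[mu]_(r in pos R) (k \_ (A n)) r)%R = K n.+2%:R - K n.+2%:R^-1.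
  rewrite -Rintegral_mkcondr.
  rewrite (_ : _ `&` A n = A n); last by apply/setIidPr; exact: Apos.
  have n1 : (n.+2%:R^-1 < n.+2%:R :> R).
    by apply: (@lt_trans _ _ 1); rewrite ?invf_lt1 ?ltr0n ?ltr1n.
  have ppos r : r \in `[n.+2%:R^-1, n.+2%:R] -> 0 < r.
    by rewrite in_itv/= => /andP[+ _]; apply: lt_le_trans; rewrite invr_gt0 ltr0n.
  rewrite /Rintegral (continuous_FTC2 n1 (F := K))//=.
  - apply: continuous_in_subspaceT => r /set_mem rA; apply: ck; exact: ppos.
  - split.
    + move=> r rA; have := dK r; case=> //; apply: ppos.
      exact: subset_itv_oo_cc rA.
    + apply: cvg_at_right_filter; apply: is_derive_continuous (dK _ _).
      by rewrite invr_gt0 ltr0n.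
    + by apply: cvg_at_left_filter; apply: is_derive_continuous (dK _ _); rewrite ltr0n.
  - move=> r rA; have h : is_derive r 1 K (k r).
      by apply: dK; apply: ppos; exact: subset_itv_oo_cc rA.
    by rewrite derive1E derive_val.
have l : (\int[mu]_(r in pos R) (k \_ (A n)) r)%R @[n --> \oo] --> \int[mu]_(r in pos R) k r.
  apply: fine_cvg; rewrite fineK; last exact: integrable_fin_num.
  apply: (@dominated_cvg _ _ _ mu (pos R) _ _ _ (fun r => `|k r|%:E)) => //.
  - move=> n; apply/measurable_EFinP; apply/measurable_restrict => //.
      exact: measurable_itv.
    by apply: measurable_funS mk => //; exact: subIsetl.
  - move=> r; rewrite /= in_itv/= andbT => r0.
    apply: cvg_near_cst; near=> n; congr EFin; rewrite /patch ifT//.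
    rewrite inE /A/= in_itv/=; apply/andP; split.
      rewrite -[leRHS]invrK lef_pV2 ?posrE ?invr_gt0//.
      apply: (@le_trans _ _ n%:R); last by rewrite ler_nat -addn2 leq_addr.
      by near: n; exact: nbhs_infty_ger.
    apply: (@le_trans _ _ n%:R); last by rewrite ler_nat -addn2 leq_addr.
    by near: n; exact: nbhs_infty_ger.
  - exact: integrable_norm.
  - move=> n r _; rewrite lee_fin /patch.
    by case: ifP => // _; rewrite normr0.
move: l; under eq_fun do rewrite kA; move=> l.
by apply: (cvg_unique _ l) => //; exact: cvgB.
Unshelve. all: by end_near. Qed.

(** Taken coordinatewise, so that integration and mean value arguments stay on real functions. *)
Definition is_cderive (R : realType) (x : R) (f : R -> R[i]) (l : R[i]) :=
  is_derive x 1 (fun y => complex.Re (f y)) (complex.Re l) /\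
  is_derive x 1 (fun y => complex.Im (f y)) (complex.Im l).

Lemma Re_add (R : realType) (x y : R[i]) :
  complex.Re (x + y) = complex.Re x + complex.Re y.
Proof. by case: x y => [a b] [c d]. Qed.

Lemma Im_add (R : realType) (x y : R[i]) :
  complex.Im (x + y) = complex.Im x + complex.Im y.
Proof. by case: x y => [a b] [c d]. Qed.

Lemma Re_mul (R : realType) (x y : R[i]) : complex.Re (x * y) =
  complex.Re x * complex.Re y - complex.Im x * complex.Im y.
Proof. by case: x y => [a b] [c d]. Qed.

Lemma Im_mul (R : realType) (x y : R[i]) : complex.Im (x * y) =
  complex.Re x * complex.Im y + complex.Im x * complex.Re y.
Proof. by case: x y => [a b] [c d]. Qed.

Lemma Re_inv (R : realType) (x : R[i]) : complex.Re x^-1 =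
  complex.Re x / (complex.Re x ^+ 2 + complex.Im x ^+ 2).
Proof. by case: x. Qed.

Lemma Im_inv (R : realType) (x : R[i]) : complex.Im x^-1 =
  - complex.Im x / (complex.Re x ^+ 2 + complex.Im x ^+ 2).
Proof. by case: x => a b /=; rewrite mulNr. Qed.

Lemma Re_opp (R : realType) (x : R[i]) : complex.Re (- x) = - complex.Re x.
Proof. by case: x. Qed.

Lemma Im_opp (R : realType) (x : R[i]) : complex.Im (- x) = - complex.Im x.
Proof. by case: x. Qed.

Lemma is_cderive_cst (R : realType) (x : R) (a : R[i]) : is_cderive x (fun=> a) 0.
Proof. by split; exact: is_derive_cst. Qed.

Lemma is_cderiveD (R : realType) (x : R) (f g : R -> R[i]) (df dg : R[i]) :
  is_cderive x f df -> is_cderive x g dg ->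
  is_cderive x (fun y => f y + g y) (df + dg).
Proof.
move=> [f1 f2] [g1 g2]; split.
  by under eq_fun do rewrite Re_add; rewrite Re_add; exact: is_derive_addfun.
by under eq_fun do rewrite Im_add; rewrite Im_add; exact: is_derive_addfun.
Qed.

Lemma is_cderiveN (R : realType) (x : R) (f : R -> R[i]) (df : R[i]) :
  is_cderive x f df -> is_cderive x (fun y => - f y) (- df).
Proof.
move=> [f1 f2]; split.
  by under eq_fun do rewrite Re_opp; rewrite Re_opp; exact: is_derive_oppfun.
by under eq_fun do rewrite Im_opp; rewrite Im_opp; exact: is_derive_oppfun.
Qed.

Lemma is_cderiveM (R : realType) (x : R) (f g : R -> R[i]) (df dg : R[i]) :
  is_cderive x f df -> is_cderive x g dg ->
  is_cderive x (fun y => f y * g y) (df * g x + f x * dg).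
Proof.
move=> [f1 f2] [g1 g2]; split.
  under eq_fun do rewrite Re_mul.
  have h := is_derive_addfun (is_derive_mulfun f1 g1)
    (is_derive_oppfun (is_derive_mulfun f2 g2)).
  by apply: is_derive_eq h _; rewrite Re_add !Re_mul; ring.
under eq_fun do rewrite Im_mul.
have h := is_derive_addfun (is_derive_mulfun f1 g2) (is_derive_mulfun f2 g1).
by apply: is_derive_eq h _; rewrite Im_add !Im_mul; ring.
Qed.

Lemma sqrReIm_neq0 (R : realType) (z : R[i]) : z != 0 ->
  complex.Re z ^+ 2 + complex.Im z ^+ 2 != 0.
Proof. by case: z => a b; rewrite paddr_eq0 ?sqr_ge0// !sqrf_eq0 eq_complex. Qed.

Lemma is_cderiveV (R : realType) (x : R) (f : R -> R[i]) (df : R[i]) :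
  f x != 0 -> is_cderive x f df ->
  is_cderive x (fun y => (f y)^-1) (- df / f x ^+ 2).
Proof.
move=> fx0 [f1 f2]; have n0 := sqrReIm_neq0 fx0.
have h : is_derive x 1 (fun y => (complex.Re (f y) ^+ 2 + complex.Im (f y) ^+ 2)^-1) 
   (- (2 * complex.Re (f x) * complex.Re df + 2 * complex.Im (f x) * complex.Im df) 
    / (complex.Re (f x) ^+ 2 + complex.Im (f x) ^+ 2) ^+ 2).
  apply: is_derive_invfun => //.
  have h := is_derive_addfun (is_derive_mulfun f1 f1) (is_derive_mulfun f2 f2).
  under eq_fun do rewrite !expr2.
  by apply: is_derive_eq h _; ring.
split.
  under eq_fun do rewrite Re_inv.
  apply: is_derive_eq (is_derive_mulfun f1 h) _.
  move: n0; case: (f x) => a b; case: df {f1 f2 h} => p q /= n0.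
  rewrite expr2 /=; field; rewrite -expr2 n0 andbT.
  by rewrite (_ : _ + _ = (a ^+ 2 + b ^+ 2) ^+ 2) ?sqrf_eq0//; ring.
under eq_fun do rewrite Im_inv.
apply: is_derive_eq (is_derive_mulfun (is_derive_oppfun f2) h) _.
move: n0; case: (f x) => a b; case: df {f1 f2 h} => p q /= n0.
rewrite expr2 /=; field; rewrite -expr2 n0 andbT.
by rewrite (_ : _ + _ = (a ^+ 2 + b ^+ 2) ^+ 2) ?sqrf_eq0//; ring.
Qed.

Lemma is_cderive_eq (R : realType) (x : R) (f : R -> R[i]) (l l' : R[i]) :
  is_cderive x f l -> l = l' -> is_cderive x f l'.
Proof. by move=> + <-. Qed.

(* [holo H r th d]: seen as a function of s = r e^{i th}, [H] has complex
   derivative d / e^{i th}, i.e. the polar Cauchy-Riemann equations hold. *)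
Definition holo (R : realType) (H : R -> R -> R[i]) (r th : R) (d : R[i]) :=
  is_cderive r (fun x => H x th) d /\
  is_cderive th (fun y => H r y) ('i%C * r%:C%C * d).

Lemma holo_eq (R : realType) (H : R -> R -> R[i]) (r th : R) (d d' : R[i]) :
  holo H r th d -> d = d' -> holo H r th d'.
Proof. by move=> + <-. Qed.

Lemma holo_cst (R : realType) (a : R[i]) (r th : R) : holo (fun _ _ => a) r th 0.
Proof. by split; rewrite ?mulr0; exact: is_cderive_cst. Qed.

Lemma holoD (R : realType) (H K : R -> R -> R[i]) (r th : R) (dH dK : R[i]) :
  holo H r th dH -> holo K r th dK ->
  holo (fun x y => H x y + K x y) r th (dH + dK).
Proof.
by move=> [h1 h2] [k1 k2]; split; rewrite ?mulrDr; exact: is_cderiveD.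
Qed.

Lemma holoN (R : realType) (H : R -> R -> R[i]) (r th : R) (dH : R[i]) :
  holo H r th dH -> holo (fun x y => - H x y) r th (- dH).
Proof. by move=> [h1 h2]; split; rewrite ?mulrN; exact: is_cderiveN. Qed.

Lemma holoM (R : realType) (H K : R -> R -> R[i]) (r th : R) (dH dK : R[i]) :
  holo H r th dH -> holo K r th dK ->
  holo (fun x y => H x y * K x y) r th (dH * K r th + H r th * dK).
Proof.
move=> [h1 h2] [k1 k2]; split; first exact: is_cderiveM.
by apply: is_cderive_eq (is_cderiveM h2 k2) _; ring.
Qed.

Lemma holoV (R : realType) (H : R -> R -> R[i]) (r th : R) (dH : R[i]) :
  H r th != 0 -> holo H r th dH ->
  holo (fun x y => (H x y)^-1) r th (- dH / H r th ^+ 2).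
Proof.
move=> H0 [h1 h2]; split; first exact: is_cderiveV.
by apply: is_cderive_eq (is_cderiveV H0 h2) _; rewrite !mulNr !mulrN !mulrA.
Qed.

Definition cis (R : realType) (x : R) : R[i] := (cos x +i* sin x)%C.

(* the branch s^a of the power function at s = r e^{i th} *)
Definition spow (R : realType) (a r th : R) : R[i] := (r `^ a)%:C%C * cis (a * th).

(* e^{t s} at s = r e^{i th} *)
Definition sexp (R : realType) (t r th : R) : R[i] :=
  (expR (t * r * cos th))%:C%C * cis (t * r * sin th).

Lemma is_cderive_real (R : realType) (x : R) (f : R -> R) (df : R) :
  is_derive x 1 f df -> is_cderive x (fun y => (f y)%:C%C) df%:C%C.
Proof. by move=> h; split => //=; exact: is_derive_cst. Qed.

Lemma is_cderive_cis (R : realType) (x : R) (f : R -> R) (df : R) :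
  is_derive x 1 f df -> is_cderive x (fun y => cis (f y)) ('i%C * df%:C%C * cis (f x)).
Proof.
move=> h; split => /=.
  have := is_derive1_comp (is_derive_cos (f x)) h.
  by move=> k; apply: is_derive_eq k _; ring.
have := is_derive1_comp (is_derive_sin (f x)) h.
by move=> k; apply: is_derive_eq k _; ring.
Qed.

Lemma holo_spow (R : realType) (a r th : R) : 0 < r ->
  holo (spow a) r th ((a / r)%:C%C * spow a r th).
Proof.
move=> r0; have h := is_cderive_real (is_derive1_powR a r0); split.
  apply: is_cderive_eq (is_cderiveM h (is_cderive_cst _ _)) _.
  rewrite mulr0 addr0 /spow mulrA -rmorphM/=; congr (_%:C%C * _).
  by rewrite powRB ?(gt_eqF r0) ?implybT// powRr1 ?ltW// mulrA mulrAC.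
apply: is_cderive_eq (is_cderiveM (is_cderive_cst _ _) (is_cderive_cis (is_derive_mull a th))) _.
rewrite mul0r add0r /spow.
have -> : a%:C%C = r%:C%C * (a / r)%:C%C by rewrite -rmorphM/= mulrC divfK ?gt_eqF.
by ring.
Qed.

Lemma holo_sexp (R : realType) (t r th : R) :
  holo (sexp t) r th (t%:C%C * cis th * sexp t r th).
Proof.
split.
  have h1 := is_derive_mulfun (is_derive_mull t r) (is_derive_cst (cos th) r 1).
  have h2 := is_derive_mulfun (is_derive_mull t r) (is_derive_cst (sin th) r 1).
  apply: is_cderive_eq (is_cderiveM (is_cderive_real (is_derive_expfun h1)) (is_cderive_cis h2)) _.
  rewrite !mulr0 !addr0 /sexp.
  rewrite (_ : cis th = (cos th)%:C%C + 'i%C * (sin th)%:C%C); last first.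
    by apply/eqP; rewrite eq_complex/= ; apply/andP; split; apply/eqP; ring.
  rewrite !rmorphM /=; ring.
have h1 := is_derive_mulfun (is_derive_cst (t * r) th 1) (is_derive_cos th).
have h2 := is_derive_mulfun (is_derive_cst (t * r) th 1) (is_derive_sin th).
apply: is_cderive_eq (is_cderiveM (is_cderive_real (is_derive_expfun h1)) (is_cderive_cis h2)) _.
rewrite !mul0r !add0r /sexp.
rewrite (_ : cis th = (cos th)%:C%C + 'i%C * (sin th)%:C%C); last first.
  by apply/eqP; rewrite eq_complex/= ; apply/andP; split; apply/eqP; ring.
rewrite /cst !rmorphM rmorphN /=.
have := sqr_i R; rewrite expr2 => i2.
ring: i2.
Qed.

Lemma normr_Re_le (R : realType) (z : R[i]) : `|complex.Re z| <= normc z.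
Proof.
case: z => a b /=; rewrite -sqrtr_sqr ler_sqrt ?lerDl ?sqr_ge0//.
by rewrite addr_ge0 ?sqr_ge0.
Qed.

Lemma normr_Im_le (R : realType) (z : R[i]) : `|complex.Im z| <= normc z.
Proof.
case: z => a b /=; rewrite -sqrtr_sqr ler_sqrt ?lerDr ?sqr_ge0//.
by rewrite addr_ge0 ?sqr_ge0.
Qed.

Lemma cvg_invn2 (R : realType) : (n.+2%:R^-1 : R) @[n --> \oo] --> (0 : R).
Proof.
have h := @cvg_harmonic R.
by move: h; rewrite -cvg_shiftS.
Qed.

(* The derivative in [th] is a total derivative in [r], whose integral
   vanishes because of the decay of [H] at both ends. *)
Lemma rotation (R : realType) (H dH : R -> R -> R[i]) (u v C : R) : 0 <= C ->
  (forall r th : R, 0 < r -> u < th < v -> holo H r th (dH r th)) ->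
  (forall r th : R, 0 < r -> u < th < v ->
     {for r, continuous (fun x => complex.Re (dH x th))}) ->
  (forall r th : R, 0 < r -> u < th < v -> normc (H r th) / r <= C / (1 + r ^+ 2)) ->
  (forall r th : R, 0 < r -> u < th < v -> normc (dH r th) <= C / (1 + r ^+ 2)) ->
  forall th1 th2 : R, u < th1 < v -> u < th2 < v ->
  \int[mu]_(r in pos R) (complex.Im (H r th1) / r) =
  \int[mu]_(r in pos R) (complex.Im (H r th2) / r).
Proof.
move=> C0 hH cdH bH bdH.
pose f th r := complex.Im (H r th) / r.
have D2 (r : R) : 0 < 1 + r ^+ 2 by rewrite ltr_pwDl ?sqr_ge0.
have cf th : u < th < v -> forall r : R, 0 < r -> {for r, continuous (f th)}.
  move=> uv r r0; have [[_ h] _] := hH _ _ r0 uv.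
  have rn0 : r != 0 by rewrite gt_eqF.
  have h2 := @is_derive_invfun R id r 1 rn0 (is_derive_id r 1).
  exact: is_derive_continuous (is_derive_mulfun h h2).
have fi th : u < th < v -> mu.-integrable (pos R) (EFin \o f th).
  move=> uv; apply: (@integrable_dominated _ _ C).
    by apply: continuous_measurable_pos; exact: cf.
  move=> r r0; apply: le_trans (bH _ _ r0 uv).
  by rewrite /f normrM normfV (gtr0_norm r0) ler_pM2r ?invr_gt0// normr_Im_le.
have dk th : u < th < v -> \int[mu]_(r in pos R) complex.Re (dH r th) = 0.
  move=> uv; rewrite -[RHS](subrr 0).
  have bK (r : R) : 0 < r -> `|complex.Re (H r th)| <= C * (r / (1 + r ^+ 2)).
    move=> r0; apply: le_trans (normr_Re_le _) _.
    by have := bH _ _ r0 uv; rewrite ler_pdivrMr// mulrAC -mulrA.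
  apply: (@FTC_pos _ _ (fun r => complex.Re (H r th))).
  - apply: (@integrable_dominated _ _ C).
      by apply: continuous_measurable_pos => r r0; exact: cdH.
    by move=> r r0; apply: le_trans (normr_Re_le _) _; exact: bdH.
  - by move=> r r0; exact: cdH.
  - by move=> r r0; have [[]] := hH _ _ r0 uv.
  - apply: norm_cvg0; apply: (@squeeze_cvgr _ _ _ _ (cst 0) (fun n => C * n.+2%:R^-1)).
    + near=> n; rewrite normr_ge0/=; apply: (le_trans (bK _ _)).
        by rewrite invr_gt0 ltr0n.
      apply: ler_wpM2l => //; rewrite ler_pdivrMr//.
      by rewrite ler_peMr ?lerDl ?sqr_ge0// invr_ge0 ler0n.
    + exact: cvg_cst.
    + by rewrite -(mulr0 C); apply: cvgM; [exact: cvg_cst|exact: cvg_invn2].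
  - apply: norm_cvg0; apply: (@squeeze_cvgr _ _ _ _ (cst 0) (fun n => C * n.+2%:R^-1)).
    + near=> n; rewrite normr_ge0/=; apply: (le_trans (bK _ _)).
        by rewrite ltr0n.
      apply: ler_wpM2l => //; rewrite ler_pdivrMr// mulrDr mulr1 expr2 mulrA.
      by rewrite mulVf ?mul1r ?lerDr ?invr_ge0 ?ler0n// pnatr_eq0.
    + exact: cvg_cst.
    + by rewrite -(mulr0 C); apply: cvgM; [exact: cvg_cst|exact: cvg_invn2].
(* Im (i r d) = r Re d: the factor 1 / r cancels, and the angular derivative of the integrand is Re
   dH, the radial derivative of Re H. *)
have df th r : u < th < v -> 0 < r -> is_derive th 1 (fun y => f y r) (complex.Re (dH r th)).
  move=> uv r0; have [_ [_ h]] := hH _ _ r0 uv.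
  have := is_derive_mulfun h (is_derive_cst r^-1 th 1).
  move=> k; apply: is_derive_eq k _; rewrite mulr0 addr0.
  rewrite (_ : complex.Im _ = r * complex.Re (dH r th)); last first.
    by case: (dH r th) => a b /=; ring.
  by rewrite mulrAC mulfV ?mul1r// gt_eqF.
pose F th := \int[mu]_(r in pos R) f th r.
pose G (r : R) := C / (1 + r ^+ 2).
have G0 r : 0 <= G r by rewrite divr_ge0// ltW.
have Gi : mu.-integrable (pos R) (EFin \o G).
  apply: (@integrable_dominated _ _ C).
    apply: measurable_funTS; apply: measurable_funM; first exact: measurable_cst.
    exact: (continuous_measurable_fun (@continuous_oneDsqrV R)).
  by move=> r _; rewrite ger0_norm.
have d1 th r : u < th < v -> 0 < r -> partial1of2 f th r = complex.Re (dH r th).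
  by move=> uv r0; rewrite partial1of2E; have := df _ _ uv r0 => k; rewrite derive_val.
have dF th : u < th < v -> is_derive th 1 F 0.
  move=> uv.
  have Ith : [set` `]u, v[] th by rewrite /= in_itv.
  have A1 : forall x, [set` `]u, v[] x -> mu.-integrable (pos R) (EFin \o f x).
    by move=> x; rewrite /= in_itv/= => /fi.
  have A2 : forall x y, [set` `]u, v[] x -> pos R y -> derivable (f ^~ y) x 1.
    move=> x y; rewrite /= !in_itv/= andbT => uvx y0.
    by have [] := df _ _ uvx y0.
  have A3 : forall x y, [set` `]u, v[] x -> pos R y -> `|partial1of2 f x y| <= G y.
    move=> x y; rewrite /= !in_itv/= andbT => uvx y0.
    by rewrite d1//; apply: le_trans (normr_Re_le _) _; exact: bdH.
  apply: DeriveDef.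
    exact: (@derivable_under_integral R _ _ mu f (pos R) (measurable_itv _) th u v Ith A1 A2 G G0 Gi A3).
  rewrite -derive1E.
  rewrite /F (@differentiation_under_integral R _ _ mu f (pos R) (measurable_itv _) th u v Ith A1 A2 G G0 Gi A3).
  rewrite -[RHS](dk _ uv); apply: eq_Rintegral => r.
  by rewrite inE/= in_itv/= andbT => r0; rewrite d1.
suff lt_eq th1 th2 : u < th1 < v -> u < th2 < v -> th1 < th2 -> F th1 = F th2.
  move=> th1 th2 uv1 uv2; have [lt|lt|->//] := ltgtP th1 th2.
    exact: (lt_eq th1 th2).
  by symmetry; exact: (lt_eq th2 th1).
move=> /andP[u1 _] /andP[_ v2] lt.
have uv x : x \in `[th1, th2] -> u < x < v.
  by rewrite in_itv/= => /andP[a b]; rewrite (lt_le_trans u1)//= (le_lt_trans b).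
have [||c cin] := @MVT _ F (fun=> 0) _ _ lt.
- by move=> x /subset_itv_oo_cc /uv /dF.
- apply: derivable_within_continuous => x /uv xuv.
  by have [] := dF _ xuv.
- by rewrite mul0r => /eqP; rewrite subr_eq0 => /eqP ->.
Unshelve. all: by end_near. Qed.

Lemma is_cderive_continuous_Re (R : realType) (x : R) (f : R -> R[i]) (l : R[i]) :
  is_cderive x f l -> {for x, continuous (fun y => complex.Re (f y))}.
Proof. by move=> [h _]; exact: is_derive_continuous h. Qed.

Lemma normc_ge0 (R : realType) (z : R[i]) : 0 <= normc z.
Proof. by case: z => a b; exact: sqrtr_ge0. Qed.

Lemma normc_real (R : realType) (x : R) : normc x%:C%C = `|x|.
Proof. by rewrite /= expr0n /= addr0 sqrtr_sqr. Qed.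

Lemma normc_sqr (R : realType) (z : R[i]) : normc (z ^+ 2) = normc z ^+ 2.
Proof. by rewrite expr2 normcM -expr2. Qed.

Lemma normc_cis (R : realType) (x : R) : normc (cis x) = 1.
Proof. by rewrite /= cos2Dsin2 sqrtr1. Qed.

Lemma normc_spow (R : realType) (a r th : R) : normc (spow a r th) = r `^ a.
Proof. by rewrite /spow normcM normc_real normc_cis mulr1 ger0_norm// powR_ge0. Qed.

Lemma normc_sexp (R : realType) (t r th : R) :
  normc (sexp t r th) = expR (t * r * cos th).
Proof. by rewrite /sexp normcM normc_real normc_cis mulr1 ger0_norm// expR_ge0. Qed.

Lemma normc_gt0 (R : realType) (z : R[i]) : 0 < normc z -> z != 0.
Proof. by apply: contraTneq => ->; rewrite normc0 ltxx. Qed.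

(** Since c >= - k, |z|^2 = x^2 + y^2 + 2 x y c is at least x^2 + y^2 - 2 k x y, which equals (1 -
    k)/2 (x + y)^2 + (1 + k)/2 (x - y)^2. *)
Lemma normc_ge_sum (R : realType) (x y c s k : R) (z : R[i]) :
  c ^+ 2 + s ^+ 2 = 1 -> 0 <= x -> 0 <= y -> - k <= c -> -1 <= k <= 1 ->
  z = ((x + y * c) +i* (y * s))%C ->
  Num.sqrt ((1 - k) / 2) * (x + y) <= normc z.
Proof.
move=> cs x0 y0 kc /andP[k1 k2] ->; rewrite /normc.
rewrite -[X in _ * X <= _]ger0_norm ?addr_ge0// -sqrtr_sqr -sqrtrM; last first.
  by rewrite divr_ge0// subr_ge0.
rewrite ler_sqrt ?addr_ge0 ?sqr_ge0//.
have -> : (x + y * c) ^+ 2 + (y * s) ^+ 2 = x ^+ 2 + y ^+ 2 + 2 * (x * y) * c.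
  by transitivity (x ^+ 2 + y ^+ 2 * (c ^+ 2 + s ^+ 2) + 2 * (x * y) * c);
     [ring|rewrite cs mulr1].
have xyc : - k * (x * y) <= (x * y) * c.
  by rewrite mulrC ler_wpM2l// mulr_ge0.
rewrite -subr_ge0.
have : 0 <= (1 + k) / 2 * (x - y) ^+ 2 by rewrite mulr_ge0 ?sqr_ge0// divr_ge0//; lra.
nra.
Qed.

(** * Kernels on the rays and lower bounds for their denominators *)

Definition Wk (R : realType) (a r th : R) : R[i] := spow a r th / (spow a r th + 1).

(** The factor a / r, instead of a / s, is due to the convention of [holo]: the derivative is e^{i
    th} W'(s). *)
Definition dWk (R : realType) (a r th : R) : R[i] :=
  (a / r)%:C%C * spow a r th / (spow a r th + 1) ^+ 2.

Lemma holo_Wk (R : realType) (a r th : R) : 0 < r -> spow a r th + 1 != 0 ->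
  holo (Wk a) r th (dWk a r th).
Proof.
move=> r0 n0; have h1 := @holo_spow R a r th r0.
have h2 := holoV n0 (holoD h1 (holo_cst 1 r th)).
apply: holo_eq (holoM h1 h2) _; rewrite /dWk.
by move: n0 {h1 h2}; move: (spow a r th) (a / r)%:C%C => S c n0; field.
Qed.

(** W(s) / (sg - s), which is what W(s) e^{ts} becomes when integrated against e^{- sg t} over t >
    0. *)
Definition Hk (R : realType) (a sg r th : R) : R[i] :=
  Wk a r th / (sg%:C%C - spow 1 r th).

Definition dHk (R : realType) (a sg r th : R) : R[i] :=
  dWk a r th / (sg%:C%C - spow 1 r th) +
  Wk a r th * ((1 / r)%:C%C * spow 1 r th) / (sg%:C%C - spow 1 r th) ^+ 2.

Lemma holo_Hk (R : realType) (a sg r th : R) : 0 < r ->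
  spow a r th + 1 != 0 -> sg%:C%C - spow 1 r th != 0 ->
  holo (Hk a sg) r th (dHk a sg r th).
Proof.
move=> r0 n0 n1; have h1 := holo_Wk r0 n0.
have h2 := holoV n1 (holoD (holo_cst sg%:C%C r th) (holoN (@holo_spow R 1 r th r0))).
apply: holo_eq (holoM h1 h2) _; rewrite /dHk.
move: n1 {h1 h2 n0}; move: (spow 1 r th) (Wk a r th) (dWk a r th) (1 / r)%:C%C sg%:C%C.
by move=> S W dW c x n1; field.
Qed.

Lemma normc_spow1_ge (R : realType) (a r th k : R) : 0 <= r ->
  - k <= cos (a * th) -> -1 <= k <= 1 ->
  Num.sqrt ((1 - k) / 2) * (1 + r `^ a) <= normc (spow a r th + 1).
Proof.
move=> r0 hk kk; apply: (normc_ge_sum (cos2Dsin2 (a * th))) => //.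
- exact: powR_ge0.
- by apply/eqP; rewrite eq_complex/=; apply/andP; split; apply/eqP; ring.
Qed.

Lemma normc_sub_spow_ge (R : realType) (sg r th k : R) : 0 <= r -> 0 <= sg ->
  cos th <= k -> -1 <= k <= 1 ->
  Num.sqrt ((1 - k) / 2) * (sg + r) <= normc (sg%:C%C - spow 1 r th).
Proof.
move=> r0 s0 hk kk; apply: (@normc_ge_sum _ _ _ (- cos th) (- sin th)) => //.
- by rewrite !sqrrN cos2Dsin2.
- by rewrite lerN2.
- rewrite /spow powRr1// mul1r.
  by apply/eqP; rewrite eq_complex/=; apply/andP; split; apply/eqP; ring.
Qed.

(** * Rotation of the ray *)

Lemma powR_sub1_le (R : realType) (a r : R) : 1 < a -> 0 < r ->
  r `^ (a - 1) <= 1 + r `^ a.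
Proof.
move=> a1 r0; have [r1|r1] := lerP r 1.
  have : r `^ (a - 1) <= r `^ 0 by apply: ger_powR; rewrite ?r0//; lra.
  by rewrite powRr0; have := powR_ge0 r a; lra.
have : r `^ (a - 1) <= r `^ a by apply: ler_powR; [exact: ltW|lra].
lra.
Qed.

(** Source of the integrable majorants along rays: r^(a-1) (1 + r^2) = r^(a-1) + r r^a is at most (1
    + r^a) + r (1 + r^a). The first summand uses r^(a-1) <= 1 + r^a, hence 1 < a. *)
Lemma powR_sub1_dominated (R : realType) (a r : R) : 1 < a -> 0 < r ->
  r `^ (a - 1) / (1 + r `^ a) / (1 + r) <= (1 + r ^+ 2)^-1.
Proof.
move=> a1 r0; have D0 : 0 < 1 + r ^+ 2 by rewrite ltr_pwDl ?sqr_ge0.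
have qp := powR_sub1_le a1 r0; have p0 := powR_ge0 r a.
have rq : r * r `^ (a - 1) = r `^ a.
  by rewrite mulr_powRB1 ?(ltW r0)// (lt_trans ltr01).
have q2 : r `^ (a - 1) * (1 + r ^+ 2) <= (1 + r `^ a) * (1 + r).
  have -> : r `^ (a - 1) * (1 + r ^+ 2) = r `^ (a - 1) + r * r `^ a.
    by rewrite -rq; ring.
  have : r * r `^ a <= r * (1 + r `^ a) by rewrite ler_pM2l// lerDr.
  by move: qp; lra.
rewrite -[leRHS]mul1r ler_pdivlMr// mulrAC [X in X / _ <= _]mulrAC.
rewrite ler_pdivrMr ?addr_gt0// mul1r ler_pdivrMr; first by rewrite [leRHS]mulrC.
by rewrite ltr_pwDl.
Qed.

Lemma normc_Wk (R : realType) (a r th : R) :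
  normc (Wk a r th) = r `^ a / normc (spow a r th + 1).
Proof. by rewrite /Wk normcM normcV normc_spow. Qed.

Lemma normc_dWk (R : realType) (a r th : R) : 0 < a -> 0 < r ->
  normc (dWk a r th) = a * r `^ (a - 1) / normc (spow a r th + 1) ^+ 2.
Proof.
move=> a0 r0; rewrite /dWk normcM normcV normc_sqr normcM normc_spow normc_real.
rewrite gtr0_norm ?divr_gt0//; congr (_ / _).
by rewrite -(mulr_powRB1 (ltW r0) a0) mulrA divfK// gt_eqF.
Qed.

(** * Uniform estimates in a sector free of poles *)

Section sector.
Variables (R : realType) (a u v : R).
Hypotheses (a1 : 1 < a) (u0 : 0 < u) (uv : u < v) (vpi : v <= pi) (avpi : a * v < pi).

(** Values of the constant of [normc_ge_sum]: [c1], with k = - cos (a v), serves s^a + 1, and [c2],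
    with k = cos u, serves sg - s. They are positive because a v < pi and 0 < u. *)
Let c1 := Num.sqrt ((1 - - cos (a * v)) / 2).
Let c2 := Num.sqrt ((1 - cos u) / 2).

Let a0 : 0 < a. Proof. exact: lt_trans a1. Qed.
Let v0 : 0 < v. Proof. exact: lt_trans uv. Qed.

Lemma sector_c1_gt0 : 0 < c1.
Proof.
have av0 : 0 < a * v by rewrite mulr_gt0.
rewrite sqrtr_gt0 divr_gt0// opprK; suff : -1 < cos (a * v) by lra.
by rewrite -cospi ltr_cos ?in_itv/= ?pi_ge0 ?lexx ?(ltW av0) ?(ltW avpi).
Qed.

Lemma sector_c2_gt0 : 0 < c2.
Proof.
rewrite sqrtr_gt0 divr_gt0//; suff : cos u < 1 by lra.
rewrite -[ltRHS]cos0 ltr_cos ?in_itv/= ?pi_ge0 ?lexx ?(ltW u0) //=.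
exact: le_trans (ltW uv) vpi.
Qed.

Lemma sector_spow1_ge (r th : R) : 0 < r -> u < th < v ->
  c1 * (1 + r `^ a) <= normc (spow a r th + 1).
Proof.
move=> r0 /andP[uth thv]; apply: normc_spow1_ge; first exact: ltW.
  have th0 : 0 < th by exact: lt_trans uth.
  rewrite opprK ltW// ltr_cos ?ltr_pM2l// in_itv/= ?mulr_ge0 ?(ltW avpi) ?ltW//.
  by rewrite (lt_trans _ avpi)// ltr_pM2l.
by rewrite lerN2 cos_le1/= lerNl cos_geN1.
Qed.

Lemma sector_sub_spow_ge (sg r th : R) : 1 <= sg -> 0 < r -> u < th < v ->
  c2 * (1 + r) <= normc (sg%:C%C - spow 1 r th).
Proof.
move=> s1 r0 /andP[uth thv].
have s0 : 0 <= sg by exact: le_trans s1.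
apply: (@le_trans _ _ (c2 * (sg + r))); first by rewrite ler_wpM2l ?sqrtr_ge0 ?lerD2r.
have thpi : th <= pi by rewrite ltW// (lt_le_trans thv).
apply: normc_sub_spow_ge => //; [exact: ltW| |by rewrite cos_le1 cos_geN1].
rewrite ltW// ltr_cos ?in_itv/= ?thpi ?(ltW u0) ?(le_trans (ltW uth))//.
by rewrite (ltW (lt_trans u0 uth)).
Qed.

Lemma sector_spow1_neq0 (r th : R) : 0 < r -> u < th < v -> spow a r th + 1 != 0.
Proof.
move=> r0 h; apply: normc_gt0; apply: lt_le_trans (sector_spow1_ge r0 h).
by rewrite mulr_gt0 ?sector_c1_gt0// ltr_pwDl ?powR_ge0.
Qed.

Lemma sector_sub_spow_neq0 (sg r th : R) : 1 <= sg -> 0 < r -> u < th < v ->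
  sg%:C%C - spow 1 r th != 0.
Proof.
move=> s1 r0 h; apply: normc_gt0; apply: lt_le_trans (sector_sub_spow_ge s1 r0 h).
by rewrite mulr_gt0 ?sector_c2_gt0// addr_gt0.
Qed.

Lemma sector_Hk_bound (sg : R) : 1 <= sg -> exists2 C : R, 0 <= C &
  forall r th : R, 0 < r -> u < th < v ->
    normc (Hk a sg r th) / r <= C / (1 + r ^+ 2) /\
    normc (dHk a sg r th) <= C / (1 + r ^+ 2).
Proof.
move=> s1; have c10 := sector_c1_gt0; have c20 := sector_c2_gt0.
(* [C1] bounds |H| / r; [C2] and [C3] bound the two summands of [dHk]. *)
pose C1 := c1^-1 * c2^-1; pose C2 := a * c1^-1 ^+ 2 * c2^-1.
pose C3 := c1^-1 * c2^-1 ^+ 2.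
have C10 : 0 <= C1 by rewrite /C1 !mulr_ge0// ?invr_ge0 ltW.
have C20 : 0 <= C2 by rewrite /C2 !mulr_ge0// ?exprn_ge0// ?invr_ge0 ltW.
have C30 : 0 <= C3 by rewrite /C3 !mulr_ge0// ?exprn_ge0// ?invr_ge0 ltW.
exists (C1 + C2 + C3) => [|r th r0 h]; first by rewrite !addr_ge0.
have hA := sector_spow1_ge r0 h; have hB := sector_sub_spow_ge s1 r0 h.
set A := normc (spow a r th + 1) in hA; set B := normc (sg%:C%C - spow 1 r th) in hB.
set p := r `^ a in hA; set q := r `^ (a - 1).
have p0 : 0 <= p by exact: powR_ge0.
have q0 : 0 <= q by exact: powR_ge0.
have rq : r * q = p by rewrite /q mulr_powRB1// ltW.
have D0 : 0 < 1 + r ^+ 2 by rewrite ltr_pwDl ?sqr_ge0.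
have A0 : 0 < A by apply: lt_le_trans hA; rewrite mulr_gt0// ltr_pwDl.
have B0 : 0 < B by apply: lt_le_trans hB; rewrite mulr_gt0// addr_gt0.
have iA : A^-1 <= c1^-1 * (1 + p)^-1.
  by rewrite -invfM lef_pV2 ?posrE// mulr_gt0// ltr_pwDl.
have iB : B^-1 <= c2^-1 * (1 + r)^-1.
  by rewrite -invfM lef_pV2 ?posrE// mulr_gt0// addr_gt0.
have pA : p / A <= c1^-1.
  rewrite ler_pdivrMr// (le_trans (_ : p <= 1 + p))//; first by rewrite lerDr.
  by rewrite -(ler_pM2l c10) mulrA mulfV ?gt_eqF// mul1r.
have r2 : 1 + r ^+ 2 <= (1 + r) ^+ 2 by rewrite sqrrD expr1n; have := ltW r0; lra.
have qd : q * (1 + p)^-1 * (1 + r)^-1 <= (1 + r ^+ 2)^-1.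
  exact: powR_sub1_dominated.
have rd : (1 + r)^-1 ^+ 2 <= (1 + r ^+ 2)^-1.
  by rewrite exprVn lef_pV2 ?posrE// exprn_gt0// addr_gt0.
have X1 : normc (Hk a sg r th) / r <= C1 / (1 + r ^+ 2).
  rewrite /Hk normcM normcV normc_Wk -/A -/B -/p -rq.
  have -> : r * q / A / B / r = q * (A^-1 * B^-1) by field; rewrite !gt_eqF.
  apply: (@le_trans _ _ (q * ((c1^-1 * (1 + p)^-1) * (c2^-1 * (1 + r)^-1)))).
    by apply: ler_wpM2l => //; apply: ler_pM; rewrite ?invr_ge0 ?(ltW A0) ?(ltW B0).
  have -> : q * (c1^-1 * (1 + p)^-1 * (c2^-1 * (1 + r)^-1)) =
            C1 * (q * (1 + p)^-1 * (1 + r)^-1) by rewrite /C1; ring.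
  by rewrite ler_wpM2l.
have X2 : normc (dWk a r th / (sg%:C%C - spow 1 r th)) <= C2 / (1 + r ^+ 2).
  rewrite normcM normcV normc_dWk// -/A -/B -/q.
  have -> : a * q / A ^+ 2 / B = a * q * (A^-1 * A^-1 * B^-1).
    by field; rewrite !gt_eqF.
  apply: (@le_trans _ _ (a * q * ((c1^-1 * 1) * (c1^-1 * (1 + p)^-1) * (c2^-1 * (1 + r)^-1)))).
    rewrite ler_wpM2l ?mulr_ge0 ?(ltW a0)//.
    apply: ler_pM; rewrite ?mulr_ge0 ?invr_ge0 ?(ltW A0) ?(ltW B0)//.
    apply: ler_pM; rewrite ?mulr_ge0 ?invr_ge0 ?(ltW A0)//.
    apply: le_trans iA _; rewrite ler_pM2l ?invr_gt0//.
    by rewrite invf_le1 ?lerDl// ltr_pwDl.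
  have -> : a * q * (c1^-1 * 1 * (c1^-1 * (1 + p)^-1) * (c2^-1 * (1 + r)^-1)) =
            C2 * (q * (1 + p)^-1 * (1 + r)^-1) by rewrite /C2; ring.
  by rewrite ler_wpM2l.
have X3 : normc (Wk a r th * ((1 / r)%:C%C * spow 1 r th) /
             (sg%:C%C - spow 1 r th) ^+ 2) <= C3 / (1 + r ^+ 2).
  rewrite normcM normcV normc_sqr normcM normc_Wk normcM normc_spow normc_real -/A -/B -/p.
  rewrite (powRr1 (ltW r0)) gtr0_norm ?divr_gt0// divfK ?gt_eqF// mulr1.
  have -> : p / A / B ^+ 2 = p / A * (B^-1 * B^-1) by field; rewrite !gt_eqF.
  apply: (@le_trans _ _ (c1^-1 * (c2^-1 * (1 + r)^-1 * (c2^-1 * (1 + r)^-1)))).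
    apply: ler_pM; rewrite ?mulr_ge0 ?invr_ge0 ?(ltW A0) ?(ltW B0)//.
    by apply: ler_pM; rewrite ?invr_ge0 ?(ltW B0).
  have -> : c1^-1 * (c2^-1 * (1 + r)^-1 * (c2^-1 * (1 + r)^-1)) =
            C3 * (1 + r)^-1 ^+ 2 by rewrite /C3; ring.
  by rewrite ler_wpM2l.
have Di : 0 <= (1 + r ^+ 2)^-1 by rewrite invr_ge0 ltW.
split.
  by apply: le_trans X1 _; rewrite ler_wpM2r//; lra.
apply: le_trans (le_normcD _ _) _; apply: le_trans (lerD X2 X3) _.
by rewrite -mulrDl ler_wpM2r//; lra.
Qed.

Lemma rotation_Hk (sg th1 th2 : R) : 1 <= sg -> u < th1 < v -> u < th2 < v ->
  \int[mu]_(r in pos R) (complex.Im (Hk a sg r th1) / r) =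
  \int[mu]_(r in pos R) (complex.Im (Hk a sg r th2) / r).
Proof.
move=> s1; have [C C0 hC] := sector_Hk_bound s1.
apply: (@rotation _ _ (dHk a sg) u v C C0).
- move=> r th r0 h; apply: holo_Hk => //; first exact: sector_spow1_neq0.
  exact: sector_sub_spow_neq0.
- move=> r th r0 h; have n0 := sector_spow1_neq0 r0 h.
  have n1 := sector_sub_spow_neq0 s1 r0 h.
  have [hW _] := holo_Wk r0 n0.
  have [hs _] := @holo_spow R a r th r0; have [hs1 _] := @holo_spow R 1 r th r0.
  have rn0 : r != 0 by rewrite gt_eqF.
  (* [dHk] is a polynomial in factors that are differentiable in r, with squares of inverses written
     as products; its continuity follows from differentiability. *)
  have hi := @is_derive_invfun R id r 1 rn0 (is_derive_id r 1).
  have hc c := is_cderive_real (is_derive_mulfun (is_derive_cst c r 1) hi).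
  have hd := is_cderiveD hs (is_cderive_cst r 1).
  have hdi := is_cderiveV n0 hd.
  have he := is_cderiveD (is_cderive_cst r sg%:C%C) (is_cderiveN hs1).
  have hei := is_cderiveV n1 he.
  have hdW := is_cderiveM (is_cderiveM (hc a) hs) (is_cderiveM hdi hdi).
  have h3 := is_cderiveM hdW hei.
  have h4 := is_cderiveM (is_cderiveM hW (is_cderiveM (hc 1) hs1)) (is_cderiveM hei hei).
  have := is_cderive_continuous_Re (is_cderiveD h3 h4).
  rewrite (_ : (fun y : R => _) = (fun x => complex.Re (dHk a sg x th)))//.
  by apply/funext => x; rewrite /dHk /dWk !expr2 !invfM.
- by move=> r th r0 h; have [] := hC _ _ r0 h.
- by move=> r th r0 h; have [] := hC _ _ r0 h.
Qed.

Lemma integrable_Hk (sg th : R) : 1 <= sg -> u < th < v ->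
  mu.-integrable (pos R) (fun r => (complex.Im (Hk a sg r th) / r)%:E).
Proof.
move=> s1 h; have [C C0 hC] := sector_Hk_bound s1.
apply: (@integrable_dominated _ _ C).
  apply: continuous_measurable_pos => r r0.
  have rn0 : r != 0 by rewrite gt_eqF.
  have hi := @is_derive_invfun R id r 1 rn0 (is_derive_id r 1).
  have n0 := sector_spow1_neq0 r0 h; have n1 := sector_sub_spow_neq0 s1 r0 h.
  have [[_ k] _] := holo_Hk r0 n0 n1.
  exact: is_derive_continuous (is_derive_mulfun k hi).
move=> r r0; have [b _] := hC _ _ r0 h; apply: le_trans b.
by rewrite normrM normfV (gtr0_norm r0) ler_pM2r ?invr_gt0// normr_Im_le.
Qed.

End sector.

(** * The Poisson kernel at the Laplace variable *)

Definition Pk (R : realType) (sg r th : R) : R[i] :=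
  spow 1 r th / (sg%:C%C - spow 1 r th).

Lemma sqr_normc_sub_spow (R : realType) (sg r th : R) : 0 < r ->
  normc (sg%:C%C - spow 1 r th) ^+ 2 = (r - sg * cos th) ^+ 2 + (sg * sin th) ^+ 2.
Proof.
move=> r0; rewrite /spow (powRr1 (ltW r0)) mul1r /= sqr_sqrtr ?addr_ge0 ?sqr_ge0//.
have := cos2Dsin2 th; move: (cos th) (sin th) => c s h.
transitivity (sg ^+ 2 - 2 * sg * r * c + r ^+ 2 * (c ^+ 2 + s ^+ 2)); first by ring.
transitivity (r ^+ 2 - 2 * sg * r * c + sg ^+ 2 * (c ^+ 2 + s ^+ 2)); last by ring.
by rewrite h; ring.
Qed.

Lemma Im_Pk (R : realType) (sg r th : R) : 0 < r ->
  complex.Im (Pk sg r th) / r = sg * sin th / normc (sg%:C%C - spow 1 r th) ^+ 2.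
Proof.
move=> r0; rewrite sqr_normc_sub_spow// /Pk Im_mul Re_inv Im_inv.
have -> : complex.Re (sg%:C%C - spow 1 r th) ^+ 2 +
    complex.Im (sg%:C%C - spow 1 r th) ^+ 2 = (r - sg * cos th) ^+ 2 + (sg * sin th) ^+ 2.
  rewrite -sqr_normc_sub_spow//; case: (_ - _) => x y /=.
  by rewrite sqr_sqrtr// addr_ge0 ?sqr_ge0.
rewrite /spow (powRr1 (ltW r0)) mul1r /=.
(* At s = sg both sides are 0, because the inverse of 0 is 0. *)
have [->|D0] := eqVneq ((r - sg * cos th) ^+ 2 + (sg * sin th) ^+ 2) 0.
  by rewrite !invr0 !mulr0 addr0 mul0r.
by field; rewrite D0 gt_eqF.
Qed.

(** The antiderivative arctan ((r - sg cos th) / (sg sin th)) runs from th - pi/2 at r = 0 to pi/2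
    at infinity. The mass tends to pi as th -> 0+, which is how the pole contributes in the
    limit. *)
Lemma Poisson_integral (R : realType) (sg th : R) : 1 <= sg -> 0 < th < pi ->
  mu.-integrable (pos R) (fun r => (complex.Im (Pk sg r th) / r)%:E) /\
  \int[mu]_(r in pos R) (complex.Im (Pk sg r th) / r) = pi - th.
Proof.
move=> s1 /andP[th0 thpi].
have s0 : 0 < sg by exact: lt_le_trans s1.
have sin0 : 0 < sin th by rewrite sin_gt0_pi// th0.
pose g (r : R) := sg * sin th / ((r - sg * cos th) ^+ 2 + (sg * sin th) ^+ 2).
have b0 : 0 < sg * sin th by rewrite mulr_gt0.
have D0 (r : R) : 0 < (r - sg * cos th) ^+ 2 + (sg * sin th) ^+ 2.
  by rewrite ltr_wpDl ?sqr_ge0// exprn_gt0.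
have gE (r : R) : 0 < r -> complex.Im (Pk sg r th) / r = g r.
  by move=> r0; rewrite Im_Pk// sqr_normc_sub_spow.
pose K (r : R) := atan ((r - sg * cos th) * (sg * sin th)^-1).
pose L (r : R) := (r - sg * cos th) * (sg * sin th)^-1.
have dl (r : R) : is_derive r 1 L (sg * sin th)^-1.
  have := is_derive_mulfun (is_derive_addfun (is_derive_id r 1) (is_derive_cst (- (sg * cos th)) r 1))
    (is_derive_cst (sg * sin th)^-1 r 1).
  by move=> k; apply: is_derive_eq k _; rewrite addr0 mul1r mulr0 addr0.
have dK (r : R) : is_derive r 1 K (g r).
  have := is_derive1_comp (is_derive1_atan (L r)) (dl r).
  move=> k; apply: is_derive_eq k _; rewrite /g /L.
  have := D0 r; move: (r - _) (sg * sin th) b0 => x y y0 D.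
  by field; rewrite !gt_eqF//= addrC exprMn.
have cg (r : R) : {for r, continuous g}.
  have h := is_derive_addfun (is_derive_id r 1) (is_derive_cst (- (sg * cos th)) r 1).
  have h2 := is_derive_addfun (is_derive_mulfun h h) (is_derive_cst ((sg * sin th) ^+ 2) r 1).
  have D1 : (r + - (sg * cos th)) * (r + - (sg * cos th)) + (sg * sin th) ^+ 2 != 0.
    by rewrite -expr2 gt_eqF// D0.
  have h3 := @is_derive_invfun R (fun y => (y + - (sg * cos th)) * (y + - (sg * cos th)) +
    (sg * sin th) ^+ 2) r _ D1 h2.
  exact: is_derive_continuous (is_derive_mulfun (is_derive_cst (sg * sin th) r 1) h3).
have gi : mu.-integrable (pos R) (EFin \o g).
  pose c := Num.sqrt ((1 - cos th) / 2).
  have c0 : 0 < c.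
    rewrite sqrtr_gt0 divr_gt0// subr_gt0 -[ltRHS]cos0.
    by rewrite ltr_cos ?in_itv/= ?pi_ge0 ?lexx ?(ltW th0) ?(ltW thpi).
  apply: (@integrable_dominated _ _ (sg * sin th / c ^+ 2)).
    by apply: continuous_measurable_pos => r _; exact: cg.
  move=> r r0; rewrite /g -sqr_normc_sub_spow// ger0_norm ?divr_ge0 ?sqr_ge0 ?(ltW b0)//.
  rewrite -[leRHS]mulrA (ler_pM2l b0) -invfM lef_pV2 ?posrE; last 2 first.
  - by rewrite sqr_normc_sub_spow.
  - by rewrite mulr_gt0 ?exprn_gt0// ltr_pwDl ?sqr_ge0.
  have hk := @normc_sub_spow_ge R sg r th _ (ltW r0) (ltW s0) (lexx _).
  have {}hk : c * (1 + r) <= normc (sg%:C%C - spow 1 r th).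
    apply: le_trans (hk _); last by rewrite cos_le1 cos_geN1.
    by rewrite ler_pM2l// lerD2r.
  apply: (@le_trans _ _ ((c * (1 + r)) ^+ 2)).
    rewrite exprMn ler_pM2l ?exprn_gt0// sqrrD expr1n; have := ltW r0; lra.
  by rewrite lerXn2r ?nnegrE ?normc_ge0// mulr_ge0 ?addr_ge0// ltW.
split.
  apply: eq_integrable gi => //; move=> r; rewrite inE/= in_itv/= andbT => r0.
  by rewrite /= gE.
transitivity (\int[mu]_(r in pos R) g r).
  by apply: eq_Rintegral => r; rewrite inE/= in_itv/= andbT => r0; rewrite gE.
have -> : pi - th = pi / 2 - (th - pi / 2) by lra.
apply: (@FTC_pos _ _ K) => //.
- have -> : th - pi / 2 = K 0.
    rewrite /K add0r.
    have -> : - (sg * cos th) / (sg * sin th) = tan (th - pi / 2).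
      by rewrite /tan sinBpihalf cosBpihalf; field; rewrite !gt_eqF.
    by rewrite tanK// in_itv/=; apply/andP; split; lra.
  apply: (cvg_comp _ _ (@cvg_invn2 R)).
  exact: is_derive_continuous (dK 0).
- apply: (cvg_comp (fun n : nat => (n.+2%:R - sg * cos th) / (sg * sin th)) atan _ (@cvgy_atan R)).
  apply/cvgryPge => A; near=> n.
  rewrite ler_pdivlMr// lerBrDr; apply: (@le_trans _ _ n%:R); last first.
    by rewrite ler_nat -addn2 leq_addr.
  by near: n; exact: nbhs_infty_ger.
Unshelve. all: by end_near. Qed.

(** As a < 2, a th <= 2 th <= pi, and 1 - cos (2 th) = 2 (1 - cos th) (1 + cos th) <= 4 (1 - cos
    th). *)
Lemma sub_cosM_le (R : realType) (a th : R) : 1 < a < 2 -> 0 <= th <= pi / 2 ->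
  1 - cos (a * th) <= 4 * (1 - cos th).
Proof.
move=> /andP[a1 a2] /andP[th0 th1].
have h : cos (th *+ 2) <= cos (a * th).
  have [->|thn] := eqVneq th 0; first by rewrite mulr0 mul0rn.
  have {thn}th0' : 0 < th by rewrite lt_def thn.
  have lt2 : a * th < th *+ 2 by rewrite -[th *+ 2]mulr_natl ltr_pM2r.
  have le2 : th *+ 2 <= pi by rewrite -[th *+ 2]mulr_natl; lra.
  have ath : 0 <= a * th by rewrite mulr_ge0// ltW// (lt_trans ltr01).
  rewrite ltW// ltr_cos// in_itv/= ?ath ?(le_trans (ltW lt2))//=.
  by rewrite le2 (le_trans ath (ltW lt2)).
move: h; rewrite cos_mulr2n => h.
have := cos_le1 th; have := cos_geN1 th; move: (cos th) (cos (a * th)) h => c d.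
nra.
Qed.

Lemma powR_lipschitz (R : realType) (a M x y : R) : 1 < a ->
  0 < x <= M -> 0 < y <= M ->
  `|x `^ a - y `^ a| <= a * M `^ (a - 1) * `|x - y|.
Proof.
move=> a1; wlog xy : x y / x < y => [H hx hy|].
  have [lt|lt|->] := ltgtP x y; first exact: H.
    by rewrite distrC (distrC x); exact: H.
  by rewrite !subrr normr0 mulr0.
move=> /andP[x0 xM] /andP[y0 yM].
have ip z : z \in `[x, y] -> 0 < z.
  by rewrite in_itv/= => /andP[+ _]; exact: lt_le_trans.
have [||c cin h] := @MVT _ (fun z => z `^ a) (fun z => a * z `^ (a - 1)) _ _ xy.
- by move=> z /subset_itv_oo_cc /ip z0; exact: is_derive1_powR.
- apply: derivable_within_continuous => z /ip z0.
  by have [] := is_derive1_powR a z0.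
rewrite distrC h normrM (distrC x) ler_wpM2r//.
have a0 : 0 < a by exact: lt_trans a1.
rewrite ger0_norm ?mulr_ge0 ?powR_ge0 ?(ltW a0)// ler_pM2l//.
have c0 := ip _ (subset_itv_oo_cc cin).
move: cin; rewrite in_itv/= => /andP[_ cy].
apply: ge0_ler_powR; rewrite ?nnegrE ?subr_ge0 ?(ltW a1) ?(ltW c0)//.
  by rewrite (le_trans _ xM)// ltW.
by rewrite (le_trans (ltW cy)).
Qed.

Lemma sqr_normc_spow_sub (R : realType) (a sg r th : R) :
  normc (spow a r th - (sg `^ a)%:C%C) ^+ 2 =
  (r `^ a - sg `^ a) ^+ 2 + 2 * (r `^ a * sg `^ a) * (1 - cos (a * th)).
Proof.
rewrite /spow /= sqr_sqrtr ?addr_ge0 ?sqr_ge0//.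
have := cos2Dsin2 (a * th).
move: (cos _) (sin _) (r `^ a) (sg `^ a) => c s x y h.
transitivity (x ^+ 2 * (c ^+ 2 + s ^+ 2) - 2 * x * y * c + y ^+ 2); first by ring.
by rewrite h; ring.
Qed.

(** By [sqr_normc_spow_sub] both moduli split into a radial and an angular part, compared through
    [powR_lipschitz] and [sub_cosM_le]. The constant is uniform down to th = 0, so difference
    quotients at the pole stay bounded while the ray approaches it. *)
Lemma spow_lipschitz (R : realType) (a sg r th : R) : 1 < a < 2 -> 0 < sg ->
  0 < r <= 2 * sg -> 0 <= th <= pi / 2 ->
  normc (spow a r th - (sg `^ a)%:C%C) <=
    2 * (2 * sg) `^ (a - 1) * normc (spow 1 r th - sg%:C%C).
Proof.
move=> /andP[a1 a2] s0 /andP[r0 r2] hth.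
have a0 : 0 < a by exact: lt_trans a1.
set M := (2 * sg) `^ (a - 1).
have M0 : 0 <= M by exact: powR_ge0.
rewrite -(ler_pXn2r (n := 2)) ?nnegrE ?normc_ge0 ?mulr_ge0 ?normc_ge0//.
rewrite exprMn -[in leRHS](powRr1 (ltW s0)) !sqr_normc_spow_sub mul1r.
rewrite !powRr1 ?(ltW r0) ?(ltW s0)//.
have h1 := @sub_cosM_le R a th; rewrite a1 a2 in h1; move/(_ isT hth) : h1 => h1.
have h2 : (r `^ a - sg `^ a) ^+ 2 <= (2 * M) ^+ 2 * (r - sg) ^+ 2.
  rewrite -exprMn -real_normK ?num_real// -[leRHS]real_normK ?num_real//.
  rewrite lerXn2r ?nnegrE// normrM.
  have s2 : sg <= 2 * sg by lra.
  have hr : 0 < r <= 2 * sg by rewrite r0.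
  have hs : 0 < sg <= 2 * sg by rewrite s0.
  apply: le_trans (powR_lipschitz a1 hr hs) _.
  by rewrite ler_wpM2r// ger0_norm ?mulr_ge0// ler_wpM2r// ltW.
have h3 : r `^ a * sg `^ a <= M ^+ 2 * (r * sg).
  rewrite -(mulr_powRB1 (ltW r0) a0) -(mulr_powRB1 (ltW s0) a0).
  have -> : r * r `^ (a - 1) * (sg * sg `^ (a - 1)) =
            (r `^ (a - 1) * sg `^ (a - 1)) * (r * sg) by ring.
  rewrite ler_wpM2r ?mulr_ge0 ?(ltW r0) ?(ltW s0)// expr2.
  by apply: ler_pM; rewrite ?powR_ge0//; apply: ge0_ler_powR;
    rewrite ?nnegrE ?subr_ge0 ?(ltW a1) ?(ltW r0) ?(ltW s0) ?mulr_ge0 ?(ltW s0)//; lra.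
have c1 : 0 <= 1 - cos th by rewrite subr_ge0 cos_le1.
have p0 : 0 <= r `^ a * sg `^ a by rewrite mulr_ge0 ?powR_ge0.
have h4 : r `^ a * sg `^ a * (1 - cos (a * th)) <=
    M ^+ 2 * (r * sg) * (4 * (1 - cos th)).
  by apply: ler_pM.
rewrite [leRHS]mulrDr lerD//.
have -> : (2 * M) ^+ 2 * (2 * (r * sg) * (1 - cos th)) =
          2 * (M ^+ 2 * (r * sg) * (4 * (1 - cos th))) by ring.
by rewrite -[leLHS]mulrA ler_pM2l.
Qed.

Lemma integrable_mull (R : realType) (c : R) (f : R -> R) :
  mu.-integrable (pos R) (EFin \o f) ->
  mu.-integrable (pos R) (EFin \o (fun r => c * f r)).
Proof.
move=> fi; have h : mu.-integrable (pos R) (fun r => (c%:E * (EFin \o f) r)%E).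
  exact: integrableZl.
by apply: eq_integrable h => // r _; rewrite /= EFinM.
Qed.

Lemma integrable_sub (R : realType) (f g : R -> R) :
  mu.-integrable (pos R) (EFin \o f) -> mu.-integrable (pos R) (EFin \o g) ->
  mu.-integrable (pos R) (EFin \o (fun r => f r - g r)).
Proof.
move=> fi gi; have h : mu.-integrable (pos R) ((EFin \o f) \- (EFin \o g))%E.
  exact: integrableB.
by apply: eq_integrable h => // r _; rewrite /= EFinB.
Qed.

Lemma Rintegral_mull (R : realType) (c : R) (f : R -> R) :
  mu.-integrable (pos R) (EFin \o f) ->
  \int[mu]_(r in pos R) (c * f r) = c * \int[mu]_(r in pos R) f r.
Proof. by move=> fi; rewrite RintegralZl. Qed.

Lemma Rintegral_sub (R : realType) (f g : R -> R) :
  mu.-integrable (pos R) (EFin \o f) -> mu.-integrable (pos R) (EFin \o g) ->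
  \int[mu]_(r in pos R) (f r - g r) =
  \int[mu]_(r in pos R) f r - \int[mu]_(r in pos R) g r.
Proof. by move=> fi gi; rewrite RintegralB. Qed.

Lemma integrable_oneDsqr_scale (R : realType) (C : R) :
  mu.-integrable (pos R) (EFin \o (fun r => C / (1 + r ^+ 2))).
Proof. exact: integrable_mull (@integrable_oneDsqrV R). Qed.

(** The exceptional point [x0] accommodates the radius r = sg, where the limiting ray meets the
    pole. *)
Lemma dominated_cvg_pos (R : realType) (f_ : nat -> R -> R) (f g : R -> R) (x0 : R) :
  (forall n, measurable_fun (pos R) (f_ n)) -> measurable_fun (pos R) f ->
  mu.-integrable (pos R) (EFin \o g) ->
  (forall r : R, 0 < r -> r != x0 -> f_ n r @[n --> \oo] --> f r) ->
  (forall n (r : R), 0 < r -> `|f_ n r| <= g r) ->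
  \int[mu]_(r in pos R) f_ n r @[n --> \oo] --> \int[mu]_(r in pos R) f r.
Proof.
move=> mf_ mf gi f_f f_g.
have [] := @dominated_convergence _ _ _ mu (pos R) (measurable_itv _)
  (fun n r => (f_ n r)%:E) (EFin \o f) (EFin \o g).
- by move=> n; apply/measurable_EFinP; exact: mf_.
- by apply/measurable_EFinP; exact: mf.
- exists [set x0]; split => //; first exact: lebesgue_measure_set1.
  move=> r /= /not_implyP [r0 nf]; apply: contrapT => rx; apply: nf.
  move: r0; rewrite in_itv/= andbT => r0.
  by apply: cvg_EFin; [exact: nearW|apply: f_f => //; apply/eqP].
- exact: gi.
- apply: aeW => r n; rewrite /= in_itv/= andbT => r0; rewrite lee_fin; exact: f_g.
move=> fi _ h; apply: fine_cvg; rewrite fineK; first exact: h.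
exact: integrable_fin_num.
Qed.

Lemma Wk_sub (R : realType) (a r th x : R) :
  spow a r th + 1 != 0 -> x + 1 != 0 ->
  Wk a r th - (x / (x + 1))%:C%C =
  (spow a r th - x%:C%C) / (spow a r th + 1) / (x + 1)%:C%C.
Proof.
move=> n0 x1; rewrite rmorphM fmorphV /= /Wk.
have x1C : (x + 1)%:C%C != 0 :> R[i] by rewrite fmorph_eq0.
move: n0 x1C; rewrite rmorphD /= rmorph1; move: (spow a r th) (x%:C%C) => S X n0 n1.
by field; rewrite n1 n0.
Qed.

(* The residue at s = sg: rotate the ray to the positive half-line, where
   subtracting the residue times the Poisson kernel leaves a bounded integrand
   with real values. *)
Lemma integral_Hk (R : realType) (a sg th0 : R) : 1 < a < 2 -> 1 <= sg ->
  0 < th0 -> a * th0 < pi ->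
  \int[mu]_(r in pos R) (complex.Im (Hk a sg r th0) / r) =
  pi * (sg `^ (a - 1) / (sg `^ a + 1)).
Proof.
move=> /andP[a1 a2] s1 th00 ath0.
have a0 : 0 < a by exact: lt_trans a1.
have s0 : 0 < sg by exact: lt_le_trans s1.
have pi0 := pi_gt0 R.
have thpi : th0 < pi / a by rewrite ltr_pdivlMr// mulrC.
have piapi : pi / a < pi by rewrite ltr_pdivrMr// ltr_pMr.
(* Strictly between th0 and pi / a, so that the open sector contains all rays used while a v <
   pi. *)
pose v := (th0 + pi / a) / 2.
have v1 : th0 < v by rewrite /v; lra.
have v2 : v < pi / a by rewrite /v; lra.
have avpi : a * v < pi by rewrite mulrC -ltr_pdivlMr.
have vpi : v <= pi by lra.
(* Angles tending to 0 and at most th0 / 2 < pi / 2, the range in which [spow_lipschitz] applies. *)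
pose th (n : nat) := th0 / n.+2%:R.
have thn0 n : 0 < th n by rewrite divr_gt0// ltr0n.
have thn2 n : th n <= th0 / 2.
  by rewrite ler_pM2l// lef_pV2 ?posrE ?ltr0n// ler_nat.
have rot n : \int[mu]_(r in pos R) (complex.Im (Hk a sg r th0) / r) =
    \int[mu]_(r in pos R) (complex.Im (Hk a sg r (th n)) / r).
  have := thn0 n; have := thn2 n => h1 h2.
  by apply: (@rotation_Hk R a (th n / 2) v) => //; try (apply/andP; split); lra.
(* [k] equals W(sg) / sg, so that the numerator W(s) - k s of the difference [D] vanishes at the
   pole s = sg. *)
set x := sg `^ a; set k := sg `^ (a - 1) / (x + 1).
have x0 : 0 < x by exact: powR_gt0.
have x1 : 0 < x + 1 by rewrite addr_gt0.
have k0 : 0 <= k by rewrite divr_ge0 ?powR_ge0// ltW.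
have kE : k * sg = x / (x + 1).
  by rewrite /k mulrAC [X in X / _]mulrC /x mulr_powRB1 1?ltW.
clearbody k.
pose D (t r : R) := complex.Im (Hk a sg r t) / r - k * (complex.Im (Pk sg r t) / r).
pose c1 := Num.sqrt ((1 - - cos (a * v)) / 2).
have c10 : 0 < c1 by apply: (@sector_c1_gt0 R a (th0 / 2) v) => //; lra.
have hA (r t : R) : 0 < r -> 0 <= t <= th0 -> c1 * (1 + r `^ a) <= normc (spow a r t + 1).
  move=> r0 /andP[t0 t1]; apply: normc_spow1_ge; first exact: ltW.
    have av0 : 0 < a * v by rewrite mulr_gt0//; lra.
    have tv : a * t < a * v by rewrite ltr_pM2l//; lra.
    have at0 : 0 <= a * t by rewrite mulr_ge0// ltW.
    rewrite opprK ltW// ltr_cos// in_itv/= ?(ltW av0) ?(ltW avpi) ?at0//=.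
    by rewrite ltW// (lt_trans tv).
  by rewrite lerN2 cos_le1/= lerNl cos_geN1.
have A0 (r t : R) : 0 < r -> 0 <= t <= th0 -> 0 < normc (spow a r t + 1).
  move=> r0 ht; apply: lt_le_trans (hA _ _ r0 ht).
  by rewrite mulr_gt0// ltr_pwDl ?powR_ge0.
have DE (r t : R) : 0 < r -> D t r =
    complex.Im ((Wk a r t - k%:C%C * spow 1 r t) / (sg%:C%C - spow 1 r t)) / r.
  move=> r0; rewrite /D /Hk /Pk mulrA -mulrBl; congr (_ / _).
  rewrite [RHS](_ : _ = complex.Im (Wk a r t / (sg%:C%C - spow 1 r t) -
     k%:C%C * (spow 1 r t / (sg%:C%C - spow 1 r t)))); last by rewrite mulrBl mulrA.
  by move: (Wk _ _ _ / _) (spow _ _ _ / _) => [w1 w2] [p1 p2] /=; ring.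
(* Away from the radius of the pole, |sg - s| >= |sg - r| is already comparable with 1 + r,
   uniformly in the angle; 1 <= sg enters here. *)
have sub_far (r t : R) : 0 < r -> (r <= sg / 2) || (2 * sg <= r) ->
    (1 + r) / 3 <= normc (sg%:C%C - spow 1 r t).
  move=> r0 hr; apply: (@le_trans _ _ `|sg - r|).
    by case/orP : hr => hr; [rewrite ger0_norm|rewrite ler0_norm]; lra.
  rewrite -(ler_pXn2r (n := 2)) ?nnegrE ?normc_ge0 ?normr_ge0//.
  rewrite sqr_normc_sub_spow// real_normK ?num_real//.
  have := cos2Dsin2 t; have := cos_le1 t; move: (cos t) (sin t) => c s hc hcs.
  have -> : (r - sg * c) ^+ 2 + (sg * s) ^+ 2 =
     r ^+ 2 - 2 * (r * sg) * c + sg ^+ 2 * (c ^+ 2 + s ^+ 2) by ring.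
  rewrite hcs; have : 0 <= r * sg * (1 - c) by rewrite !mulr_ge0 ?subr_ge0 ?(ltW r0) ?(ltW s0).
  lra.
pose M := (2 * sg) `^ (a - 1).
have M0 : 0 <= M by exact: powR_ge0.
pose L := 2 * M / c1 + k.
have L0 : 0 <= L by rewrite addr_ge0// divr_ge0 ?mulr_ge0// ltW.
have near_b (r t : R) : 0 < r <= 2 * sg -> 0 <= t <= th0 / 2 ->
    normc ((Wk a r t - k%:C%C * spow 1 r t) / (sg%:C%C - spow 1 r t)) <= L.
  move=> /andP[r0 r2] ht.
  have ht2 : 0 <= t <= th0 by move: ht => /andP[-> ht]/=; lra.
  have ht3 : 0 <= t <= pi / 2 by move: ht => /andP[-> ht]/=; lra.
  rewrite normcM normcV; set N := normc (sg%:C%C - _).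
  have NN : normc (spow 1 r t - sg%:C%C) = N.
    by rewrite /N -normcN opprB.
  (* At the pole itself the quotient is 0 by convention. *)
  have [N0|N0] := eqVneq N 0; first by rewrite N0 invr0 mulr0.
  have {}N0 : 0 < N by rewrite lt_def N0 normc_ge0.
  rewrite ler_pdivrMr//.
  have hl := @spow_lipschitz R a sg r t _ s0 _ ht3.
  rewrite a1 a2 r0 r2 NN in hl; move/(_ isT isT) : hl => hl.
  have An := normc_gt0 (A0 _ _ r0 ht2).
  have -> : Wk a r t - k%:C%C * spow 1 r t =
     (Wk a r t - (x / (x + 1))%:C%C) + k%:C%C * (sg%:C%C - spow 1 r t).
    rewrite -kE (rmorphM _ k sg) /=.
    by move: (Wk a r t) (k%:C%C) (sg%:C%C) (spow 1 r t) => W K S s; ring.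
  apply: le_trans (le_normcD _ _) _; rewrite /L mulrDl lerD//; last first.
    by rewrite normcM normc_real ger0_norm.
  have xn : x + 1 != 0 by rewrite gt_eqF.
  rewrite (Wk_sub An xn) normcM normcM !normcV normc_real (gtr0_norm x1).
  rewrite ler_pdivrMr// ler_pdivrMr; last exact: A0.
  apply: le_trans hl _.
  have h1 : c1 <= normc (spow a r t + 1).
    apply: le_trans (hA _ _ r0 ht2); rewrite ler_peMr ?(ltW c10)//.
    by rewrite lerDl powR_ge0.
  have h2 : c1 <= (x + 1) * normc (spow a r t + 1).
    by rewrite -[c1]mul1r; apply: ler_pM => //; [exact: ltW|rewrite lerDr ltW].
  rewrite -/M -[leRHS]mulrA -[2 * M / c1 * N]mulrAC -[leRHS]mulrA.
  rewrite ler_peMr ?mulr_ge0 ?(ltW N0)//.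
  by rewrite mulrC ler_pdivlMr// mul1r.
(* The first bracket serves the far range: 3 / c1 for [Hk] and 9 k sg for the Poisson kernel. The
   last term serves sg/2 < r < 2 sg, where 1 / r <= 2 / sg and 1 + r^2 <= 1 + 4 sg^2. *)
pose C := (3 / c1 + 9 * (k * sg)) + L * (2 / sg) * (1 + 4 * sg ^+ 2).
have D0 (r : R) : 0 < 1 + r ^+ 2 by rewrite ltr_pwDl ?sqr_ge0.
have dom (r t : R) : 0 < r -> 0 <= t <= th0 / 2 -> `|D t r| <= C / (1 + r ^+ 2).
  move=> r0 ht; have ht2 : 0 <= t <= th0 by move: ht => /andP[-> ht]/=; lra.
  have Ca : 0 <= 3 / c1 + 9 * (k * sg).
    by rewrite addr_ge0 ?divr_ge0 ?mulr_ge0 ?(ltW c10) ?(ltW s0).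
  have Cb : 0 <= L * (2 / sg) * (1 + 4 * sg ^+ 2).
    by rewrite !mulr_ge0 ?invr_ge0 ?(ltW s0)// addr_ge0// mulr_ge0// sqr_ge0.
  have iD : 0 <= (1 + r ^+ 2)^-1 by rewrite invr_ge0 ltW.
  have [far|] := boolP ((r <= sg / 2) || (2 * sg <= r)).
    apply: (@le_trans _ _ ((3 / c1 + 9 * (k * sg)) / (1 + r ^+ 2))); last first.
      by rewrite ler_wpM2r// lerDl.
    have hN := sub_far _ t r0 far.
    set N := normc (sg%:C%C - spow 1 r t) in hN.
    have r1 : 0 < 1 + r by rewrite addr_gt0.
    have N0 : 0 < N by apply: lt_le_trans hN; rewrite divr_gt0.
    have iN : N^-1 <= 3 / (1 + r).
      by rewrite -[3 / _]invrK lef_pV2 ?posrE ?invf_div// ?divr_gt0.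
    rewrite /D; apply: le_trans (ler_normB _ _) _; rewrite [leRHS]mulrDl lerD//.
      rewrite normrM normfV (gtr0_norm r0).
      apply: (@le_trans _ _ (normc (Hk a sg r t) / r)).
        by rewrite ler_pM2r ?invr_gt0// normr_Im_le.
      rewrite /Hk normcM normcV normc_Wk -/N.
      have -> : r `^ a = r * r `^ (a - 1) by rewrite mulr_powRB1// ltW.
      have -> : r * r `^ (a - 1) / normc (spow a r t + 1) / N / r =
         r `^ (a - 1) * ((normc (spow a r t + 1))^-1 * N^-1).
        by field; rewrite (gt_eqF N0) (gt_eqF r0) (gt_eqF (A0 _ _ r0 ht2)).
      have p1 : 0 < 1 + r `^ a by rewrite ltr_pwDl ?powR_ge0.
      apply: (@le_trans _ _ (r `^ (a - 1) * ((c1^-1 * (1 + r `^ a)^-1) * (3 / (1 + r))))).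
        rewrite ler_wpM2l ?powR_ge0//; apply: ler_pM => //.
        + by rewrite invr_ge0 normc_ge0.
        + by rewrite invr_ge0 ltW.
        + by rewrite -invfM lef_pV2 ?posrE ?mulr_gt0 ?A0// hA.
      have -> : r `^ (a - 1) * (c1^-1 * (1 + r `^ a)^-1 * (3 / (1 + r))) =
        3 / c1 * (r `^ (a - 1) / (1 + r `^ a) / (1 + r)) by ring.
      by rewrite ler_wpM2l ?divr_ge0 ?(ltW c10)// powR_sub1_dominated.
    rewrite normrM (ger0_norm k0) Im_Pk// -/N.
    have -> : 9 * (k * sg) / (1 + r ^+ 2) = k * (sg * 9 / (1 + r ^+ 2)) by ring.
    rewrite ler_wpM2l// normrM normrM normfV (gtr0_norm s0).
    rewrite (@ger0_norm _ (N ^+ 2)) ?sqr_ge0//.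
    apply: (@le_trans _ _ (sg * 1 * (3 / (1 + r)) ^+ 2)).
      apply: ler_pM; rewrite ?mulr_ge0 ?invr_ge0 ?sqr_ge0 ?(ltW s0)//.
        by rewrite ler_wpM2l ?(ltW s0)// sin_max.
      by rewrite -exprVn lerXn2r ?nnegrE ?invr_ge0 ?(ltW N0) ?divr_ge0 ?(ltW r1).
    rewrite mulr1 exprMn exprVn mulrA (_ : 3 ^+ 2 = 9 :> R); last by ring.
    rewrite ler_pM2l ?mulr_gt0// lef_pV2 ?posrE ?exprn_gt0//.
    by rewrite sqrrD expr1n; have := ltW r0; lra.
  rewrite negb_or -!ltNge => /andP[r1 r2].
  apply: (@le_trans _ _ (L * (2 / sg) * (1 + 4 * sg ^+ 2) / (1 + r ^+ 2))); last first.
    by rewrite ler_wpM2r// lerDr.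
  rewrite DE// normrM normfV (gtr0_norm r0) -[leRHS]mulrA.
  have rr : 0 < r <= 2 * sg by rewrite r0 ltW.
  apply: (@le_trans _ _ (L * (2 / sg))).
    apply: ler_pM; rewrite ?invr_ge0 ?(ltW r0)//.
      by apply: le_trans (normr_Im_le _) _; exact: near_b.
    by rewrite -[2 / sg]invf_div lef_pV2 ?posrE ?divr_gt0// ltW.
  rewrite ler_peMr ?mulr_ge0 ?invr_ge0 ?(ltW s0)// ler_pdivlMr// mul1r lerD2l.
  have : r ^+ 2 <= (2 * sg) ^+ 2 by rewrite lerXn2r ?nnegrE ?mulr_ge0 ?(ltW r0) ?(ltW s0)// ltW.
  by rewrite exprMn; lra.
have thnI n : 0 < th n < pi by rewrite thn0 (le_lt_trans (thn2 n))//; lra.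
have Pi n := Poisson_integral s1 (thnI n).
have Hi n : mu.-integrable (pos R) (fun r => (complex.Im (Hk a sg r (th n)) / r)%:E).
  have := thn0 n; have := thn2 n => h1 h2.
  by apply: (@integrable_Hk R a (th n / 2) v) => //; try (apply/andP; split); lra.
have kPi n := integrable_mull k (Pi n).1.
have Di n : mu.-integrable (pos R) (EFin \o D (th n)) := integrable_sub (Hi n) (kPi n).
have intD n : \int[mu]_(r in pos R) D (th n) r =
    \int[mu]_(r in pos R) (complex.Im (Hk a sg r th0) / r) - k * (pi - th n).
  rewrite (Rintegral_sub (Hi n) (kPi n)) -rot.
  by rewrite (Rintegral_mull k (Pi n).1) (Pi n).2.
have thc : th n @[n --> \oo] --> (0 : R).
  by rewrite -(mulr0 th0); apply: cvgM; [exact: cvg_cst|exact: cvg_invn2].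
have limD : \int[mu]_(r in pos R) D (th n) r @[n --> \oo] --> (0 : R).
  have z : \int[mu]_(r in pos R) (cst 0 r) = 0 :> R by rewrite /Rintegral integral0.
  suff : \int[mu]_(r in pos R) D (th n) r @[n --> \oo] -->
    \int[mu]_(r in pos R) (cst 0 r) by rewrite z.
  apply: (@dominated_cvg_pos _ _ _ (fun r => C / (1 + r ^+ 2)) sg).
  - by move=> n; have /integrableP[/measurable_EFinP] := Di n.
  - exact: measurable_cst.
  - exact: integrable_oneDsqr_scale.
  - move=> r r0 rsg.
    have ht : 0 <= (0 : R) <= th0 by rewrite lexx ltW.
    have n0 := normc_gt0 (A0 _ _ r0 ht).
    have sp1 : spow 1 r 0 = r%:C%C.
      by rewrite /spow (powRr1 (ltW r0)) mulr0 /cis cos0 sin0 mulr1.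
    have n1 : sg%:C%C - spow 1 r 0 != 0.
      by rewrite sp1 -rmorphB fmorph_eq0 subr_eq0 eq_sym.
    have [_ hH] := holo_Hk r0 n0 n1.
    have hs := @holo_spow R 1 r 0 r0.
    have [_ hP] := holoM hs (holoV n1 (holoD (holo_cst sg%:C%C r 0) (holoN hs))).
    have c1' := is_derive_mulfun hH.2 (is_derive_cst r^-1 (0 : R) 1).
    have c2' := is_derive_mulfun (is_derive_cst k (0 : R) 1)
      (is_derive_mulfun hP.2 (is_derive_cst r^-1 (0 : R) 1)).
    have cD := is_derive_continuous (is_derive_addfun c1' (is_derive_oppfun c2')).
    rewrite [cst 0 r](_ : _ = D 0 r); first exact: (cvg_comp _ _ thc cD).
    (* On the positive half-line s, s^a and [k] are all real, so the imaginary part vanishes. *)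
    rewrite DE// sp1 /Wk.
    have -> : spow a r 0 = (r `^ a)%:C%C.
      by rewrite /spow mulr0 /cis cos0 sin0 mulr1.
    rewrite -(rmorph1 (real_complex R)) -!rmorphM -!rmorphB -!rmorphD -!fmorphV -!rmorphM.
    by rewrite -!rmorphB -!rmorphM /= mul0r.
  - move=> n r r0; apply: dom => //.
    by rewrite (ltW (thn0 n)) thn2.
have l2 : \int[mu]_(r in pos R) D (th n) r @[n --> \oo] -->
    \int[mu]_(r in pos R) (complex.Im (Hk a sg r th0) / r) - k * (pi - 0).
  under eq_fun do rewrite intD.
  apply: cvgB; first exact: cvg_cst.
  by apply: cvgM; [exact: cvg_cst|apply: cvgB; [exact: cvg_cst|exact: thc]].
have : 0 = \int[mu]_(r in pos R) (complex.Im (Hk a sg r th0) / r) - k * (pi - 0).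
  exact: (cvg_unique _ limD l2).
by move=> /esym/eqP; rewrite subr0 subr_eq0 mulrC => /eqP.
Qed.

(** * The ray integral *)

Definition Gk (R : realType) (a t r th : R) : R[i] := spow a r th * sexp t r th.

Lemma normc_Gk (R : realType) (a t r th : R) :
  normc (Gk a t r th) = r `^ a * expR (t * r * cos th).
Proof. by rewrite /Gk normcM normc_spow normc_sexp. Qed.

(** At th = pi, e^{ts} is e^{-tr} and s^a = r^a e^{i a pi}, so the rotated integral is sin (a pi)
    times an Euler integral. [Gk] has no poles, hence the rotation is not restricted by a th <
    pi. *)
Lemma integral_Gk (R : realType) (a t th0 : R) : 1 <= a -> 0 < t ->
  pi / 2 < th0 < pi ->
  \int[mu]_(r in pos R) (complex.Im (Gk a t r th0) / r) =
  sin (a * pi) * (Gamma a * t `^ (- a)).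
Proof.
move=> a1 t0 /andP[th1 th2].
have a0 : 0 < a by exact: lt_le_trans a1.
have pi0 := pi_gt0 R.
(* [rotation] needs an open interval of angles around pi; this one is symmetric about pi, so cos <=
   cos u < 0 on it. Angles beyond pi are harmless, as [spow] lives on the Riemann surface of the
   logarithm. *)
pose u := (pi / 2 + th0) / 2; pose v := pi *+ 2 - u.
have u1 : pi / 2 < u by rewrite /u; lra.
have u2 : u < th0 by rewrite /u; lra.
have v1 : pi < v by rewrite /v mulr2n; lra.
pose c := - cos u.
have c0 : 0 < c.
  rewrite /c oppr_gt0 -cos_pihalf ltr_cos ?in_itv/=; [exact: u1|lra|].
  by apply/andP; split; lra.
have cle (th : R) : u < th < v -> cos th <= - c.
  move=> /andP[h1 h2]; rewrite /c opprK.
  have [le|lt] := lerP th pi.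
    by rewrite ltW// ltr_cos ?in_itv/=; [exact: h1| |]; apply/andP; split; lra.
  rewrite -(cosN th) -(cosD2pi (- th)) ltW// ltr_cos ?in_itv/=.
  - by move: h2; rewrite /v mulr2n; lra.
  - by apply/andP; split; lra.
  - by move: h2; rewrite /v mulr2n => h2; apply/andP; split; lra.
have tc0 : 0 < t * c by rewrite mulr_gt0.
have y0 : 0 <= a - 1 by rewrite subr_ge0.
have [C1 C10 hC1] := powR_expR_dominated y0 tc0.
have [C2 C20 hC2] := powR_expR_dominated (ltW a0) tc0.
have D0 (r : R) : 0 < 1 + r ^+ 2 by rewrite ltr_pwDl ?sqr_ge0.
pose C := C1 + a * C1 + t * C2.
have C0 : 0 <= C by rewrite !addr_ge0 ?mulr_ge0 ?(ltW C10) ?(ltW C20) ?(ltW a0) ?(ltW t0).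
pose dGk r th := (a / r)%:C%C * spow a r th * sexp t r th +
  spow a r th * (t%:C%C * cis th * sexp t r th).
have eb (r th : R) : 0 < r -> u < th < v -> expR (t * r * cos th) <= expR (- (r * (t * c))).
  move=> r0 /cle h; rewrite ler_expR -mulrN -mulrN mulrA (mulrC r).
  by rewrite ler_pM2l// mulr_gt0.
have qE (r : R) : 0 < r -> r `^ a / r = r `^ (a - 1).
  by move=> r0; rewrite -(mulr_powRB1 (ltW r0) a0) mulrAC mulfV ?mul1r// gt_eqF.
rewrite (@rotation R (Gk a t) dGk u v C C0 _ _ _ _ th0 pi).
- rewrite -(Gamma_scale a1 t0) -Rintegral_mull; last exact: integrable_powR_expR.
  apply: eq_Rintegral => r; rewrite inE/= in_itv/= andbT => r0.
  rewrite /Gk /spow /sexp cospi sinpi mulr0 mulrN1 /cis cos0 sin0 /=.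
  rewrite -(qE r r0) (mulrC t r); ring.
- move=> r th r0 h; exact: holoM (holo_spow a th r0) (holo_sexp t r th).
- move=> r th r0 h.
  have rn0 : r != 0 by rewrite gt_eqF.
  have hi := @is_derive_invfun R id r 1 rn0 (is_derive_id r 1).
  have hc := is_cderive_real (is_derive_mulfun (is_derive_cst a r 1) hi).
  have hs := (holo_spow a th r0).1; have he := (holo_sexp t r th).1.
  have hk := is_cderive_cst r (t%:C%C * cis th).
  exact: is_cderive_continuous_Re (is_cderiveD (is_cderiveM (is_cderiveM hc hs) he)
    (is_cderiveM hs (is_cderiveM hk he))).
- move=> r th r0 h; rewrite normc_Gk mulrAC qE//.
  apply: (@le_trans _ _ (C1 / (1 + r ^+ 2))).
    apply: le_trans (hC1 r r0); rewrite ler_wpM2l ?powR_ge0//; exact: eb.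
  rewrite ler_pM2r ?invr_gt0// /C -addrA lerDl addr_ge0// mulr_ge0 ?(ltW a0) ?(ltW t0) ?(ltW C10) ?(ltW C20)//.
- move=> r th r0 h; apply: le_trans (le_normcD _ _) _.
  rewrite normcM [X in X * _ + _]normcM normc_spow normc_sexp normc_real.
  rewrite normcM normc_spow normcM normc_sexp normcM normc_real normc_cis.
  rewrite mulr1 (gtr0_norm t0) gtr0_norm ?divr_gt0//.
  have -> : a / r * r `^ a * expR (t * r * cos th) =
     a * (r `^ (a - 1) * expR (t * r * cos th)) by rewrite -qE//; ring.
  have -> : r `^ a * (t * expR (t * r * cos th)) = t * (r `^ a * expR (t * r * cos th)) by ring.
  apply: (@le_trans _ _ (a * (C1 / (1 + r ^+ 2)) + t * (C2 / (1 + r ^+ 2)))).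
    rewrite lerD// ler_pM2l//.
      by apply: le_trans (hC1 r r0); rewrite ler_wpM2l ?powR_ge0//; exact: eb.
    by apply: le_trans (hC2 r r0); rewrite ler_wpM2l ?powR_ge0//; exact: eb.
  rewrite !mulrA -mulrDl ler_pM2r ?invr_gt0// /C -addrA lerDr; exact: ltW.
- by apply/andP; split => //; rewrite /v mulr2n; lra.
- by apply/andP; split => //; lra.
Qed.

(* f(t) = E_a(- t^a) is represented by an integral over the pair of rays
   arg s = +-th, which avoids the poles s^a = -1. *)
Definition Fk (R : realType) (a t r th : R) : R[i] := Wk a r th * sexp t r th.

Definition Rk (R : realType) (a t r th : R) : R[i] :=
  spow a r th * Wk a r th * sexp t r th.

Lemma Fk_split (R : realType) (a t r th : R) : spow a r th + 1 != 0 ->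
  Fk a t r th = Gk a t r th - Rk a t r th.
Proof.
move=> n0; rewrite /Fk /Gk /Rk /Wk.
by move: n0; move: (spow a r th) (sexp t r th) => S e n0; field.
Qed.

(** * Exchange of integrals and increments of the exponential *)

Lemma integral_pos_support (R : realType) (g : R -> \bar R) :
  (forall x : R, ~~ (0 < x) -> g x = 0%E) ->
  (\int[mu]_x g x = \int[mu]_(x in pos R) g x)%E.
Proof.
move=> g0; rewrite [RHS]integral_mkcond; apply: eq_integral => x _.
rewrite /patch; case: ifPn => // xn; rewrite g0//.
by apply: contra xn => x0; rewrite inE/= in_itv/= x0.
Qed.

(** The double integral of |f| is finite because w(r) e^{- t m(r)} integrates in t to w(r) / m(r),
    which is dominated in r. Vanishing of f off the open quadrant lets the product measure on the
    whole plane be used. *)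
Lemma Fubini_pos (R : realType) (f : R -> R -> R) (w m : R -> R) (C : R) :
  measurable_fun setT (fun p : R * R => f p.1 p.2) ->
  (forall t r : R, ~~ (0 < t) -> f t r = 0) ->
  (forall t r : R, ~~ (0 < r) -> f t r = 0) ->
  (forall r : R, 0 < r -> 0 < m r /\ w r / m r <= C / (1 + r ^+ 2)) ->
  (forall t r : R, 0 < t -> 0 < r -> `|f t r| <= w r * expR (- (t * m r))) ->
  (forall t : R, 0 < t -> mu.-integrable (pos R) (EFin \o f t)) ->
  (forall r : R, 0 < r -> mu.-integrable (pos R) (EFin \o (f ^~ r))) ->
  mu.-integrable (pos R) (fun t => (\int[mu]_(r in pos R) f t r)%:E) /\
  \int[mu]_(t in pos R) (\int[mu]_(r in pos R) f t r) =
  \int[mu]_(r in pos R) (\int[mu]_(t in pos R) f t r).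
Proof.
move=> mf ft fr hm hf it ir.
pose g (p : R * R) := (f p.1 p.2)%:E.
have mg : measurable_fun setT g by exact/measurable_EFinP.
have fi : ((mu : measure _ R) \x (mu : measure _ R))%E.-integrable setT g.
  apply/integrable21ltyP => //.
  have /integrableP[mC] := @integrable_oneDsqr_scale R C; apply: le_lt_trans.
  have mag : measurable_fun setT (abse \o g) by exact: measurableT_comp.
  rewrite integral_pos_support; last first.
    by move=> r r0; rewrite integral0_eq// => t _; rewrite /g/= fr// normr0.
  apply: ge0_le_integral => //.
  - by move=> r _; exact: integral_ge0.
  - apply: measurable_funTS.
    by apply: (@measurable_fun_fubini_tonelli_G _ _ _ _ _ mu (abse \o g)) => // p; exact: abse_ge0.
  - exact: measurableT_comp.
  - move=> r /=; rewrite in_itv/= andbT => r0.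
    have [m0 wm] := hm _ r0.
    have w0 : 0 <= w r.
      have := hf 1 r ltr01 r0; move/(le_trans (normr_ge0 _)).
      by rewrite pmulr_lge0 ?expR_gt0.
    apply: (@le_trans _ _ (w r / m r)%:E); last first.
      by rewrite lee_fin (le_trans wm)// ler_norm.
    rewrite integral_pos_support; last by move=> t t0; rewrite ft// normr0.
    rewrite EFinM -(integral_expRN m0) -ge0_integralZl//.
    + apply: ge0_le_integral => //.
      * by have /integrable_norm/integrableP[] := ir _ r0.
      * apply: measurable_funeM; apply/measurable_EFinP.
        apply: (@continuous_measurable_pos R) => t _.
        exact: is_derive_continuous (is_derive_expfun (is_derive_oppfun (is_derive_mulr (m r) t))).
      * move=> t /=; rewrite in_itv/= andbT => t0.
        by rewrite -EFinM lee_fin; exact: hf.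
    + apply/measurable_EFinP.
      apply: (@continuous_measurable_pos R) => t _.
      exact: is_derive_continuous (is_derive_expfun (is_derive_oppfun (is_derive_mulr (m r) t))).
have inner1 (t : R) : (\int[mu]_r g (t, r) = (\int[mu]_(r in pos R) f t r)%:E)%E.
  rewrite integral_pos_support; last by move=> r r0; rewrite /g/= fr.
  have [t0|t0] := boolP (0 < t).
    by rewrite /Rintegral fineK//; apply: integrable_fin_num => //; exact: it.
  rewrite integral0_eq; last by move=> r _; rewrite /g/= ft.
  by rewrite /Rintegral integral0_eq// => r _; rewrite ft.
have inner2 (r : R) : (\int[mu]_t g (t, r) = (\int[mu]_(t in pos R) f t r)%:E)%E.
  rewrite integral_pos_support; last by move=> t t0; rewrite /g/= ft.
  have [r0|r0] := boolP (0 < r).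
    by rewrite /Rintegral fineK//; apply: integrable_fin_num => //; exact: ir.
  rewrite integral0_eq; last by move=> t _; rewrite /g/= fr.
  by rewrite /Rintegral integral0_eq// => t _; rewrite fr.
have Fi := integrable_fubini_F fi.
split.
  have : mu.-integrable setT (fun t : R => (\int[mu]_(r in pos R) f t r)%:E).
    by apply: eq_integrable Fi => // t _; rewrite /fubini_F inner1.
  exact: integrableS.
have := Fubini fi.
under eq_integral do rewrite inner1.
under [in X in _ = X -> _]eq_integral do rewrite inner2.
rewrite integral_pos_support; last first.
  by move=> t t0; rewrite /Rintegral integral0_eq// => r _; rewrite ft.
rewrite integral_pos_support; last first.
  by move=> r r0; rewrite /Rintegral integral0_eq// => t _; rewrite fr.
by rewrite /Rintegral => ->.
Qed.

Lemma mem_pos (R : realType) (r : R) : r \in pos R -> 0 < r.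
Proof. by rewrite inE/= in_itv/= andbT. Qed.

(** Both M + m and M - m are nonincreasing. *)
Lemma dist_le_of_derive (R : realType) (m M dm dM : R -> R) (t1 t2 : R) :
  t1 < t2 ->
  (forall x : R, is_derive x 1 m (dm x)) -> (forall x : R, is_derive x 1 M (dM x)) ->
  (forall x : R, `|dm x| <= - dM x) -> `|m t1 - m t2| <= M t1 - M t2.
Proof.
move=> t12 hm hM h.
have mono (g dg : R -> R) : (forall x : R, is_derive x 1 g (dg x)) ->
    (forall x, dg x <= 0) -> g t2 <= g t1.
  move=> hg dg0; have [|x _ e] := @MVT _ g dg _ _ t12.
    by apply: derivable_within_continuous => x _; have [] := hg x.
  by rewrite -subr_le0 e mulr_le0_ge0 ?dg0// subr_ge0 ltW.
rewrite ler_norml; apply/andP; split.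
  have := @mono (fun x => M x + m x) (fun x => dM x + dm x).
  move=> /(_ (fun x => is_derive_addfun (hM x) (hm x))) k.
  suff : M t2 + m t2 <= M t1 + m t1 by lra.
  by apply: k => x; have := h x; have := ler_norm (dm x); lra.
have := @mono (fun x => M x - m x) (fun x => dM x - dm x).
move=> /(_ (fun x => is_derive_addfun (hM x) (is_derive_oppfun (hm x)))) k.
suff : M t2 - m t2 <= M t1 - m t1 by lra.
by apply: k => x; have := h x; have := ler_norm (- dm x); rewrite normrN; lra.
Qed.

(** The time derivative of e^{ts} has modulus r e^{t r cos th}, which is minus the derivative of (-
    cos th)^-1 e^{t r cos th}. Keeping a difference of exponentials, instead of a factor t2 - t1, is
    what integrates to t1^(-2a) - t2^(-2a) in [Jrem_dist]. *)
Lemma sexp_dist (R : realType) (r th t1 t2 : R) : 0 < r -> cos th < 0 -> t1 < t2 ->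
  let d := (- cos th)^-1 * (expR (- (r * (t1 * - cos th))) - expR (- (r * (t2 * - cos th)))) in
  `|complex.Re (sexp t1 r th - sexp t2 r th)| <= d /\
  `|complex.Im (sexp t1 r th - sexp t2 r th)| <= d.
Proof.
move=> r0 c0 t12.
pose M (x : R) := (- cos th)^-1 * expR (- (x * (r * - cos th))).
pose dM (x : R) := - (r * expR (x * (r * cos th))).
have hM (x : R) : is_derive x 1 M (dM x).
  have := is_derive_mulfun (is_derive_cst (- cos th)^-1 x 1)
    (is_derive_expfun (is_derive_oppfun (is_derive_mulr (r * - cos th) x))).
  move=> k; apply: is_derive_eq k _; rewrite mul0r add0r /dM /cst.
  have -> : - (x * (r * - cos th)) = x * (r * cos th) by ring.
  by field; rewrite lt_eqF.
have he (x : R) : is_derive x 1 (fun y => expR (y * (r * cos th))) (r * cos th * expR (x * (r * cos th))).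
  exact: (is_derive_expfun (is_derive_mulr (r * cos th) x)).
have hc (x : R) : is_derive x 1 (fun y => cos (y * (r * sin th))) (- sin (x * (r * sin th)) * (r * sin th)).
  exact: (@is_derive1_comp R cos _ x _ _ (is_derive_cos _) (is_derive_mulr (r * sin th) x)).
have hs (x : R) : is_derive x 1 (fun y => sin (y * (r * sin th))) (cos (x * (r * sin th)) * (r * sin th)).
  exact: (@is_derive1_comp R sin _ x _ _ (is_derive_sin _) (is_derive_mulr (r * sin th) x)).
have bound (w e : R) : 0 <= e -> `|w| <= 1 -> `|r * e * w| <= - - (r * e).
  move=> e0 w1; have re0 : 0 <= r * e by rewrite mulr_ge0// ltW.
  by rewrite opprK normrM (ger0_norm re0) ler_piMr.
have Md (x y : R) : M x - M y = (- cos th)^-1 * (expR (- (r * (x * - cos th))) - expR (- (r * (y * - cos th)))).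
  by rewrite /M -mulrBr (mulrCA x) (mulrCA y).
split; rewrite -Md.
  have := dist_le_of_derive t12 (fun x => is_derive_mulfun (he x) (hc x)) hM.
  rewrite Re_add Re_opp /sexp /cis /= !mul0r !subr0.
  rewrite -!(mulrA t1) -!(mulrA t2); apply => x.
  rewrite (_ : _ + _ = r * expR (x * (r * cos th)) * cos (th + x * (r * sin th))).
    by apply: bound; [exact: expR_ge0|exact: cos_max].
  by rewrite cosD; ring.
have := dist_le_of_derive t12 (fun x => is_derive_mulfun (he x) (hs x)) hM.
rewrite Im_add Im_opp /sexp /cis /= !mul0r !addr0.
rewrite -!(mulrA t1) -!(mulrA t2); apply => x.
rewrite (_ : _ + _ = r * expR (x * (r * cos th)) * sin (th + x * (r * sin th))).
  by apply: bound; [exact: expR_ge0|exact: sin_max].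
by rewrite sinD; ring.
Qed.

(** * Expansion of the ray integral with a remainder controlled in increments *)

Section asymptotics.
Variables (R : realType) (a th : R).
Hypotheses (a1 : 1 < a) (th1 : pi / 2 < th) (ath : a * th < pi).

Let c := - cos th.
Let c1 := Num.sqrt ((1 - - cos (a * th)) / 2).
Let a0 : 0 < a. Proof. exact: lt_trans a1. Qed.
Let th0 : 0 < th. Proof. by apply: lt_trans th1; rewrite divr_gt0 ?pi_gt0. Qed.
Let thpi : th < pi.
Proof. by apply: lt_trans ath; rewrite ltr_pMl. Qed.

Lemma asym_c_gt0 : 0 < c.
Proof.
rewrite oppr_gt0 -cos_pihalf ltr_cos ?in_itv/=; first exact: th1.
  by have := pi_gt0 R => ?; apply/andP; split; lra.
by rewrite (ltW th0) (ltW thpi).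
Qed.

Lemma asym_c1_gt0 : 0 < c1.
Proof.
have at0 : 0 < a * th by rewrite mulr_gt0.
rewrite sqrtr_gt0 divr_gt0// opprK; suff : -1 < cos (a * th) by lra.
by rewrite -cospi ltr_cos ?in_itv/= ?pi_ge0 ?lexx ?(ltW at0) ?(ltW ath).
Qed.

Lemma asym_spow1_ge (r : R) : 0 < r -> c1 * (1 + r `^ a) <= normc (spow a r th + 1).
Proof.
move=> r0; apply: normc_spow1_ge; [exact: ltW|by rewrite opprK|].
by rewrite lerN2 cos_le1/= lerNl cos_geN1.
Qed.

Lemma asym_spow1_gt0 (r : R) : 0 < r -> 0 < normc (spow a r th + 1).
Proof.
move=> r0; apply: lt_le_trans (asym_spow1_ge r0).
by rewrite mulr_gt0 ?asym_c1_gt0// ltr_pwDl ?powR_ge0.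
Qed.

Lemma asym_Wk_le (r : R) : 0 < r -> normc (Wk a r th) <= c1^-1 * r `^ a.
Proof.
move=> r0; rewrite normc_Wk ler_pdivrMr ?asym_spow1_gt0// mulrAC.
rewrite -[leLHS]mul1r ler_wpM2r ?powR_ge0//.
rewrite -(ler_pM2l asym_c1_gt0) mulr1 mulrA mulfV ?gt_eqF ?asym_c1_gt0// mul1r.
by apply: le_trans (asym_spow1_ge r0); rewrite ler_peMr ?(ltW asym_c1_gt0)// lerDl powR_ge0.
Qed.

Lemma continuous_Im_div (H : R -> R -> R[i]) (d : R[i]) (r : R) : 0 < r ->
  holo H r th d -> {for r, continuous (fun x => complex.Im (H x th) / x)}.
Proof.
move=> r0 [[_ h] _]; have rn0 : r != 0 by rewrite gt_eqF.
have hi := @is_derive_invfun R id r 1 rn0 (is_derive_id r 1).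
exact: is_derive_continuous (is_derive_mulfun h hi).
Qed.

(** Common estimate for the three kernels, with b = a for [Fk] and [Gk] and b = 2 a for [Rk]: the
    pointwise bound integrates to a Gamma value. *)
Lemma integrable_Im_div (H : R -> R -> R[i]) (b K t : R) : 1 <= b -> 0 < t -> 0 <= K ->
  (forall r : R, 0 < r -> exists d, holo H r th d) ->
  (forall r : R, 0 < r -> normc (H r th) <= K * (r `^ b * expR (- (r * (t * c))))) ->
  mu.-integrable (pos R) (fun r => (complex.Im (H r th) / r)%:E) /\
  `|\int[mu]_(r in pos R) (complex.Im (H r th) / r)| <=
    K * (Gamma b * (t * c) `^ (- b)).
Proof.
move=> b1 t0 K0 hH bH; have y0 : 0 <= b - 1 by rewrite subr_ge0.
have b0 : 0 < b by exact: lt_le_trans b1.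
have tc0 : 0 < t * c by rewrite mulr_gt0 ?asym_c_gt0.
have gi := integrable_mull K (integrable_powR_expR y0 tc0).
have mH : measurable_fun (pos R) (fun r => complex.Im (H r th) / r).
  by apply: continuous_measurable_pos => r r0; have [d /continuous_Im_div] := hH r r0; exact.
have bd (r : R) : 0 < r -> `|complex.Im (H r th) / r| <= K * (r `^ (b - 1) * expR (- (r * (t * c)))).
  move=> r0; rewrite normrM normfV (gtr0_norm r0) ler_pdivrMr//.
  apply: le_trans (normr_Im_le _) _; apply: le_trans (bH _ r0) _.
  by rewrite -(mulr_powRB1 (ltW r0) b0) le_eqVlt; apply/orP; left; apply/eqP; ring.
have fi : mu.-integrable (pos R) (fun r => (complex.Im (H r th) / r)%:E).
  apply: (le_integrable _ _ _ gi) => //; first by apply/measurable_EFinP; exact: mH.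
  move=> r /=; rewrite in_itv/= andbT => r0; rewrite lee_fin.
  by apply: le_trans (bd r r0) _; exact: ler_norm.
split => //.
rewrite -(Gamma_scale b1 tc0) -Rintegral_mull; last exact: integrable_powR_expR.
apply: le_trans (le_normr_Rintegral _ fi) _ => //.
apply: le_Rintegral => //; first exact: (integrable_norm fi).
by move=> r /=; rewrite in_itv/= andbT => r0; exact: bd.
Qed.

Lemma sexp_norm (t r : R) : normc (sexp t r th) = expR (- (r * (t * c))).
Proof. by rewrite normc_sexp /c !mulrN opprK mulrCA mulrA. Qed.

Lemma holo_ex_Fk (t r : R) : 0 < r -> exists d, holo (Fk a t) r th d.
Proof.
move=> r0; have n0 := normc_gt0 (asym_spow1_gt0 r0).
by eexists; exact: holoM (holo_Wk r0 n0) (holo_sexp t r th).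
Qed.

Lemma holo_ex_Gk (t r : R) : 0 < r -> exists d, holo (Gk a t) r th d.
Proof. by move=> r0; eexists; exact: holoM (holo_spow a th r0) (holo_sexp t r th). Qed.

Lemma holo_ex_Rk (t r : R) : 0 < r -> exists d, holo (Rk a t) r th d.
Proof.
move=> r0; have n0 := normc_gt0 (asym_spow1_gt0 r0).
eexists; exact: holoM (holoM (holo_spow a th r0) (holo_Wk r0 n0)) (holo_sexp t r th).
Qed.

Lemma normc_Fk_le (t r : R) : 0 < r ->
  normc (Fk a t r th) <= c1^-1 * (r `^ a * expR (- (r * (t * c)))).
Proof.
move=> r0; rewrite /Fk normcM sexp_norm [leRHS]mulrA ler_wpM2r ?expR_ge0//.
exact: asym_Wk_le.
Qed.

Lemma normc_spowWk_le (r : R) : 0 < r ->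
  normc (spow a r th * Wk a r th) <= c1^-1 * r `^ (a + a).
Proof.
move=> r0; rewrite normcM normc_spow powRD; last by rewrite (gt_eqF r0) implybT.
by rewrite mulrCA ler_wpM2l ?powR_ge0// asym_Wk_le.
Qed.

Lemma normc_Rk_le (t r : R) : 0 < r ->
  normc (Rk a t r th) <= c1^-1 * (r `^ (a + a) * expR (- (r * (t * c)))).
Proof.
move=> r0; rewrite /Rk normcM sexp_norm [leRHS]mulrA ler_wpM2r ?expR_ge0//.
exact: normc_spowWk_le.
Qed.

Let c1V_ge0 : 0 <= c1^-1. Proof. by rewrite invr_ge0 ltW// asym_c1_gt0. Qed.
Let aa1 : 1 <= a + a. Proof. by move: a1; lra. Qed.

Definition Jray (t : R) := \int[mu]_(r in pos R) (complex.Im (Fk a t r th) / r).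
Definition Jrem (t : R) := \int[mu]_(r in pos R) (complex.Im (Rk a t r th) / r).

Lemma integrable_Fk (t : R) : 0 < t ->
  mu.-integrable (pos R) (fun r => (complex.Im (Fk a t r th) / r)%:E).
Proof.
move=> t0; apply: (integrable_Im_div (ltW a1) t0 c1V_ge0 _ _).1 => r r0.
  exact: holo_ex_Fk.
exact: normc_Fk_le.
Qed.

Lemma integrable_Rk (t : R) : 0 < t ->
  mu.-integrable (pos R) (fun r => (complex.Im (Rk a t r th) / r)%:E).
Proof.
move=> t0; apply: (integrable_Im_div aa1 t0 c1V_ge0 _ _).1 => r r0.
  exact: holo_ex_Rk.
exact: normc_Rk_le.
Qed.

Lemma integrable_Gk (t : R) : 0 < t ->
  mu.-integrable (pos R) (fun r => (complex.Im (Gk a t r th) / r)%:E).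
Proof.
move=> t0; apply: (integrable_Im_div (ltW a1) t0 ler01 _ _).1 => r r0.
  exact: holo_ex_Gk.
by rewrite /Gk normcM sexp_norm normc_spow mul1r.
Qed.

Lemma Jray_split (t : R) : 0 < t ->
  Jray t = sin (a * pi) * Gamma a * t `^ (- a) - Jrem t.
Proof.
move=> t0; rewrite -mulrA -(@integral_Gk R a t th (ltW a1) t0); last by rewrite th1 thpi.
rewrite -(Rintegral_sub (integrable_Gk t0) (integrable_Rk t0)).
apply: eq_Rintegral => r /mem_pos r0.
have n0 := normc_gt0 (asym_spow1_gt0 r0).
by rewrite (Fk_split t n0) Im_add Im_opp mulrBl.
Qed.

(** Sized for [Jrem_dist]: c^-1 comes from [sexp_dist], and 2 from the two products in the imaginary
    part of a product. As c <= 1, the factor 2 / c is at least 1 and the same constant serves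
    [Jrem_le]. *)
Let C0 := 2 / c * (c1^-1 * (Gamma (a + a) * c `^ (- (a + a)))).

Lemma Jrem_const_ge0 : 0 <= C0.
Proof.
rewrite /C0 mulr_ge0 ?divr_ge0 ?(ltW asym_c_gt0)// mulr_ge0//.
by rewrite mulr_ge0 ?powR_ge0 ?(ltW (Gamma_gt0 aa1)).
Qed.

Lemma Jrem_le (t : R) : 0 < t -> `|Jrem t| <= C0 * t `^ (- (a + a)).
Proof.
move=> t0; have c0 := asym_c_gt0.
apply: le_trans (integrable_Im_div aa1 t0 c1V_ge0 _ _).2 _.
- by move=> r r0; exact: holo_ex_Rk.
- by move=> r r0; exact: normc_Rk_le.
rewrite powRM ?(ltW t0) ?(ltW c0)// (mulrC (t `^ _)) /C0.
have -> : c1^-1 * (Gamma (a + a) * (c `^ (- (a + a)) * t `^ (- (a + a)))) =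
  c1^-1 * (Gamma (a + a) * c `^ (- (a + a))) * t `^ (- (a + a)) by ring.
rewrite ler_wpM2r ?powR_ge0// ler_peMl//.
  by rewrite !mulr_ge0 ?powR_ge0// ltW// Gamma_gt0.
rewrite ler_pdivlMr// mul1r /c; have := cos_geN1 th; lra.
Qed.

Lemma Jrem_dist (t1 t2 : R) : 0 < t1 -> t1 < t2 ->
  `|Jrem t1 - Jrem t2| <= C0 * (t1 `^ (- (a + a)) - t2 `^ (- (a + a))).
Proof.
move=> t10 t12; have t20 := lt_trans t10 t12; have c0 := asym_c_gt0.
rewrite -(Rintegral_sub (integrable_Rk t10) (integrable_Rk t20)).
have y0 : 0 <= a + a - 1 by move: a1; lra.
have tc1 : 0 < t1 * c by rewrite mulr_gt0.
have tc2 : 0 < t2 * c by rewrite mulr_gt0.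
have i1 := integrable_powR_expR y0 tc1; have i2 := integrable_powR_expR y0 tc2.
have gi := integrable_mull (2 / c * c1^-1) (integrable_sub i1 i2).
have -> : C0 * (t1 `^ (- (a + a)) - t2 `^ (- (a + a))) =
  \int[mu]_(r in pos R) (2 / c * c1^-1 * (r `^ (a + a - 1) * expR (- (r * (t1 * c))) -
     r `^ (a + a - 1) * expR (- (r * (t2 * c))))).
  rewrite (Rintegral_mull _ (integrable_sub i1 i2)) (Rintegral_sub i1 i2).
  rewrite (Gamma_scale aa1 tc1) (Gamma_scale aa1 tc2).
  rewrite !powRM ?(ltW t10) ?(ltW t20) ?(ltW c0)// /C0; ring.
have fi := integrable_sub (integrable_Rk t10) (integrable_Rk t20).
apply: le_trans (le_normr_Rintegral _ fi) _ => //.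
apply: le_Rintegral => //; first exact: (integrable_norm fi).
move=> r /=; rewrite in_itv/= andbT => r0.
rewrite -mulrBl normrM normfV (gtr0_norm r0) ler_pdivrMr//.
have cth : cos th < 0 by rewrite -oppr_gt0.
have [dRe dIm] := sexp_dist r0 cth t12.
rewrite -/c in dRe dIm.
set e := c^-1 * _ in dRe dIm.
have -> : complex.Im (Rk a t1 r th) - complex.Im (Rk a t2 r th) =
    complex.Im (spow a r th * Wk a r th * (sexp t1 r th - sexp t2 r th)).
  by rewrite -Im_opp -Im_add /Rk mulrBr.
rewrite Im_mul; set Z := spow a r th * Wk a r th.
have Zle := normc_spowWk_le r0; rewrite -/Z in Zle.
have e0 : 0 <= e by exact: le_trans (normr_ge0 _) dRe.
apply: (@le_trans _ _ (normc Z * e + normc Z * e)).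
  apply: le_trans (ler_normD _ _) _; rewrite !normrM lerD// ler_pM//.
    exact: normr_Re_le.
  exact: normr_Im_le.
apply: (@le_trans _ _ (2 * (c1^-1 * r `^ (a + a)) * e)).
  by have := ler_wpM2r e0 Zle; lra.
rewrite -(mulr_powRB1 (ltW r0) (_ : 0 < a + a)); last by move: a0; lra.
rewrite /e le_eqVlt; apply/orP; left; apply/eqP; ring.
Qed.

(** The leading term is a power, and the remainder is continuous because its increments are
    dominated by those of t^(-2a). *)
Lemma Jray_continuous (t : R) : 0 < t -> {for t, continuous Jray}.
Proof.
move=> t0.
have cp b : {for t, continuous (fun x : R => x `^ b)} by exact: continuous_powR.
have crem : {for t, continuous Jrem}.
  apply/cvgrPdist_le => e e0; near=> x.
  have x0 : 0 < x by near: x; exact: lt_nbhsr.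
  apply: (@le_trans _ _ (C0 * `|t `^ (- (a + a)) - x `^ (- (a + a))|)).
    have [tx|xt|<-] := ltgtP t x.
    - by apply: le_trans (Jrem_dist t0 tx) _; rewrite ler_wpM2l ?Jrem_const_ge0// ler_norm.
    - rewrite distrC; apply: le_trans (Jrem_dist x0 xt) _.
      by rewrite ler_wpM2l ?Jrem_const_ge0// distrC ler_norm.
    - by rewrite !subrr !normr0 mulr0.
  near: x.
  have C1 : 0 < C0 + 1 by rewrite ltr_wpDl ?Jrem_const_ge0.
  have h := cp (- (a + a)); move/cvgrPdist_le : h => /(_ (e / (C0 + 1))).
  rewrite divr_gt0// => /(_ isT); apply: filterS => x hx.
  apply: (@le_trans _ _ ((C0 + 1) * `|t `^ (- (a + a)) - x `^ (- (a + a))|)).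
    by rewrite ler_wpM2r// lerDl.
  by rewrite mulrC -ler_pdivlMr.
have h : {for t, continuous (fun x => sin (a * pi) * Gamma a * x `^ (- a) - Jrem x)}.
  by apply: cvgB => //; apply: cvgM; [exact: cvg_cst|exact: cp].
suff : Jray x @[x --> t] --> Jray t by [].
rewrite (Jray_split t0); apply: (cvg_trans _ h); apply: near_eq_cvg.
near=> x; rewrite Jray_split//; near: x; exact: lt_nbhsr.
Unshelve. all: by end_near. Qed.

Lemma is_cderive_sexp_time (t r : R) : 0 < r ->
  is_cderive t (fun y => sexp y r th) (spow 1 r th * sexp t r th).
Proof.
move=> r0.
have h1 := is_derive_mulfun (is_derive_mulr r t) (is_derive_cst (cos th) t 1).
have h2 := is_derive_mulfun (is_derive_mulr r t) (is_derive_cst (sin th) t 1).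
apply: is_cderive_eq (is_cderiveM (is_cderive_real (is_derive_expfun h1)) (is_cderive_cis h2)) _.
rewrite /cst !mulr0 !addr0 /sexp /spow (powRr1 (ltW r0)) mul1r.
rewrite (_ : cis th = (cos th)%:C%C + 'i%C * (sin th)%:C%C); last first.
  by apply/eqP; rewrite eq_complex/= ; apply/andP; split; apply/eqP; ring.
rewrite !rmorphM /=; ring.
Qed.

(** * Laplace transform of the ray integral *)

Let Ek (sg r t : R) : R[i] := (expR (- (sg * t)))%:C%C * sexp t r th.

Lemma normc_Ek (sg r t : R) : normc (Ek sg r t) = expR (- (t * (sg + r * c))).
Proof.
rewrite /Ek normcM normc_real sexp_norm ger0_norm ?expR_ge0// -expRD; congr expR; ring.
Qed.

Lemma is_cderive_Ek (sg r t : R) : 0 < r ->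
  is_cderive t (Ek sg r) ((spow 1 r th - sg%:C%C) * Ek sg r t).
Proof.
move=> r0; have h := is_cderive_real (is_derive_expfun (is_derive_oppfun (is_derive_mull sg t))).
apply: is_cderive_eq (is_cderiveM h (is_cderive_sexp_time t r0)) _.
by rewrite /Ek rmorphM rmorphN /=; ring.
Qed.

Lemma Ek0 (sg r : R) : Ek sg r 0 = 1.
Proof.
by rewrite /Ek /sexp mulr0 oppr0 !mul0r !expR0 /cis cos0 sin0 /= !mulr1.
Qed.

Lemma Laplace_kernel (sg r : R) : 1 <= sg -> 0 < r ->
  mu.-integrable (pos R)
    (EFin \o (fun t => expR (- (sg * t)) * (complex.Im (Fk a t r th) / r))) /\
  \int[mu]_(t in pos R) (expR (- (sg * t)) * (complex.Im (Fk a t r th) / r)) =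
    complex.Im (Hk a sg r th) / r.
Proof.
move=> s1 r0; have c0 := asym_c_gt0.
have s0 : 0 < sg by exact: lt_le_trans s1.
have m0 : 0 < sg + r * c by rewrite addr_gt0// mulr_gt0.
have cth : cos th <= 1 by exact: cos_le1.
have n1 : sg%:C%C - spow 1 r th != 0.
  have h := @normc_sub_spow_ge R sg r th (cos th) (ltW r0) (ltW s0) (lexx _).
  apply: normc_gt0; apply: lt_le_trans (h _); last by rewrite cos_geN1 cos_le1.
  rewrite mulr_gt0 ?addr_gt0// sqrtr_gt0 divr_gt0//.
  by move: c0; rewrite /c; lra.
have n1' : spow 1 r th - sg%:C%C != 0 by rewrite -opprB oppr_eq0.
have kE t : expR (- (sg * t)) * (complex.Im (Fk a t r th) / r) =
    complex.Im (Wk a r th * Ek sg r t) / r.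
  by rewrite /Fk /Ek; move: (Wk a r th) (sexp t r th) => [x y] [z w] /=; ring.
have dk t : is_cderive t (fun t => Wk a r th * Ek sg r t)
     (Wk a r th * ((spow 1 r th - sg%:C%C) * Ek sg r t)).
  by apply: is_cderive_eq (is_cderiveM (is_cderive_cst t (Wk a r th)) (is_cderive_Ek sg t r0)) _; rewrite mul0r add0r.
pose k t := complex.Im (Wk a r th * Ek sg r t) / r.
have ck (t : R) : {for t, continuous k}.
  exact: is_derive_continuous (is_derive_mulfun (dk t).2 (is_derive_cst r^-1 t 1)).
have ki : mu.-integrable (pos R) (EFin \o k).
  have gi := integrable_mull (normc (Wk a r th) / r) (integrable_powR_expR (lexx 0) m0).
  apply: (le_integrable _ _ _ gi) => //.
    apply/measurable_EFinP; apply: (@continuous_measurable_pos R) => t _; exact: ck.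
  move=> t _; rewrite lee_fin powRr0 mul1r (le_trans _ (ler_norm _))//.
  rewrite /k normrM normfV (gtr0_norm r0) [leRHS]mulrAC ler_pM2r ?invr_gt0//.
  by apply: le_trans (normr_Im_le _) _; rewrite normcM normc_Ek.
split.
  by apply: eq_integrable ki => // t _; rewrite /= kE.
transitivity (\int[mu]_(t in pos R) k t).
  by apply: eq_Rintegral => t _; rewrite kE.
(* Antiderivative in t of W e^{(s - sg) t}: it vanishes at infinity, and the sign of its value at t
   = 0 turns s - sg into sg - s. *)
pose Z := Wk a r th / (spow 1 r th - sg%:C%C).
pose K t := complex.Im (Z * Ek sg r t) / r.
have dK (t : R) : is_derive t 1 K (k t).
  have := is_cderiveM (is_cderive_cst t Z) (is_cderive_Ek sg t r0).
  move=> [_ h]; have := is_derive_mulfun h (is_derive_cst r^-1 t 1).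
  move=> h2; apply: is_derive_eq h2 _; rewrite mulr0 addr0 mul0r add0r /k.
  by rewrite mulrA /Z divfK.
rewrite (@FTC_pos _ k K (K 0) 0)//.
- rewrite sub0r /K Ek0 mulr1 /Z /Hk -[spow 1 r th - _]opprB invrN mulrN Im_opp.
  by rewrite mulNr opprK.
- apply: (cvg_comp _ _ (@cvg_invn2 R)).
  exact: is_derive_continuous (dK 0).
- apply: norm_cvg0; apply: (@squeeze_cvgr _ _ _ _ (cst 0)
    (fun n : nat => normc Z / r * expR (- (n.+2%:R * (sg + r * c))))).
  + near=> n; rewrite normr_ge0/= normrM normfV (gtr0_norm r0) [leRHS]mulrAC.
    rewrite ler_pM2r ?invr_gt0//.
    by apply: le_trans (normr_Im_le _) _; rewrite normcM normc_Ek.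
  + exact: cvg_cst.
  + rewrite -[X in _ --> X](mulr0 (normc Z / r)); apply: cvgM; first exact: cvg_cst.
    apply: (cvg_comp (fun n : nat => n.+2%:R * (sg + r * c)) (fun y => expR (- y))); last exact: cvgr_expR.
    apply/cvgryPge => A; near=> n; rewrite -ler_pdivrMr//.
    apply: (@le_trans _ _ n%:R); last by rewrite ler_nat -addn2 leq_addr.
    by near: n; exact: nbhs_infty_ger.
Unshelve. all: by end_near. Qed.

Lemma Laplace_Jray (sg : R) : 1 <= sg ->
  mu.-integrable (pos R) (fun t => (expR (- (sg * t)) * Jray t)%:E) /\
  \int[mu]_(t in pos R) (expR (- (sg * t)) * Jray t) =
  \int[mu]_(r in pos R) (complex.Im (Hk a sg r th) / r).
Proof.
move=> s1; have c0 := asym_c_gt0; have c10 := asym_c1_gt0.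
(* Real form of the kernel, with W cut off to r > 0 and e^{- sg t} to t > 0: sums of products of
   functions of t, functions of r and continuous functions of t r, hence jointly measurable. *)
pose p1 := (fun r => complex.Re (Wk a r th) / r) \_ (pos R).
pose p2 := (fun r => complex.Im (Wk a r th) / r) \_ (pos R).
pose q := (fun t : R => expR (- (sg * t))) \_ (pos R).
pose f (t r : R) := q t * (p1 r * (expR (t * r * cos th) * sin (t * r * sin th)) +
  p2 r * (expR (t * r * cos th) * cos (t * r * sin th))).
have inp (x : R) : (x \in pos R) = (0 < x).
  by apply/idP/idP => [/mem_pos//|x0]; rewrite inE/= in_itv/= x0.
have fE (t r : R) : 0 < t -> 0 < r ->
    f t r = expR (- (sg * t)) * (complex.Im (Fk a t r th) / r).
  move=> t0 r0; rewrite /f /q /p1 /p2 /patch !inp t0 r0; congr (_ * _).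
  by rewrite /Fk /sexp /cis; move: (Wk a r th) => [x y] /=; ring.
have mW : measurable_fun (pos R) (fun r => complex.Re (Wk a r th) / r) /\
          measurable_fun (pos R) (fun r => complex.Im (Wk a r th) / r).
  have h (r : R) : 0 < r -> exists d, is_cderive r (fun x => Wk a x th) d.
    move=> r0; have n0 := normc_gt0 (asym_spow1_gt0 r0).
    by exists (dWk a r th); have [] := holo_Wk r0 n0.
  have hi (r : R) (r0 : 0 < r) : is_derive r 1 (fun x : R => x^-1) (- 1 / r ^+ 2).
    have rn0 : r != 0 by rewrite gt_eqF.
    exact: @is_derive_invfun R id r 1 rn0 (is_derive_id r 1).
  split; apply: continuous_measurable_pos => r r0; have [d hd] := h r r0.
    exact: is_derive_continuous (is_derive_mulfun hd.1 (hi _ r0)).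
  exact: is_derive_continuous (is_derive_mulfun hd.2 (hi _ r0)).
have mp1 : measurable_fun setT p1 by apply/(measurable_restrictT _ (measurable_itv _)); exact: mW.1.
have mp2 : measurable_fun setT p2 by apply/(measurable_restrictT _ (measurable_itv _)); exact: mW.2.
have mq : measurable_fun setT q.
  apply/(measurable_restrictT _ (measurable_itv _)).
  apply: continuous_measurable_pos => t _.
  exact: is_derive_continuous (is_derive_expfun (is_derive_oppfun (is_derive_mull sg t))).
have mlin (b : R) : measurable_fun setT (fun p : R * R => p.1 * p.2 * b).
  apply: measurable_funM => //; apply: measurable_funM; [exact: measurable_fst|exact: measurable_snd].
have mexp : measurable_fun setT (fun p : R * R => expR (p.1 * p.2 * cos th)).
  by apply: (measurableT_comp (continuous_measurable_fun (@continuous_expR R))); exact: mlin.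
have mcos : measurable_fun setT (fun p : R * R => cos (p.1 * p.2 * sin th)).
  by apply: (measurableT_comp (continuous_measurable_fun (@continuous_cos R))); exact: mlin.
have msin : measurable_fun setT (fun p : R * R => sin (p.1 * p.2 * sin th)).
  by apply: (measurableT_comp (continuous_measurable_fun (@continuous_sin R))); exact: mlin.
have mf : measurable_fun setT (fun p : R * R => f p.1 p.2).
  apply: measurable_funM; first by apply: (measurableT_comp mq); exact: measurable_fst.
  apply: measurable_funD; apply: measurable_funM.
  - by apply: (measurableT_comp mp1); exact: measurable_snd.
  - exact: measurable_funM.
  - by apply: (measurableT_comp mp2); exact: measurable_snd.
  - exact: measurable_funM.
(* The rate sg + r c adds the Laplace damping to the decay of e^{ts} along the ray; 1 <= sg and c <=
   1 make it at least c (1 + r). *)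
have hm (r : R) : 0 < r -> 0 < sg + r * c /\
    normc (Wk a r th) / r / (sg + r * c) <= c1^-1 * c^-1 / (1 + r ^+ 2).
  move=> r0; have m0 : 0 < sg + r * c by rewrite addr_gt0 ?mulr_gt0// (lt_le_trans ltr01).
  split=> //; have p0 : 0 < 1 + r `^ a by rewrite ltr_pwDl ?powR_ge0.
  have mc : c * (1 + r) <= sg + r * c.
    by rewrite mulrDr mulr1 (mulrC c r) lerD2r (le_trans _ s1)// /c; have := cos_geN1 th; lra.
  have im : (sg + r * c)^-1 <= c^-1 * (1 + r)^-1.
    by rewrite -invfM lef_pV2 ?posrE// mulr_gt0// addr_gt0.
  have iA : (normc (spow a r th + 1))^-1 <= c1^-1 * (1 + r `^ a)^-1.
    by rewrite -invfM lef_pV2 ?posrE ?asym_spow1_gt0 ?mulr_gt0// asym_spow1_ge.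
  rewrite normc_Wk -(mulr_powRB1 (ltW r0) a0).
  have -> : r * r `^ (a - 1) / normc (spow a r th + 1) / r / (sg + r * c) =
     r `^ (a - 1) * ((normc (spow a r th + 1))^-1 * (sg + r * c)^-1).
    by field; rewrite (gt_eqF r0) (gt_eqF m0) (gt_eqF (asym_spow1_gt0 r0)).
  apply: (@le_trans _ _ (r `^ (a - 1) * ((c1^-1 * (1 + r `^ a)^-1) * (c^-1 * (1 + r)^-1)))).
    by rewrite ler_wpM2l ?powR_ge0// ler_pM ?invr_ge0 ?normc_ge0 ?(ltW m0).
  have -> : r `^ (a - 1) * (c1^-1 * (1 + r `^ a)^-1 * (c^-1 * (1 + r)^-1)) =
     c1^-1 * c^-1 * (r `^ (a - 1) / (1 + r `^ a) / (1 + r)) by ring.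
  by rewrite ler_wpM2l ?powR_sub1_dominated// mulr_ge0// invr_ge0 ltW.
have hf (t r : R) : 0 < t -> 0 < r ->
    `|f t r| <= normc (Wk a r th) / r * expR (- (t * (sg + r * c))).
  move=> t0 r0; rewrite fE// normrM (ger0_norm (expR_ge0 _)) normrM normfV (gtr0_norm r0).
  apply: (@le_trans _ _ (expR (- (sg * t)) * (normc (Fk a t r th) / r))).
    by rewrite ler_wpM2l ?expR_ge0// ler_pM2r ?invr_gt0// normr_Im_le.
  rewrite /Fk normcM sexp_norm.
  have -> : - (t * (sg + r * c)) = - (sg * t) + - (r * (t * c)) by ring.
  by rewrite expRD le_eqVlt; apply/orP; left; apply/eqP; ring.
have it (t : R) : 0 < t -> mu.-integrable (pos R) (EFin \o f t).
  move=> t0; apply: eq_integrable (integrable_mull (expR (- (sg * t))) (integrable_Fk t0)) => //.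
  by move=> r /mem_pos r0; rewrite [in RHS]/comp fE.
have ir (r : R) : 0 < r -> mu.-integrable (pos R) (EFin \o (f ^~ r)).
  move=> r0; apply: eq_integrable (Laplace_kernel s1 r0).1 => //.
  by move=> t /mem_pos t0; rewrite [in RHS]/comp fE.
have ft (t r : R) : ~~ (0 < t) -> f t r = 0.
  by move=> t0; rewrite /f /q /patch inp (negbTE t0) mul0r.
have fr (t r : R) : ~~ (0 < r) -> f t r = 0.
  by move=> r0; rewrite /f /p1 /p2 /patch inp (negbTE r0) !mul0r addr0 mulr0.
have [Fi FE] := Fubini_pos mf ft fr hm hf it ir.
have JE (t : R) : 0 < t -> \int[mu]_(r in pos R) f t r = expR (- (sg * t)) * Jray t.
  move=> t0; rewrite /Jray -(Rintegral_mull _ (integrable_Fk t0)).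
  by apply: eq_Rintegral => r /mem_pos r0; rewrite fE.
split.
  by apply: eq_integrable Fi => // t /mem_pos t0; rewrite JE.
rewrite (@eq_Rintegral _ _ _ mu (pos R) (fun t => \int[mu]_(r in pos R) f t r)); last first.
  by move=> t /mem_pos t0; rewrite JE.
rewrite FE; apply: eq_Rintegral => r /mem_pos r0.
rewrite -(Laplace_kernel s1 r0).2.
by apply: eq_Rintegral => t /mem_pos t0; rewrite fE.
Qed.

End asymptotics.

(** * The Laplace transform of the Mittag-Leffler function *)

Lemma cvg_le_cst (R : realType) (u : nat -> R) (l c : R) :
  u n @[n --> \oo] --> l -> (forall n, u n <= c) -> l <= c.
Proof.
move=> ul uc; rewrite -(cvg_lim (@Rhausdorff R) ul).
by apply: limr_le; [apply/cvg_ex; exists l|exact: nearW].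
Qed.

(** For |z|, |w| <= Z, |z^k - w^k| <= (2 Z)^k |z - w|, a crude form of k Z^(k-1) |z - w|; the term
    bound at 2 Z then still leaves a geometric series. This gives continuity of [fml] without
    termwise differentiation. *)
Lemma ml_lipschitz (R : realType) (a b Z : R) : 0 < a -> 1 <= b -> 1 <= Z ->
  exists2 C : R, 0 <= C & forall z w : R, `|z| <= Z -> `|w| <= Z ->
    `|mittag_leffler a b z - mittag_leffler a b w| <= C * `|z - w|.
Proof.
move=> a0 b1 Z1; have Z0 : 0 < Z by exact: lt_le_trans Z1.
have [C C0 hC] := @ml_term_bound R a b (2 * Z) a0 b1.
exists (C * 2) => [|z w zZ wZ]; first by rewrite mulr_ge0// ltW.
have G0 (k : nat) : 0 < Gamma (a * k%:R + b).
  by apply: Gamma_gt0; rewrite (le_trans b1)// lerDr mulr_ge0// ltW.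
have hX (k : nat) : `|z ^+ k - w ^+ k| <= (2 * Z) ^+ k * `|z - w|.
  elim: k => [|k IH]; first by rewrite !expr0 subrr normr0 mul1r.
  have -> : z ^+ k.+1 - w ^+ k.+1 = z * (z ^+ k - w ^+ k) + w ^+ k * (z - w).
    by rewrite !exprS; ring.
  apply: le_trans (ler_normD _ _) _; rewrite !normrM.
  have h1 : `|z| * `|z ^+ k - w ^+ k| <= Z * ((2 * Z) ^+ k * `|z - w|).
    by apply: ler_pM.
  have h2 : `|w ^+ k| <= Z * (2 * Z) ^+ k.
    rewrite normrX; apply: (@le_trans _ _ ((2 * Z) ^+ k)).
      by rewrite lerXn2r ?nnegrE// ?mulr_ge0 ?(ltW Z0)//; move: wZ Z0; lra.
    by rewrite ler_peMl// exprn_ge0// mulr_ge0// ltW.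
  have h3 := ler_wpM2r (normr_ge0 (z - w)) h2.
  apply: le_trans (lerD h1 h3) _.
  by rewrite exprS le_eqVlt; apply/orP; left; apply/eqP; ring.
have hn (n : nat) : `|series (fun k : nat => z ^+ k / Gamma (a * k%:R + b)) n -
     series (fun k : nat => w ^+ k / Gamma (a * k%:R + b)) n| <= C * 2 * `|z - w|.
  rewrite /series/= -sumrB.
  apply: le_trans (ler_norm_sum _ _ _) _.
  apply: (@le_trans _ _ (\sum_(0 <= k < n) C * `|z - w| * 2^-1 ^+ k)).
    apply: ler_sum => k _; rewrite -mulrBl normrM normfV (gtr0_norm (G0 k)).
    have := hC k; rewrite normrM normfV (gtr0_norm (G0 k)) => h.
    have := ler_wpM2r (normr_ge0 (z - w)) h => {}h.
    rewrite [leRHS]mulrAC; apply: le_trans h.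
    rewrite [leRHS]mulrAC ler_pM2r ?invr_gt0 ?G0//.
    apply: le_trans (hX k) _; rewrite ler_wpM2r// ler_norm//.
  rewrite -mulr_sumr mulrAC ler_wpM2r// ler_pM2l//.
  have -> : \sum_(0 <= k < n) 2^-1 ^+ k = 2 - 2 * 2^-1 ^+ n :> R.
    elim: n => [|n IH]; first by rewrite big_geq// expr0 mulr1 subrr.
    rewrite big_nat_recr//= IH exprS; lra.
  by rewrite gerBl mulr_ge0// exprn_ge0// invr_ge0.
have cz := @cvg_ml R a b z a0 b1; have cw := @cvg_ml R a b w a0 b1.
apply: (cvg_le_cst _ hn); apply: cvg_norm; exact: cvgB.
Qed.

Definition fml (R : realType) (a t : R) := mittag_leffler a 1 (- (t `^ a)).

Lemma fml_continuous (R : realType) (a t : R) : 0 < a -> 0 < t ->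
  {for t, continuous (fml a)}.
Proof.
move=> a0 t0; pose Z := t `^ a + 1.
have Z1 : 1 <= Z by rewrite lerDr powR_ge0.
have [C C0 hC] := ml_lipschitz a0 (lexx 1) Z1.
have cp : {for t, continuous (fun x : R => x `^ a)} by exact: continuous_powR.
apply/cvgrPdist_le => e e0; near=> x.
have tx1 : `|t `^ a - x `^ a| <= 1.
  by near: x; move/cvgrPdist_le : cp => /(_ 1 ltr01).
have tx2 : `|t `^ a - x `^ a| <= e / (C + 1).
  by near: x; move/cvgrPdist_le : cp; apply; rewrite divr_gt0// ltr_wpDl.
rewrite /fml; apply: le_trans (hC _ _ _ _) _.
- by rewrite normrN ger0_norm ?powR_ge0// lerDl.
- rewrite normrN ger0_norm ?powR_ge0// /Z.
  by move: tx1; rewrite distrC => /(le_trans (ler_norm _)); lra.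
have -> : `|- (t `^ a) - - (x `^ a)| = `|t `^ a - x `^ a| by rewrite -opprD normrN.
apply: (@le_trans _ _ ((C + 1) * `|t `^ a - x `^ a|)).
  by rewrite ler_wpM2r// lerDl.
by rewrite mulrC -ler_pdivlMr// ltr_wpDl.
Unshelve. all: by end_near. Qed.

Lemma integrable_add (R : realType) (f g : R -> R) :
  mu.-integrable (pos R) (EFin \o f) -> mu.-integrable (pos R) (EFin \o g) ->
  mu.-integrable (pos R) (EFin \o (fun r => f r + g r)).
Proof.
move=> fi gi; have h : mu.-integrable (pos R) ((EFin \o f) \+ (EFin \o g))%E.
  exact: integrableD.
by apply: eq_integrable h => // r _; rewrite /= EFinD.
Qed.

Lemma Rintegral_add (R : realType) (f g : R -> R) :
  mu.-integrable (pos R) (EFin \o f) -> mu.-integrable (pos R) (EFin \o g) ->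
  \int[mu]_(r in pos R) (f r + g r) =
  \int[mu]_(r in pos R) f r + \int[mu]_(r in pos R) g r.
Proof. by move=> fi gi; rewrite RintegralD. Qed.

(** Each power t^(a k) transforms to Gamma (a k + 1) sg^(- a k - 1), leaving a geometric series of
    ratio - sg^(- a). Dominated convergence needs one majorant for all partial sums, and this is
    where 3 <= sg enters. *)
Lemma Laplace_fml (R : realType) (a sg : R) : 1 < a -> 3 <= sg ->
  mu.-integrable (pos R) (fun t => (expR (- (sg * t)) * fml a t)%:E) /\
  \int[mu]_(t in pos R) (expR (- (sg * t)) * fml a t) =
  sg `^ (a - 1) / (sg `^ a + 1).
Proof.
move=> a1 s3; have a0 : 0 < a by exact: lt_trans a1.
have s0 : 0 < sg by exact: lt_le_trans s3.
pose u (k : nat) (t : R) := expR (- (sg * t)) * ((- (t `^ a)) ^+ k / Gamma (a * k%:R + 1)).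
pose S (n : nat) (t : R) := \sum_(0 <= k < n) u k t.
have x1 (k : nat) : 1 <= a * k%:R + 1 by rewrite lerDr mulr_ge0// ltW.
have xk (k : nat) : a * k%:R + 1 - 1 = a * k%:R by rewrite addrK.
have y0 (k : nat) : 0 <= a * k%:R by rewrite mulr_ge0// ltW.
have uE (k : nat) (t : R) : 0 < t -> u k t =
    (-1) ^+ k / Gamma (a * k%:R + 1) * (t `^ (a * k%:R) * expR (- (t * sg))).
  move=> t0; rewrite /u [(- (t `^ a)) ^+ k]exprNn powRrM powR_mulrn ?powR_ge0// (mulrC sg).
  by move: (Gamma _)^-1 ((-1) ^+ k) ((t `^ a) ^+ k) (expR _) => G m p e; ring.
have ui (k : nat) : mu.-integrable (pos R) (EFin \o u k).
  apply: eq_integrable (integrable_mull ((-1) ^+ k / Gamma (a * k%:R + 1))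
    (integrable_powR_expR (y0 k) s0)) => //.
  by move=> t /mem_pos t0; rewrite [in RHS]/comp uE.
have uI (k : nat) : \int[mu]_(t in pos R) u k t = sg^-1 * (- (sg `^ (- a))) ^+ k.
  have -> : \int[mu]_(t in pos R) u k t = (-1) ^+ k / Gamma (a * k%:R + 1) *
     \int[mu]_(t in pos R) (t `^ (a * k%:R) * expR (- (t * sg))).
    rewrite -(Rintegral_mull _ (integrable_powR_expR (y0 k) s0)).
    by apply: eq_Rintegral => t /mem_pos t0; rewrite uE.
  have := Gamma_scale (x1 k) s0; rewrite xk => ->.
  rewrite mulrA divfK ?gt_eqF ?Gamma_gt0// [in RHS]exprNn.
  have -> : sg `^ (- a) ^+ k = sg `^ (- (a * k%:R)).
    by rewrite -mulNr powRrM powR_mulrn ?powR_ge0.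
  rewrite opprD powRD; last by rewrite (gt_eqF s0) implybT.
  rewrite powR_inv1 ?(ltW s0)//.
  by move: ((-1) ^+ k) (sg `^ _) sg^-1 => x y z; ring.
have Si (n : nat) : mu.-integrable (pos R) (EFin \o S n).
  elim: n => [|n IH].
    apply: (@integrable_dominated _ _ 0).
      by rewrite (_ : S 0%N = cst 0) //; apply/funext => t; rewrite /S big_geq.
    by move=> t _; rewrite /S big_geq// normr0 mul0r.
  apply: eq_integrable (integrable_add IH (ui n)) => //.
  by move=> t _; rewrite /= /S big_nat_recr.
have SI (n : nat) : \int[mu]_(t in pos R) S n t = \sum_(0 <= k < n) sg^-1 * (- (sg `^ (- a))) ^+ k.
  elim: n => [|n IH].
    rewrite big_geq// /Rintegral integral0_eq// => t _.
    by rewrite /S big_geq.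
  rewrite big_nat_recr//= -IH -uI -(Rintegral_add (Si n) (ui n)).
  by apply: eq_Rintegral => t _; rewrite /S big_nat_recr.
pose g (t : R) := 2 * expR 1 * (t `^ 0 * expR (- (t * (sg - 2)))).
have s2 : 0 < sg - 2 by move: s3; lra.
have gi : mu.-integrable (pos R) (EFin \o g).
  exact: integrable_mull (integrable_powR_expR (lexx 0) s2).
have Sg (n : nat) (t : R) : 0 < t -> `|S n t| <= g t.
  move=> t0; rewrite /S /g powRr0 mul1r.
  apply: le_trans (ler_norm_sum _ _ _) _.
  (* M^(a k) = 2^k t^(a k), so the lower bound for Gamma leaves 2^-k. As 1 < a, M <= 2 t, and the
     resulting factor e^{2t} is absorbed because sg > 2. *)
  pose M := 2 `^ a^-1 * t.
  have M0 : 0 < M by rewrite mulr_gt0// powR_gt0.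
  have M2 : M <= 2 * t.
    rewrite ler_pM2r// -[leRHS]powRr1// ler_powR// ?ler1n// invf_le1//; exact: ltW.
  have ub (k : nat) : `|u k t| <= expR (- (sg * t)) * expR (2 * t + 1) * 2^-1 ^+ k.
    rewrite /u normrM (ger0_norm (expR_ge0 _)) -[leRHS]mulrA ler_wpM2l ?expR_ge0//.
    have G0 := Gamma_gt0 (x1 k).
    rewrite normrM normrX normrN normfV (gtr0_norm G0) (ger0_norm (powR_ge0 _ _)).
    rewrite ler_pdivrMr//; have := Gamma_ge (x1 k) M0; rewrite xk => h.
    apply: (@le_trans _ _ (expR (M + 1) * 2^-1 ^+ k * Gamma (a * k%:R + 1))); last first.
      by rewrite ler_pM2r// ler_pM2r ?exprn_gt0 ?invr_gt0// ler_expR lerD2r.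
    apply: le_trans (ler_wpM2l _ h); last by rewrite mulr_ge0 ?expR_ge0 ?exprn_ge0 ?invr_ge0.
    have -> : M `^ (a * k%:R) = 2 ^+ k * (t `^ a) ^+ k.
      rewrite /M powRrM powR_mulrn ?powR_ge0// powRM ?powR_ge0 ?(ltW t0)//.
      by rewrite -powRrM mulVf ?gt_eqF// powRr1// exprMn.
    rewrite le_eqVlt; apply/orP; left; apply/eqP; rewrite expRN.
    have e0 : expR (M + 1) != 0 by rewrite gt_eqF ?expR_gt0.
    by rewrite exprVn; field; rewrite e0 expf_neq0.
  apply: le_trans (ler_sum _ (fun k _ => ub k)) _.
  rewrite -mulr_sumr -expRD.
  have -> : \sum_(0 <= k < n) 2^-1 ^+ k = 2 - 2 * 2^-1 ^+ n :> R.
    elim: n => [|n IH]; first by rewrite big_geq// expr0 mulr1 subrr.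
    by rewrite big_nat_recr//= IH exprS; lra.
  have -> : 2 * expR 1 * expR (- (t * (sg - 2))) = expR (- (sg * t) + (2 * t + 1)) * 2.
    rewrite -mulrA -expRD mulrC; congr (expR _ * _); ring.
  by rewrite ler_pM2l ?expR_gt0// gerBl mulr_ge0// exprn_ge0// invr_ge0.
have Sc (t : R) : S n t @[n --> \oo] --> expR (- (sg * t)) * fml a t.
  have h := @cvg_ml R a 1 (- (t `^ a)) a0 (lexx 1).
  apply: (cvg_trans _ (cvgM (cvg_cst (expR (- (sg * t)))) h)).
  by apply: near_eq_cvg; apply: nearW => n; rewrite /S /series/= mulr_sumr.
have mF : measurable_fun (pos R) (fun t => expR (- (sg * t)) * fml a t).
  apply: continuous_measurable_pos => t t0; apply: cvgM; last exact: fml_continuous.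
  exact: is_derive_continuous (is_derive_expfun (is_derive_oppfun (is_derive_mull sg t))).
have Fg (t : R) : 0 < t -> `|expR (- (sg * t)) * fml a t| <= g t.
  move=> t0; apply: (@cvg_le_cst _ (fun n => `|S n t|)) => [|n]; last exact: Sg.
  by apply: cvg_norm; exact: Sc.
split.
  apply: (le_integrable _ _ _ gi) => //; first by apply/measurable_EFinP; exact: mF.
  move=> t /=; rewrite in_itv/= andbT => t0; rewrite lee_fin (le_trans (Fg _ t0))//.
  exact: ler_norm.
have l1 : \int[mu]_(t in pos R) S n t @[n --> \oo] -->
    \int[mu]_(t in pos R) (expR (- (sg * t)) * fml a t).
  apply: (@dominated_cvg_pos _ _ _ g 0) => //.
  by move=> n; have /integrableP[/measurable_EFinP] := Si n.
pose q := - (sg `^ (- a)).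
have sa1 : 1 < sg `^ a.
  rewrite -(powRr0 sg) /powR gt_eqF// ltr_expR mul0r mulr_gt0//.
  by rewrite ln_gt0//; move: s3; lra.
have q1 : `|q| < 1.
  by rewrite normrN ger0_norm ?powR_ge0// powRN invf_lt1// (lt_trans ltr01).
have l2 : \int[mu]_(t in pos R) S n t @[n --> \oo] --> sg^-1 * (1 - q)^-1.
  have := cvg_geometric_series (a := sg^-1) q1.
  apply: cvg_trans; rewrite (_ : (fun n => _) = series (geometric sg^-1 q))//.
  by apply/funext => n; rewrite SI.
have -> : sg `^ (a - 1) / (sg `^ a + 1) = sg^-1 * (1 - q)^-1.
  rewrite /q opprK powRN powRB ?(gt_eqF s0) ?implybT// powRr1 ?(ltW s0)//.
  by field; rewrite (gt_eqF s0) !gt_eqF//; move: sa1; lra.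
exact: (cvg_unique _ l1 l2).
Qed.

(** * Lerch's theorem and the decay of the Mittag-Leffler function *)

Lemma Rintegral_ge_itv (R : realType) (F : R -> R) (b l c : R) :
  mu.-integrable (pos R) (EFin \o F) -> (forall t : R, 0 < t -> 0 <= F t) ->
  0 < b -> b < l -> 0 <= c -> (forall t : R, b <= t <= l -> c <= F t) ->
  c * (l - b) <= \int[mu]_(t in pos R) F t.
Proof.
move=> Fi F0 b0 bl c0 cF.
rewrite -lee_fin /Rintegral fineK; last by apply: integrable_fin_num.
have mg : measurable_fun (pos R) (fun u : R => (F u)%:E) by have /integrableP[] := Fi.
apply: (@le_trans _ _ (\int[mu]_(u in `[b, l]) (F u)%:E)%E); last first.
  apply: ge0_subset_integral => //.
  - by move=> u /=; rewrite in_itv/= andbT => u0; rewrite lee_fin F0.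
  - by move=> u /=; rewrite !in_itv/= andbT => /andP[/(lt_le_trans b0)].
apply: (@le_trans _ _ (\int[mu]_(u in `[b, l]) (cst c%:E u))%E).
  by rewrite integral_cst//= lebesgue_measure_itv/= lte_fin bl -EFinB -EFinM.
apply: ge0_le_integral => //.
- apply: measurable_funS mg => //.
  by move=> u /=; rewrite !in_itv/= andbT => /andP[/(lt_le_trans b0)].
Qed.

(* Lerch: the polynomials (1 - (x - u0)^2)^n in x = e^{-t} peak at x = u0. *)
Lemma lerch_le0 (R : realType) (D : R -> R) (s0 t0 : R) : 0 <= s0 -> 0 < t0 ->
  (forall n : nat, mu.-integrable (pos R)
     (EFin \o (fun t => expR (- ((s0 + n%:R) * t)) * D t))) ->
  (forall n : nat, \int[mu]_(t in pos R) (expR (- ((s0 + n%:R) * t)) * D t) = 0) ->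
  {for t0, continuous D} -> D t0 <= 0.
Proof.
move=> s00 t00 gi0 gI cD; rewrite leNgt; apply/negP => D0.
pose g (t : R) := expR (- (s0 * t)) * D t.
have gE (n : nat) (t : R) : expR (- ((s0 + n%:R) * t)) * D t = expR (- t) ^+ n * g t.
  by rewrite -expRM_natl /g mulrA -expRD; congr (expR _ * _); ring.
(* Horner induction: passing from p to p X + b raises the exponent j by one, hence the statement for
   all j. *)
have poly_int (p : {poly R}) (j : nat) :
    mu.-integrable (pos R) (EFin \o (fun t => p.[expR (- t)] * (expR (- t) ^+ j * g t))) /\
    \int[mu]_(t in pos R) (p.[expR (- t)] * (expR (- t) ^+ j * g t)) = 0.
  elim/poly_ind: p j => [|p b IH] j.
    have z : (fun t : R => (0 : {poly R}).[expR (- t)] * (expR (- t) ^+ j * g t)) = cst 0.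
      by apply/funext => t; rewrite horner0 mul0r.
    rewrite z; split; last by rewrite /Rintegral integral0.
    exact: integrable0.
  have bi : mu.-integrable (pos R) (EFin \o (fun t => b * (expR (- t) ^+ j * g t))).
    apply: eq_integrable (integrable_mull b (gi0 j)) => //.
    by move=> t _; rewrite /= gE.
  have [pi1 pi2] := IH j.+1.
  have e (t : R) : (p * 'X + b%:P).[expR (- t)] * (expR (- t) ^+ j * g t) =
      p.[expR (- t)] * (expR (- t) ^+ j.+1 * g t) + b * (expR (- t) ^+ j * g t).
    by rewrite hornerD hornerMX hornerC exprS; ring.
  split.
    by apply: eq_integrable (integrable_add pi1 bi) => // t _; rewrite /= e.
  rewrite (@eq_Rintegral _ _ _ mu (pos R) (fun t => p.[expR (- t)] *
     (expR (- t) ^+ j.+1 * g t) + b * (expR (- t) ^+ j * g t))); last by move=> t _; rewrite e.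
  rewrite (Rintegral_add pi1 bi) pi2 add0r.
  have -> : \int[mu]_(t in pos R) (b * (expR (- t) ^+ j * g t)) =
            \int[mu]_(t in pos R) (b * (expR (- ((s0 + j%:R) * t)) * D t)).
    by apply: eq_Rintegral => t _; rewrite gE.
  by rewrite (Rintegral_mull b (gi0 j)) gI mulr0.
pose u0 := expR (- t0).
have u01 : u0 < 1 by rewrite expR_lt1 oppr_lt0.
have u00 : 0 < u0 by exact: expR_gt0.
have lnu0 : - ln u0 = t0 by rewrite expRK opprK.
have cln : {for u0, continuous (fun u => D (- ln u))}.
  apply: (@continuous_comp _ _ _ (fun u => - ln u) D); last by rewrite lnu0.
  by apply: continuousN; exact: is_derive_continuous (is_derive1_ln u00).
have [eta [eta0 eta1 heta]] : exists eta : R, [/\ 0 < eta, eta <= 1 / 2 &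
    forall u : R, `|u0 - u| < eta -> D t0 / 2 <= D (- ln u)].
  have D2 : 0 < D t0 / 2 by rewrite divr_gt0.
  move/cvgrPdist_le : cln => /(_ _ D2) [e /= e0 he].
  exists (Num.min e (1 / 2)); split.
  - by rewrite lt_min e0 divr_gt0.
  - by rewrite ge_min lexx orbT.
  - move=> u; rewrite lt_min => /andP[ue _]; have := he u ue; rewrite lnu0.
    by move=> /(le_trans (ler_norm _)); lra.
have [dl [dl0 hdl]] : exists dl : R, 0 < dl /\
    forall t : R, `|t0 - t| <= dl -> `|u0 - expR (- t)| <= eta / 2.
  have ce : {for t0, continuous (fun t : R => expR (- t))}.
    exact: is_derive_continuous (is_derive_expfun (is_derive_oppfun (is_derive_id t0 1))).
  have e2 : 0 < eta / 2 by rewrite divr_gt0.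
  move/cvgrPdist_le : ce => /(_ _ e2) [e /= e0 he].
  exists (e / 2); split; first by rewrite divr_gt0.
  by move=> t ht; apply: he; rewrite /=; apply: le_lt_trans ht _; lra.
(* Outside the eta-neighbourhood of u0 the base 1 - (x - u0)^2 is at most [kap]; within eta / 2 of
   u0 it is at least [kap'], which is larger. The bound eta <= 1/2 keeps [kap] positive. *)
pose kap := 1 - eta ^+ 2; pose kap' := 1 - (eta / 2) ^+ 2.
have et2 : eta ^+ 2 <= 1 / 4.
  have -> : 1 / 4 = (1 / 2) ^+ 2 :> R by field.
  by rewrite lerXn2r ?nnegrE// ?(ltW eta0)// divr_ge0.
have et0 : 0 < eta ^+ 2 by rewrite exprn_gt0.
have k0 : 0 < kap by rewrite /kap; lra.
have kk : kap < kap' by rewrite /kap /kap' exprMn exprVn; lra.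
have gint : mu.-integrable (pos R) (EFin \o g).
  apply: eq_integrable (gi0 0%N) => // t _.
  by rewrite /= gE expr0 mul1r.
have agi : mu.-integrable (pos R) (EFin \o (fun t => `|g t|)) := integrable_norm gint.
pose G := \int[mu]_(t in pos R) `|g t|.
pose cst := expR (- (s0 * (t0 + dl))) * (D t0 / 2).
have cst0 : 0 < cst by rewrite mulr_gt0 ?expR_gt0// divr_gt0.
have key (n : nat) : kap' ^+ n * cst * dl <= kap ^+ n * G.
  pose p : {poly R} := (1 - ('X - u0%:P) ^+ 2) ^+ n.
  have pE (x : R) : p.[x] = (1 - (x - u0) ^+ 2) ^+ n.
    by rewrite /p horner_exp hornerD hornerN horner_exp !hornerE.
  have [pi1 pi2] := poly_int p 0%N.
  have kgi := integrable_mull (kap ^+ n) agi.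
  (* Adding kap^n |g| makes the integrand nonnegative off the peak too, so that everything outside
     [t0, t0 + dl] can be discarded. *)
  pose F (t : R) := p.[expR (- t)] * (expR (- t) ^+ 0 * g t) + kap ^+ n * `|g t|.
  have Fi : mu.-integrable (pos R) (EFin \o F) := integrable_add pi1 kgi.
  have FI : \int[mu]_(t in pos R) F t = kap ^+ n * G.
    by rewrite (Rintegral_add pi1 kgi) pi2 add0r (Rintegral_mull _ agi).
  have x01 (t : R) : 0 < t -> 0 <= (expR (- t) - u0) ^+ 2 <= 1.
    move=> t1; rewrite sqr_ge0/= -[leRHS](expr1n _ 2) -real_normK ?num_real//.
    rewrite lerXn2r ?nnegrE// ler_norml.
    have := expR_gt0 (- t); have : expR (- t) < 1 by rewrite expR_lt1 oppr_lt0.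
    by move=> h1 h2; apply/andP; split; lra.
  have q0 (t : R) : 0 < t -> 0 <= 1 - (expR (- t) - u0) ^+ 2.
    by move=> /x01/andP[_]; rewrite subr_ge0.
  have Dlow (t : R) : 0 < t -> `|u0 - expR (- t)| < eta -> D t0 / 2 <= D t.
    by move=> t1 /heta; rewrite expRK opprK.
  have F0 (t : R) : 0 < t -> 0 <= F t.
    move=> t1; rewrite /F expr0 mul1r pE.
    have kg : 0 <= kap ^+ n * `|g t| by rewrite mulr_ge0 ?exprn_ge0// ltW.
    have [near|far] := ltP `|u0 - expR (- t)| eta.
      rewrite addr_ge0// mulr_ge0 ?exprn_ge0 ?q0//.
      apply: mulr_ge0; first exact: expR_ge0.
      apply: le_trans (Dlow _ t1 near).
      by rewrite divr_ge0// ltW.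
    have qk : 1 - (expR (- t) - u0) ^+ 2 <= kap.
      rewrite /kap lerD2l lerN2 -[leRHS]real_normK ?num_real// distrC.
      by rewrite lerXn2r ?nnegrE// ltW.
    have h : `|(1 - (expR (- t) - u0) ^+ 2) ^+ n * g t| <= kap ^+ n * `|g t|.
      rewrite normrM ler_wpM2r// normrX (ger0_norm (q0 _ t1)) lerXn2r ?nnegrE ?q0//.
      exact: ltW.
    by move: h; rewrite ler_norml => /andP[h _]; move: h; lra.
  rewrite -FI -[dl](addrK t0) (addrC dl).
  apply: Rintegral_ge_itv => //.
  - by rewrite ltrDl.
  - by rewrite mulr_ge0 ?(ltW cst0)// exprn_ge0// ltW// (lt_trans k0).
  - move=> t /andP[tt1 tt2]; have t1 : 0 < t by exact: lt_le_trans tt1.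
    have ht : `|u0 - expR (- t)| <= eta / 2.
      by apply: hdl; rewrite ler_norml; apply/andP; split; move: tt1 tt2 dl0; lra.
    have near : `|u0 - expR (- t)| < eta by apply: le_lt_trans ht _; move: eta0; lra.
    apply: (@le_trans _ _ (p.[expR (- t)] * (expR (- t) ^+ 0 * g t))); last first.
      by rewrite lerDl mulr_ge0 ?exprn_ge0// ltW.
    rewrite expr0 mul1r pE.
    have qk : kap' <= 1 - (expR (- t) - u0) ^+ 2.
      rewrite lerD2l lerN2 -[leLHS]real_normK ?num_real// distrC.
      by rewrite lerXn2r ?nnegrE// divr_ge0// ltW.
    apply: ler_pM.
    + by rewrite exprn_ge0// ltW// (lt_trans k0).
    + exact: ltW.
    + by rewrite lerXn2r ?nnegrE ?q0// ltW// (lt_trans k0).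
    + rewrite /g ler_pM ?expR_ge0//; [by rewrite divr_ge0// ltW| |exact: Dlow].
      by rewrite ler_expR lerN2 ler_wpM2l.
pose rho := kap' / kap.
have rho1 : 1 < rho by rewrite ltr_pdivlMr// mul1r.
(* Bernoulli's inequality: rho^n is unbounded, whereas [keyn] bounds rho^n times a positive constant
   by [G]. *)
have bern (n : nat) : 1 + n%:R * (rho - 1) <= rho ^+ n.
  elim: n => [|n IH]; first by rewrite mul0r addr0 expr0.
  rewrite exprS -natr1; have r0 : 0 < rho by exact: lt_trans rho1.
  have := ler_wpM2l (ltW r0) IH; have n0 : 0 <= n%:R :> R by [].
  have : 0 <= n%:R * (rho - 1) ^+ 2 by rewrite mulr_ge0 ?sqr_ge0.
  nra.
have keyn (n : nat) : rho ^+ n * (cst * dl) <= G.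
  have kn : 0 < kap ^+ n by rewrite exprn_gt0.
  rewrite -(ler_pM2l kn) mulrA (_ : kap ^+ n * rho ^+ n = kap' ^+ n).
    by rewrite mulrA; exact: key.
  by rewrite -exprMn /rho mulrC divfK// gt_eqF.
have cd0 : 0 < cst * dl by rewrite mulr_gt0.
have r10 : 0 < rho - 1 by rewrite subr_gt0.
near \oo => n.
have nb : G / (cst * dl) / (rho - 1) <= n%:R by near: n; exact: nbhs_infty_ger.
have := keyn n; rewrite -ler_pdivlMr// => h.
by move: nb; rewrite ler_pdivrMr// => nb; have := bern n; lra.
Unshelve. all: by end_near. Qed.

Lemma lerch_eq0 (R : realType) (D : R -> R) (s0 t0 : R) : 0 <= s0 -> 0 < t0 ->
  (forall n : nat, mu.-integrable (pos R)
     (EFin \o (fun t => expR (- ((s0 + n%:R) * t)) * D t))) ->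
  (forall n : nat, \int[mu]_(t in pos R) (expR (- ((s0 + n%:R) * t)) * D t) = 0) ->
  {for t0, continuous D} -> D t0 = 0.
Proof.
move=> s00 t00 Di DI cD; apply/eqP; rewrite eq_le (lerch_le0 s00 t00 Di DI cD)/=.
rewrite -oppr_le0; apply: (@lerch_le0 _ (fun t => - D t) _ _ s00 t00) => [n|n|].
- apply: eq_integrable (integrable_mull (-1) (Di n)) => //.
  by move=> t _; rewrite /= mulN1r mulrN.
- rewrite (@eq_Rintegral _ _ _ mu (pos R)
    (fun t => -1 * (expR (- ((s0 + n%:R) * t)) * D t))).
    by rewrite (Rintegral_mull (-1) (Di n)) DI mulr0.
  by move=> t _; rewrite mulN1r mulrN.
- exact: continuousN.
Qed.

(** Both transforms are sampled at 3 + n, starting where [Laplace_fml] becomes available;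
    [integral_Hk] evaluates the one of the ray integral. *)
Lemma fml_Jray (R : realType) (a th t : R) : 1 < a < 2 -> pi / 2 < th ->
  a * th < pi -> 0 < t -> pi * fml a t = Jray a th t.
Proof.
move=> a12 th1 ath t0; have /andP[a1 a2] := a12.
have a0 : 0 < a by exact: lt_trans a1.
have th0 : 0 < th by apply: lt_trans th1; rewrite divr_gt0 ?pi_gt0.
apply/eqP; rewrite -subr_eq0; apply/eqP.
have s3 (n : nat) : 3 <= 3 + n%:R :> R by rewrite lerDl.
have s1 (n : nat) : 1 <= 3 + n%:R :> R by apply: le_trans (s3 n); rewrite ler1n.
have fi (n : nat) := (Laplace_fml a1 (s3 n)).1.
have Ji (n : nat) := (Laplace_Jray a1 th1 ath (s1 n)).1.
have E (n : nat) (x : R) : expR (- ((3 + n%:R) * x)) * (pi * fml a x - Jray a th x) =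
    pi * (expR (- ((3 + n%:R) * x)) * fml a x) - expR (- ((3 + n%:R) * x)) * Jray a th x.
  by ring.
apply: (@lerch_eq0 _ (fun x => pi * fml a x - Jray a th x) 3 t) => // [n|n|].
- apply: eq_integrable (integrable_sub (integrable_mull pi (fi n)) (Ji n)) => //.
  by move=> x _; rewrite [in RHS]/comp E.
- rewrite (@eq_Rintegral _ _ _ mu (pos R) (fun x => pi * (expR (- ((3 + n%:R) * x)) * fml a x) -
    expR (- ((3 + n%:R) * x)) * Jray a th x)); last by move=> x _; rewrite E.
  rewrite (Rintegral_sub (integrable_mull pi (fi n)) (Ji n)) (Rintegral_mull pi (fi n)).
  rewrite (Laplace_fml a1 (s3 n)).2 (Laplace_Jray a1 th1 ath (s1 n)).2.
  by rewrite (integral_Hk a12 (s1 n) th0 ath) subrr.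
- have cJ : {for t, continuous (Jray a th)} by exact: Jray_continuous.
  have cf : {for t, continuous (fun x => pi * fml a x)}.
    by apply: cvgM; [exact: cvg_cst|exact: fml_continuous].
  exact: (continuousB cf cJ).
Qed.

(** * Asymptotics and geometric decay *)

Lemma fml_asymptotics (R : realType) (a : R) : 1 < a < 2 ->
  exists A C : R, [/\ 0 < A, 0 <= C,
    forall t, 0 < t -> `|fml a t + A * t `^ (- a)| <= C * t `^ (- a) ^+ 2 &
    forall t1 t2, 0 < t1 -> t1 < t2 ->
      fml a t1 + A * t1 `^ (- a) - (fml a t2 + A * t2 `^ (- a)) <=
      C * (t1 `^ (- a) ^+ 2 - t2 `^ (- a) ^+ 2)].
Proof.
move=> a12; have /andP[a1 a2] := a12; have a0 : 0 < a by exact: lt_trans a1.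
have pi0 := pi_gt0 R.
(* Midpoint of the admissible interval from pi/2 to pi/a, nonempty because a < 2. *)
pose th : R := (pi / 2 + pi / a) / 2.
have pia : pi / 2 < pi / a :> R by rewrite ltr_pM2l// ltf_pV2 ?posrE.
have th1 : pi / 2 < th by rewrite /th; move: pia; lra.
have ath : a * th < pi.
  have -> : a * th = a * pi / 4 + pi / 2 by rewrite /th; field; rewrite gt_eqF.
  have : a * pi < 2 * pi by rewrite ltr_pM2r.
  lra.
(* a pi lies strictly between pi and 2 pi; this sign makes the leading coefficient positive. *)
have sin0 : sin (a * pi) < 0.
  have -> : a * pi = (a - 1) * pi + pi by ring.
  rewrite sinDpi oppr_lt0 sin_gt0_pi// mulr_gt0 ?subr_gt0//=.
  by rewrite -[ltRHS]mul1r ltr_pM2r//; move: a2; lra.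
have G0 : 0 < Gamma a by apply: Gamma_gt0; exact: ltW.
have [C0 [C00 hle hdist]] : exists C0 : R, [/\ 0 <= C0,
    forall t, 0 < t -> `|Jrem a th t| <= C0 * t `^ (- (a + a)) &
    forall t1 t2, 0 < t1 -> t1 < t2 ->
      `|Jrem a th t1 - Jrem a th t2| <= C0 * (t1 `^ (- (a + a)) - t2 `^ (- (a + a)))].
  eexists; split; [exact: (Jrem_const_ge0 a1 th1 ath)|exact: (Jrem_le a1 th1 ath)|].
  exact: (Jrem_dist a1 th1 ath).
have sq (t : R) : 0 < t -> t `^ (- (a + a)) = t `^ (- a) ^+ 2.
  by move=> t0; rewrite opprD powRD ?expr2// (gt_eqF t0) implybT.
(* By the classical reflection formula this is -1 over the Gamma function continued to 1 - a. *)
pose A := - (sin (a * pi) * Gamma a) / pi.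
have fE (t : R) : 0 < t -> fml a t + A * t `^ (- a) = - Jrem a th t / pi.
  move=> t0; have := fml_Jray a12 th1 ath t0; rewrite (Jray_split a1 th1 ath t0) => h.
  have pn : pi != 0 :> R by exact: lt0r_neq0.
  apply: (mulfI pn); rewrite mulrDr h mulrA (mulrC pi A) divfK// [RHS]mulrC divfK//.
  by rewrite mulNr addrAC subrr add0r.
exists A, (C0 / pi); split.
- by rewrite divr_gt0// oppr_gt0 nmulr_rlt0.
- by rewrite divr_ge0// ltW.
- move=> t t0; rewrite fE// normrM normrN normfV (gtr0_norm pi0) -sq// mulrAC.
  by rewrite ler_pM2r ?invr_gt0// hle.
- move=> t1 t2 t10 t12; have t20 := lt_trans t10 t12.
  rewrite !fE// -mulrBl mulrAC ler_pM2r ?invr_gt0// -!sq//.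
  apply: le_trans (hdist _ _ t10 t12); rewrite -normrN opprB addrC opprK addrC.
  by apply: le_trans (ler_norm _); rewrite addrC.
Qed.

Lemma fml_decay (R : realType) (a : R) : 1 < a < 2 ->
  exists2 T0 : R, 0 < T0 & forall t : R, T0 <= t ->
    [/\ -1 <= fml a t, fml a t < 0 & forall k : R, 1 < k ->
        - fml a (k * t) <= (1 - (1 - k `^ (- a)) / 4) * (- fml a t)].
Proof.
move=> a12; have /andP[a1 a2] := a12; have a0 : 0 < a by exact: lt_trans a1.
have [A [C [A0 C0 hle hdist]]] := fml_asymptotics a12.
(* Threshold for t^(-a). The first entry gives C X <= A / 4, so that f stays within a quarter of - A
   t^(-a); C + 1 covers the case C = 0. The second gives A X <= 1/2, hence f >= - 5/8. *)
pose X := Num.min (A / (4 * (C + 1))) (1 / (2 * (A + 1))).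
have C10 : 0 < C + 1 by rewrite ltr_wpDl.
have A10 : 0 < A + 1 by rewrite addr_gt0.
have X0 : 0 < X by rewrite lt_min !divr_gt0// mulr_gt0.
have CX : C * X <= A / 4.
  apply: (@le_trans _ _ ((C + 1) * (A / (4 * (C + 1))))).
    by apply: ler_pM => //; [exact: ltW|rewrite lerDl|rewrite ge_min lexx].
  by rewrite le_eqVlt; apply/orP; left; apply/eqP; field; rewrite gt_eqF.
have AX : A * X <= 1 / 2.
  apply: (@le_trans _ _ ((A + 1) * (1 / (2 * (A + 1))))).
    by apply: ler_pM; [exact: ltW|exact: ltW|rewrite lerDl|rewrite ge_min lexx orbT].
  by rewrite le_eqVlt; apply/orP; left; apply/eqP; field; rewrite gt_eqF.
exists (X `^ (- a^-1)); first exact: powR_gt0.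
have main (t : R) : X `^ (- a^-1) <= t ->
    [/\ 0 < t, 0 < t `^ (- a), t `^ (- a) <= X, fml a t <= - (3 / 4 * (A * t `^ (- a))) &
        - (5 / 4 * (A * t `^ (- a))) <= fml a t].
  move=> Tt; have t0 : 0 < t by apply: lt_le_trans Tt; exact: powR_gt0.
  have x0 : 0 < t `^ (- a) by exact: powR_gt0.
  have xX : t `^ (- a) <= X.
    rewrite powRN -[leRHS]invrK lef_pV2 ?posrE ?powR_gt0 ?invr_gt0//.
    have -> : X^-1 = (X `^ (- a^-1)) `^ a.
      by rewrite -powRrM mulNr mulVf ?gt_eqF// powR_inv1// ltW.
    by apply: ge0_ler_powR; rewrite ?nnegrE ?powR_ge0 ?(ltW a0) ?(ltW t0).
  have h : C * t `^ (- a) ^+ 2 <= A / 4 * t `^ (- a).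
    rewrite expr2 mulrA ler_pM2r//; apply: le_trans CX.
    by rewrite ler_wpM2l.
  have := le_trans (hle _ t0) h; rewrite ler_norml => /andP[h1 h2].
  by split => //; move: h1 h2; lra.
move=> t Tt; have [t0 x0 xX f1 f2] := main t Tt.
have Ax0 : 0 < A * t `^ (- a) by rewrite mulr_gt0.
have Ax1 : A * t `^ (- a) <= 1 / 2 by apply: le_trans AX; rewrite ler_pM2l.
split; [by move: f2 Ax1; lra|by move: f1 Ax0; lra|move=> k k1].
have k0 : 0 < k by exact: lt_trans k1.
have tk : t < k * t by rewrite ltr_pMl.
have := hdist _ _ t0 tk; rewrite powRM ?(ltW k0) ?(ltW t0)//.
set r := k `^ (- a); have r0 : 0 < r by exact: powR_gt0.
have r1 : r < 1.
  rewrite /r powRN invf_lt1 ?powR_gt0// -(powRr0 k) /powR gt_eqF// ltr_expR mul0r.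
  by rewrite mulr_gt0// ln_gt0.
set x := t `^ (- a) in x0 xX f1 f2 Ax0 Ax1 *; set ft := fml a t in f1 f2 *.
set fk := fml a (k * t) => h.
have h1 : C * (x ^+ 2 - (r * x) ^+ 2) <= A / 2 * (x * (1 - r)).
  have -> : C * (x ^+ 2 - (r * x) ^+ 2) = C * x * (1 + r) * (x * (1 - r)) by ring.
  rewrite ler_wpM2r// ?mulr_ge0 ?subr_ge0 ?(ltW r1) ?(ltW x0)//.
  have : C * x <= A / 4 by apply: le_trans CX; rewrite ler_wpM2l.
  have : 0 <= C * x by rewrite mulr_ge0// ltW.
  by move: r0 r1; nra.
(* The remainder takes at most half of the main increment A x (1 - r). As - ft <= 5/4 A x, what is
   left is at least 2/5 of - ft (1 - r), and the claimed 1/4 follows. *)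
have h2 : A * (x - r * x) / 2 <= fk - ft by move: h h1; lra.
have h3 : - ft * (1 - r) <= 5 / 4 * (A * x) * (1 - r).
  by rewrite ler_wpM2r ?subr_ge0 ?(ltW r1)//; move: f2; lra.
have h4 : 0 <= A * x * (1 - r) by rewrite mulr_ge0 ?subr_ge0 ?(ltW r1) ?(ltW Ax0).
by move: h2 h3 h4; lra.
Qed.

(** * Positivity of Dirichlet eigenvalues *)

Lemma is_derive_line (R : realType) (V : normedModType R) (u : V -> R) (x e : V) (h : R) :
  derivable u (x + h *: e) e ->
  is_derive h 1 (fun k : R => u (x + k *: e)) ('D_e u (x + h *: e)).
Proof.
move=> du.
have E : (fun k : R => k^-1 *: (((fun k => u (x + k *: e)) \o shift h) (k *: (1 : R)) -
    u (x + h *: e))) =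
    (fun k : R => k^-1 *: ((u \o shift (x + h *: e)) (k *: e) - u (x + h *: e))).
  apply/funext => k /=; congr (_ *: (u _ - _)).
  by rewrite -[k *: 1]/(k * 1) mulr1 scalerDl addrCA.
by split; rewrite /derivable /derive E.
Qed.

(** If D were positive, g1 would be positive just to the right of its zero at 0, and the mean value
    theorem would make g exceed g 0 there. *)
Lemma second_derivative_max (R : realType) (g g1 : R -> R) (d D : R) : 0 < d ->
  (forall h : R, `|h| < d -> is_derive h 1 g (g1 h)) ->
  (forall h : R, `|h| < d -> g h <= g 0) -> is_derive (0 : R) 1 g1 D -> D <= 0.
Proof.
move=> d0 dg gmax [dg1 valD].
have itvP (h : R) : h \in `](- d), d[ -> `|h| < d.
  by rewrite in_itv/= ltr_norml.
have z : g1 0 = 0.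
  have Hd : is_derive (0 : R) 1 g (g1 0) by apply: dg; rewrite normr0.
  have H0 : is_derive (0 : R) 1 g 0.
    apply: (@derive1_at_max _ g (- d) d 0).
    - by move: d0; lra.
    - by move=> t /itvP/dg[].
    - by rewrite in_itv/= oppr_lt0 d0.
    - by move=> t /itvP; exact: gmax.
  by rewrite -(@derive_val _ _ _ _ _ _ _ Hd) (@derive_val _ _ _ _ _ _ _ H0).
rewrite leNgt; apply/negP => D0.
have cD : (fun h : R => h^-1 *: ((g1 \o shift 0) (h *: (1 : R)) - g1 0)) @ 0^' --> D.
  by rewrite -valD; exact: dg1.
move/cvgrPdist_lt : cD => /(_ _ D0) [e /= e0 he].
have g1pos (h : R) : 0 < h -> h < e -> 0 < g1 h.
  move=> h0 hl; have := he h; rewrite /= sub0r normrN (gtr0_norm h0) => /(_ hl (lt0r_neq0 h0)).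
  rewrite z subr0 /= addr0 -[h *: 1]/(h * 1) mulr1 => /(le_lt_trans (ler_norm _)).
  rewrite -[h^-1 *: _]/(h^-1 * _) => h1.
  have : 0 < h^-1 * g1 h by move: h1; lra.
  by rewrite pmulr_rgt0// invr_gt0.
pose m := Num.min d e / 2.
have mn0 : 0 < Num.min d e by rewrite lt_min d0.
have m0 : 0 < m by rewrite divr_gt0.
have md : m < d by apply: (@lt_le_trans _ _ (Num.min d e)); [rewrite /m; move: mn0; lra|rewrite ge_min lexx].
have me : m < e by apply: (@lt_le_trans _ _ (Num.min d e)); [rewrite /m; move: mn0; lra|rewrite ge_min lexx orbT].
have nd (h : R) : 0 <= h <= m -> `|h| < d.
  by move=> /andP[h0 hm]; rewrite ger0_norm// (le_lt_trans hm).
have [c c01 gE] : exists2 c, c \in `]0, m[ & g m - g 0 = g1 c * (m - 0).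
  apply: MVT => //.
  - by move=> h; rewrite in_itv/= => /andP[h0 hm]; apply: dg; rewrite nd// !ltW.
  - apply: derivable_within_continuous => h; rewrite in_itv/= => hm.
    by have [] := dg h (nd _ hm).
have := gmax m (nd m _); rewrite (ltW m0) lexx => /(_ isT).
have : 0 < g1 c * (m - 0).
  move: c01; rewrite in_itv/= => /andP[c0 cm].
  by rewrite subr0 mulr_gt0// g1pos// (lt_trans cm).
by rewrite -gE; lra.
Qed.

Section maximum_principle.
Variables (R : realType) (N : nat).
Local Notation E := 'rV[R]_N.
Implicit Types (Omega : set E) (u : E -> R).

Lemma compact_closure Omega : bounded_set Omega -> compact (closure Omega).
Proof.
move=> [M [Mr hM]].
pose B := [set x : E | `|x| <= M + 1].
have cB : closed B.
  apply: (@closed_comp _ _ (fun x : E => `|x|) [set r : R | r <= M + 1]); last exact: closed_le.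
  by move=> x _; exact: norm_continuous.
have sB : Omega `<=` B by move=> x Ox; apply: (hM (M + 1)) => //; rewrite ltrDl.
have bB : bounded_set B.
  by exists (M + 1); split; [exact: num_real|move=> y My x /= /le_trans; apply; exact: ltW].
apply: (subclosed_compact _ (bounded_closed_compact bB cB)); first exact: closed_closure.
by rewrite closureE; apply: smallest_sub.
Qed.

Lemma open_line Omega (x e : E) : open Omega -> Omega x ->
  exists2 d : R, 0 < d & forall h : R, `|h| < d -> Omega (x + h *: e).
Proof.
move=> oO Ox; have /nbhs_ballP[d /= d0 hd] : nbhs x Omega by exact: open_nbhs_nbhs.
have e0 : 0 < `|e| + 1 by rewrite ltr_wpDl.
exists (d / (`|e| + 1)); first by rewrite divr_gt0.
move=> h hh; apply: hd; rewrite -ball_normE/= opprD addrA subrr sub0r normrN normrZ.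
apply: (@le_lt_trans _ _ (`|h| * (`|e| + 1))); first by rewrite ler_wpM2l// lerDl.
by rewrite -ltr_pdivlMr.
Qed.

(* The strictly convex perturbation eps x_j^2 turns a nonnegative Laplacian at
   an interior maximum into a contradiction. *)
Lemma dirichlet_maximum_principle Omega (m : R) u (j : 'I_N) (c : R) (x : E) :
  bounded_domain Omega -> dirichlet_eigenspace Omega m u -> m <= 0 ->
  Omega x -> c * u x <= 0.
Proof.
move=> [oO _ _ bO] [uC uc ub ueq] m0 Ox; rewrite leNgt; apply/negP => cu0.
have cK := compact_closure bO; have Kx : closure Omega x by exact: subset_closure.
have K0 : closure Omega !=set0 by exists x.
have cj : continuous (fun y : E => y 0 j ^+ 2).
  have -> : (fun y : E => y 0 j ^+ 2) = (fun y => y 0 j * y 0 j).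
    by apply/funext => y; rewrite expr2.
  have cc := @coord_continuous R 1 N 0 j.
  by move=> y; apply: (cvgM (cc y) (cc y)).
have [z0 _ hz0] := compact_EVT_max K0 cK (continuous_subspaceT cj).
pose B := z0 0 j ^+ 2; have B0 : 0 <= B by exact: sqr_ge0.
have hB (y : E) : closure Omega y -> y 0 j ^+ 2 <= B by move=> Ky; apply: hz0; exact/mem_set.
(* Small enough that eps B < c u(x), where B bounds y_j^2 on the closure. At a maximum point z of
   the perturbed function c u(z) is then still positive, so z is not on the boundary, where u
   vanishes. *)
pose eps := c * u x / (2 * (B + 1)).
have B10 : 0 < B + 1 by rewrite ltr_wpDl.
have eps0 : 0 < eps by rewrite divr_gt0// mulr_gt0.
have epsB : eps * B < c * u x.
  have h : eps * (B + 1) * 2 = c * u x by rewrite /eps; field; rewrite gt_eqF.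
  by have := mulr_ge0 (ltW eps0) B0; move: h eps0; lra.
pose v (y : E) := c * u y + eps * y 0 j ^+ 2.
have cv : {within closure Omega, continuous v}.
  move=> y; apply: cvgD; first by apply: cvgM; [exact: cvg_cst|exact: uc].
  apply: cvgM; first exact: cvg_cst.
  exact: (continuous_subspaceT cj).
have [z Kz hz] := compact_EVT_max K0 cK cv.
have {}Kz : closure Omega z by exact/set_mem.
have vz : c * u x <= v z.
  apply: (@le_trans _ _ (v x)); last by apply: hz; exact/mem_set.
  by rewrite /v lerDl mulr_ge0 ?sqr_ge0// ltW.
have cuz : 0 < c * u z.
  have : eps * z 0 j ^+ 2 <= eps * B by rewrite ler_pM2l// hB.
  by move: vz epsB; rewrite /v; lra.
have Oz : Omega z.
  have [//|nO] := pselect (Omega z); exfalso.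
  have bz : boundary Omega z by split => //; rewrite (interior_id Omega).1.
  by move: cuz; rewrite (ub _ bz) mulr0 ltxx.
have test (i : 'I_N) : c * partial i (partial i u) z + 2 * eps * (i == j)%:R <= 0.
  pose e : E := delta_mx 0 i; pose b : R := (i == j)%:R.
  have [d d0 hd] := open_line e oO Oz.
  have du (h : R) : `|h| < d -> is_derive h 1 (fun k : R => u (z + k *: e)) (partial i u (z + h *: e)).
    by move=> hh; apply: is_derive_line; exact: (uC.2 i).1 (hd _ hh).
  have ddu : is_derive (0 : R) 1 (fun k : R => partial i u (z + k *: e)) (partial i (partial i u) z).
    have := @is_derive_line _ _ (partial i u) z e 0; rewrite scale0r addr0; apply.
    exact: ((uC.2 i).2.2 i).1.
  have vE (h : R) : v (z + h *: e) = c * u (z + h *: e) + eps * (z 0 j + h * b) ^+ 2.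
    by rewrite /v !mxE eqxx/= [j == i]eq_sym.
  pose g (h : R) := c * u (z + h *: e) + eps * (z 0 j + h * b) ^+ 2.
  pose g1 (h : R) := c * partial i u (z + h *: e) + 2 * eps * b * (z 0 j + h * b).
  have dl (h : R) : is_derive h 1 (fun k : R => z 0 j + k * b) b.
    have h1 := is_derive_addfun (is_derive_cst (z 0 j) h 1) (is_derive_mull b h).
    rewrite add0r in h1; rewrite (_ : (fun k => _) = (fun y => cst (z 0 j) y + b * y))//.
    by apply/funext => k /=; rewrite mulrC.
  have b2 : b * b = b by rewrite /b; case: (i == j); rewrite ?mulr1 ?mulr0.
  apply: (@second_derivative_max _ g g1 d) => //.
  - move=> h hh.
    have h1 := is_derive_mulfun (is_derive_cst c h 1) (du h hh).
    have h2 := is_derive_mulfun (is_derive_cst eps h 1) (is_derive_mulfun (dl h) (dl h)).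
    have h3 := is_derive_addfun h1 h2.
    apply: is_derive_eq h3 _; rewrite /g1 /cst; ring.
  - move=> h hh; have := hz (z + h *: e); rewrite vE /g.
    rewrite scale0r addr0 mul0r addr0 => /(_ _)/le_trans; apply; last by [].
    by apply/mem_set; apply: subset_closure; exact: hd.
  - have h1 := is_derive_mulfun (is_derive_cst c (0 : R) 1) ddu.
    have h2 := is_derive_mulfun (is_derive_cst (2 * eps * b) (0 : R) 1) (dl 0).
    have h3 := is_derive_addfun h1 h2.
    apply: is_derive_eq h3 _.
    by rewrite /cst !mul0r !add0r -[2 * eps * b * b]mulrA b2.
have : \sum_(i < N) (c * partial i (partial i u) z + 2 * eps * (i == j)%:R) <= 0.
  by apply: sumr_le0 => i _; exact: test.
rewrite big_split/= -!mulr_sumr.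
have -> : \sum_(i < N) (i == j)%:R = 1 :> R.
  by rewrite (bigD1 j)//= eqxx big1 ?addr0// => i /negbTE ->.
rewrite mulr1.
have -> : \sum_(i < N) partial i (partial i u) z = - (m * u z).
  by rewrite -(ueq _ Oz) opprK.
(* Since the Laplacian of u is - m u, the summed second derivative tests read - m c u(z) + 2 eps <=
   0, impossible for m <= 0. *)
have : m * (c * u z) <= 0 by rewrite mulr_le0_ge0// ltW.
by move: eps0; rewrite mulrCA mulrN; lra.
Qed.

(** The index n lies in its own level set, so the multiplicity is positive; a basis whose members
    all vanish on Omega would contradict linear independence. *)
Lemma dirichlet_eigenvalues_mult Omega (l : nat -> R) (n : nat) :
  dirichlet_eigenvalues Omega l ->
  exists2 u : E -> R, dirichlet_eigenspace Omega (l n) u &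
    exists2 x, Omega x & u x != 0.
Proof.
move=> [_ /(_ (l n))[m [cm [f [fe ff _]]]]].
apply: contrapT => nex.
have z (i : 'I_m) (x : E) : Omega x -> f i x = 0.
  move=> Ox; apply/eqP/negP => /negP fx; apply: nex.
  by exists (f i) => //; exists x.
case: m => [|m] in cm f fe ff z *.
  move: cm; rewrite II0 card_eq0 => /eqP/seteqP[/(_ n) h _].
  exact: h.
have h (x : E) : Omega x -> \sum_(i < m.+1) 1 * f i x = 0.
  by move=> Ox; rewrite big1// => i _; rewrite z// mulr0.
by have /eqP := ff (fun=> 1) h ord0; rewrite oner_eq0.
Qed.

(** Taking c = u(x) turns the maximum principle into u(x)^2 <= 0, so both signs of u are handled at
    once. *)
Lemma dirichlet_eigenvalues_gt0 Omega (l : nat -> R) (n : nat) : (0 < N)%N ->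
  bounded_domain Omega -> dirichlet_eigenvalues Omega l -> 0 < l n.
Proof.
move=> N0 bO /(dirichlet_eigenvalues_mult n)[u ue [x Ox ux]].
rewrite ltNge; apply/negP => l0.
have := dirichlet_maximum_principle (Ordinal N0) (u x) bO ue l0 Ox.
by rewrite -expr2 leNgt exprn_even_gt0//= ux.
Qed.

(** [Tstar] is chosen from one sequence before the sequence of the theorem is given. An eigenvalue
    of [l] has a nonzero eigenfunction, which rules out multiplicity 0 for [l']. *)
Lemma dirichlet_eigenvalues_range Omega (l l' : nat -> R) (n : nat) :
  dirichlet_eigenvalues Omega l -> dirichlet_eigenvalues Omega l' ->
  exists k : nat, l' k = l n.
Proof.
move=> /(dirichlet_eigenvalues_mult n)[u ue [x Ox ux]].
move=> [_ /(_ (l n))[m [cm [f [_ _ fs]]]]].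
apply: contrapT => nex.
have : ([set k | l' k = l n] = set0).
  by apply/seteqP; split => k //= kl; apply: nex; exists k.
move=> e; rewrite e card_eq_sym card_eq0 in cm.
case: m => [|m] in cm f fs *.
  have [b /(_ x Ox)] := fs u ue; rewrite big_ord0 => u0.
  by rewrite u0 eqxx in ux.
by move: cm => /eqP/seteqP[/(_ 0%N) h _]; exact: h.
Qed.

End maximum_principle.

(** * The quotient *)

Lemma S_ml_fml (R : realType) (a l t : R) : 0 < a -> 0 < l -> 0 <= t ->
  S_ml a l t = fml a (l `^ a^-1 * t).
Proof.
move=> a0 l0 t0; rewrite /S_ml /fml powRM ?powR_ge0// -powRrM mulVf ?gt_eqF//.
by rewrite powRr1 ?(ltW l0)// mulNr.
Qed.

Lemma Q_ml_S_ml (R : realType) (a l t : R) : 0 < a -> 0 < l ->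
  Q_ml a l t = (1 - S_ml a l t) / l.
Proof.
move=> a0 l0; rewrite /S_ml ml_shift// /Q_ml.
by field; rewrite gt_eqF.
Qed.

(** In terms of u_i = - s_i the quotient increases with u_2 and, along u_2 = q u_1, with u_1; the
    bound is its value at u_1 = 1, u_2 = q. *)
Lemma ratio_bound (R : realType) (l s1 s2 q : R) : 0 < l -> -1 <= s1 -> s1 < 0 ->
  s2 < 0 -> 0 < q < 1 -> - s2 <= q * (- s1) ->
  0 < ((1 - s1) / l * s2) / (s1 * ((1 - s2) / l)) <= 2 * q / (1 + q).
Proof.
move=> l0 s1m s10 s20 /andP[q0 q1] s12.
have ln : l != 0 by rewrite gt_eqF.
have s1n : s1 != 0 by rewrite lt_eqF.
have w0 : 0 < 1 - s2 by move: s20; lra.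
have w1 : 0 < 1 - s1 by move: s10; lra.
have wn : 1 - s2 != 0 by rewrite gt_eqF.
have -> : ((1 - s1) / l * s2) / (s1 * ((1 - s2) / l)) =
    ((1 - s1) * - s2) / (- s1 * (1 - s2)).
  by field; rewrite ?oppr_eq0 ?ln ?s1n ?wn.
have d0 : 0 < - s1 * (1 - s2) by rewrite mulr_gt0// oppr_gt0.
have q10 : 0 < 1 + q by rewrite addr_gt0.
rewrite divr_gt0 ?mulr_gt0 ?oppr_gt0//= ler_pdivrMr// mulrAC ler_pdivlMr//.
rewrite -subr_ge0.
have -> : 2 * q * (- s1 * (1 - s2)) - (1 - s1) * - s2 * (1 + q) =
    q * - s1 * ((1 - q) * (1 + s1)) +
    (q * - s1 - - s2) * (1 + q + - s1 * (1 - q)) by ring.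
have s1p : 0 <= - s1 by rewrite oppr_ge0 ltW.
have qp : 0 <= 1 - q by rewrite subr_ge0 ltW.
apply: addr_ge0; apply: mulr_ge0.
- by rewrite mulr_ge0// ltW.
- by rewrite mulr_ge0//; move: s1m; lra.
- by rewrite subr_ge0.
- by rewrite addr_ge0 ?(ltW q10)// mulr_ge0.
Qed.

Lemma ratio_bound_lt1 (R : realType) (q : R) : 0 < q < 1 -> 2 * q / (1 + q) < 1.
Proof.
move=> /andP[q0 q1]; have q10 : 0 < 1 + q by rewrite addr_gt0.
by rewrite ltr_pdivrMr// mul1r; lra.
Qed.

Theorem lemma2p8 (R : realType) (N : nat) (hN : (1 <= N <= 3)%N)
  (Omega : set 'rV[R]_N) (hOmega : bounded_domain Omega)
  (hsmooth : C_boundary 2 Omega)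
  (alpha : R) (halpha : 1 < alpha < 2) :
  exists Tstar : R, 0 < Tstar /\
    forall T1 T2 : R, Tstar <= T1 -> T1 < T2 ->
    exists d : R, d < 1 /\
      forall lambda : nat -> R, dirichlet_eigenvalues Omega lambda ->
      forall n : nat,
        0 < (Q_ml alpha (lambda n) T1 * S_ml alpha (lambda n) T2)
            / (S_ml alpha (lambda n) T1 * Q_ml alpha (lambda n) T2) <= d.
Proof.
have /andP[N0 _] := hN; have /andP[a1 a2] := halpha.
have a0 : 0 < alpha by exact: lt_trans a1.
have [T0 T00 hT] := fml_decay halpha.
(* If no eigenvalue sequence exists the conclusion is vacuous and any positive scale serves. *)
have [[l0 hl0]|none] := pselect (exists l, dirichlet_eigenvalues Omega l); last first.
  exists 1; split => // T1 T2 _ _; exists 0; split => // l hl.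
  by case: none; exists l.
have l00 : 0 < l0 0%N := dirichlet_eigenvalues_gt0 0%N N0 hOmega hl0.
pose c := l0 0%N `^ alpha^-1; have c0 : 0 < c by exact: powR_gt0.
(* c is the least eigenvalue to the power 1/alpha, so every rescaled time lambda_n^(1/alpha) T1 is
   at least c T1 >= T0. *)
exists (T0 / c); split; first by rewrite divr_gt0.
move=> T1 T2 T1le T12.
have T10 : 0 < T1 by apply: lt_le_trans T1le; rewrite divr_gt0.
have T20 := lt_trans T10 T12.
pose k := T2 / T1; have k1 : 1 < k by rewrite ltr_pdivlMr// mul1r.
have k0 : 0 < k by exact: lt_trans k1.
pose r := k `^ (- alpha); have r0 : 0 < r by exact: powR_gt0.
have r1 : r < 1.
  rewrite /r powRN invf_lt1 ?powR_gt0// -(powRr0 k) /powR gt_eqF// ltr_expR mul0r.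
  by rewrite mulr_gt0// ln_gt0.
pose q := 1 - (1 - r) / 4; have q01 : 0 < q < 1 by rewrite /q; move: r0 r1; lra.
exists (2 * q / (1 + q)); split; first exact: ratio_bound_lt1.
move=> l hl n; have ln0 : 0 < l n := dirichlet_eigenvalues_gt0 n N0 hOmega hl.
have [i li] := dirichlet_eigenvalues_range n hl hl0.
have lle : l0 0%N <= l n by rewrite -li; apply: hl0.1.
pose t := l n `^ alpha^-1 * T1.
have Tt : T0 <= t.
  move: T1le; rewrite ler_pdivrMr// mulrC => /le_trans; apply.
  rewrite ler_pM2r// /c ge0_ler_powR ?nnegrE ?invr_ge0 ?(ltW a0) ?(ltW l00) ?(ltW ln0)//.
have t0 : 0 < t by exact: lt_le_trans Tt.
have kt : l n `^ alpha^-1 * T2 = k * t.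
  by rewrite /k /t mulrCA divfK// gt_eqF.
rewrite !Q_ml_S_ml// !S_ml_fml ?(ltW T10) ?(ltW T20)// kt -/t.
have [f1 f10 hk] := hT t Tt.
have Tkt : T0 <= k * t by apply: le_trans Tt _; rewrite ler_peMl// ltW.
have [_ f20 _] := hT (k * t) Tkt.
by apply: ratio_bound => //; exact: hk.
Qed.
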